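(* Let $0<\alpha<1$ and let $p$ be a prime. For each $n$, let $M$ be a random symmetric matrix in $M_n(\mathbb Z)$ whose entries $m_{ij}$, $1\le i\le j\le n$, are independent, and such that $\Pr(m_{ij}\equiv t\bmod p)\le 1-\alpha$ for every $t\in\mathbb Z/p\mathbb Z$ and all $i\le j$. Let $\mathrm{cok}(M)_p$ be the Sylow $p$-subgroup of $\mathrm{cok}(M)=\mathbb Z^n/\mathrm{col}(M)$ and let $\langle\cdot,\cdot\rangle_{p}$ be the restriction to $\mathrm{cok}(M)_p$ of the canonical duality pairing on the torsion subgroup of $\mathrm{cok}(M)$. Then for every finite abelian $p$-group $G$ with a duality pairing $\langle\cdot,\cdot\rangle_G$, \[\lim_{n\to\infty}\Pr\big((\mathrm{cok}(M)_p,\langle\cdot,\cdot\rangle_{p})\simeq(G,\langle\cdot,\cdot\rangle_G)\big)=\frac{\prod_{k\ge1}(1-p^{1-2k})}{|G|\,|\mathrm{Aut}(G,\langle\cdot,\cdot\rangle_G)|}.\]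
   Context: $\mathrm{col}(M)=M\mathbb Z^n$. For symmetric $M\in M_n(\mathbb Z)$ the torsion subgroup of $\mathrm{cok}(M)$ is $\ker(M)^\perp/\mathrm{col}(M)$ ($\perp$ w.r.t. the standard dot product). Its canonical (Bosch–Lorenzini) duality pairing: for torsion $\tau,\tau'$ choose lifts $T,T'\in\ker(M)^\perp$, positive integers $k,k'$ and $S,S'\in\mathbb Z^n$ with $MS=kT$, $MS'=k'T'$, and set $\langle\tau,\tau'\rangle=S^tMS'/(kk')\bmod\mathbb Z$. A duality pairing on a finite abelian group $A$ is a symmetric bilinear map $A\times A\to\mathbb Q/\mathbb Z$ inducing an isomorphism $A\to\mathrm{Hom}(A,\mathbb Q/\mathbb Z)$. An isomorphism of groups with pairings is a group isomorphism preserving the pairings; $\mathrm{Aut}(G,\langle\cdot,\cdot\rangle_G)$ is the group of pairing-preserving automorphisms of $G$. *)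

(* Defs.v *)
From HB Require Import structures.
From mathcomp Require Import all_boot all_order all_algebra all_fingroup.
From mathcomp Require Import generic_quotient ring_quotient.
From mathcomp Require Import zify.
From mathcomp Require Import all_classical all_reals all_analysis.

Set Implicit Arguments.
Unset Strict Implicit.
Unset Printing Implicit Defensive.

Import Order.TTheory GRing.Theory Num.Theory.
Import numFieldNormedType.Exports.

Local Open Scope classical_set_scope.
Local Open Scope ring_scope.
Local Open Scope quotient_scope.

Section colspan.
Variables (n : nat) (M : 'M[int]_n).

Definition colspan : pred 'cV[int]_n :=
  fun v => `[< exists s : 'cV[int]_n, v = M *m s >].

Lemma colspan_zmod_closed : zmod_closed colspan.
Proof.
split=> [|u v /asboolP[s ->] /asboolP[t ->]].
  by apply/asboolP; exists 0; rewrite mulmx0.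
by apply/asboolP; exists (s - t); rewrite mulmxBr.
Qed.

HB.instance Definition _ :=
  GRing.isZmodClosed.Build 'cV[int]_n colspan colspan_zmod_closed.

Definition colgroup : zmodClosed 'cV[int]_n :=
  GRing.ZmodClosed.clone _ colspan _.

Definition cok : zmodType := Quotient.quot colgroup.

Definition cok_class (v : 'cV[int]_n) : cok := \pi_(Quotient.quot colgroup) v.

End colspan.

Definition int_in_rat : zmodClosed rat :=
  GRing.ZmodClosed.clone rat Num.int_num_subdef _.

Definition QmodZ : zmodType := Quotient.quot int_in_rat.

Definition qz (q : rat) : QmodZ := \pi_(Quotient.quot int_in_rat) q.

(* The p-Sylow subgroup of a possibly infinite abelian group: the subgroup of
   the elements whose order is a power of p. *)
Section sylow.
Variables (p : nat) (V : zmodType).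

Definition ppower_torsion : pred V :=
  fun x => `[< exists k : nat, x *+ (p ^ k)%N = 0 >].

Lemma ppower_torsion_zmod_closed : zmod_closed ppower_torsion.
Proof.
split=> [|x y /asboolP[k xk] /asboolP[l yl]].
  by apply/asboolP; exists 0%N; rewrite mul0rn.
apply/asboolP; exists (k + l)%N; rewrite expnD mulrnBl mulrnA xk mul0rn.
by rewrite mulnC mulrnA yl mul0rn subrr.
Qed.

HB.instance Definition _ :=
  GRing.isZmodClosed.Build V ppower_torsion ppower_torsion_zmod_closed.

Record sylow := Sylow { sylow_val :> V; _ : sylow_val \in ppower_torsion }.

HB.instance Definition _ := [isSub for sylow_val].
HB.instance Definition _ := [Choice of sylow by <:].
HB.instance Definition _ := [SubChoice_isSubZmodule of sylow by <:].

End sylow.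

Section canonical_pairing.
Variables (n : nat) (M : 'M[int]_n).
Implicit Types (x y : cok M) (q : QmodZ).

Definition dot (u v : 'cV[int]_n) : int := (u^T *m v) ord0 ord0.

Definition ker_perp : set 'cV[int]_n :=
  [set u | forall v, M *m v = 0 -> dot u v = 0].

(* q is the value <x, y> computed from some admissible choice of lifts. *)
Definition pairing_value x y q : Prop :=
  exists (T T' S S' : 'cV[int]_n) (k k' : nat),
    [/\ ker_perp T /\ ker_perp T', cok_class M T = x /\ cok_class M T' = y,
        (0 < k)%N /\ (0 < k')%N, M *m S = T *+ k /\ M *m S' = T' *+ k'
      & q = qz ((dot S (M *m S'))%:~R / (k * k')%N%:R)].

(* The default 0 is only used when x or y is not a torsion element; for
   symmetric M the value does not depend on the choices, see
   canonical_pairingE. *)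
Definition canonical_pairing x y : QmodZ := xget 0 [set q | pairing_value x y q].

End canonical_pairing.

Definition sylow_pairing (p n : nat) (M : 'M[int]_n)
    (x y : sylow p (cok M)) : QmodZ :=
  canonical_pairing (x : cok M) (y : cok M).

Section canonical_pairing_theory.
Variables (n : nat) (M : 'M[int]_n).
Hypothesis symM : M^T = M.

Lemma dotC (u v : 'cV[int]_n) : dot u v = dot v u.
Proof. by rewrite /dot -[v in LHS]trmxK -trmx_mul mxE. Qed.

Lemma dot_sym (u v : 'cV[int]_n) : dot u (M *m v) = dot (M *m u) v.
Proof. by rewrite /dot trmx_mul symM mulmxA. Qed.

Lemma dotMnl (u v : 'cV[int]_n) k : dot (u *+ k) v = dot u v *+ k.
Proof. by rewrite /dot -scaler_nat linearZ/= -scalemxAl mxE mulr_natl. Qed.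

Lemma dotBl (u v w : 'cV[int]_n) : dot (u - v) w = dot u w - dot v w.
Proof. by rewrite /dot linearB/= mulmxBl !mxE. Qed.

Lemma cok_classP (u v : 'cV[int]_n) :
  cok_class M u = cok_class M v <-> exists s, u - v = M *m s.
Proof.
have -> : (cok_class M u = cok_class M v) <-> (u - v) \in colspan M.
  rewrite (Quotient.idealrBE (colgroup M)).
  by split=> [h|/eqP h]; [apply/eqP|].
by split=> /asboolP.
Qed.

Lemma qzP (a b : rat) : qz a = qz b <-> a - b \is a Num.int.
Proof.
rewrite /qz; split=> [/eqP|h].
  by rewrite -(Quotient.idealrBE int_in_rat).
by apply/eqP; rewrite -(Quotient.idealrBE int_in_rat).
Qed.

Lemma pairing_value_uniq (x y : cok M) q r :
  pairing_value x y q -> pairing_value x y r -> q = r.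
Proof.
suff half (T T1 T' S S1 S' : 'cV[int]_n) (k k1 k' : nat) :
    cok_class M T = cok_class M T1 -> (0 < k)%N -> (0 < k1)%N -> (0 < k')%N ->
    M *m S = T *+ k -> M *m S1 = T1 *+ k1 -> M *m S' = T' *+ k' ->
    qz ((dot S (M *m S'))%:~R / (k * k')%N%:R) =
    qz ((dot S1 (M *m S'))%:~R / (k1 * k')%N%:R).
  move=> [T [T' [S [S' [k [k' [_ [Tx T'y] [k0 k'0] [MS MS'] ->]]]]]]].
  move=> [U [U' [V [V' [l [l' [_ [Ux U'y] [l0 l'0] [MV MV'] ->]]]]]]].
  rewrite (half T U T' S V S' k l k') ?Tx ?Ux//.
  have dotMC (u v : 'cV[int]_n) : dot u (M *m v) = dot v (M *m u).
    by rewrite dot_sym dotC.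
  rewrite (dotMC V S') [(l * k')%N]mulnC.
  rewrite (half T' U' U S' V' V k' l' l) ?T'y ?U'y//.
  by rewrite (dotMC V' V) mulnC.
move=> /cok_classP[u Tu] k0 k10 k'0 MS MS1 MS'.
have red (s t : 'cV[int]_n) (j : nat) : (0 < j)%N -> M *m s = t *+ j ->
    (dot s (M *m S'))%:~R / (j * k')%N%:R = (dot t S')%:~R / k'%:R :> rat.
  move=> j0 Ms; rewrite dot_sym Ms dotMnl rmorphMn/= -mulr_natl natrM.
  by rewrite -mulf_div divff ?mul1r// pnatr_eq0 -lt0n.
rewrite (red _ _ _ k0 MS) (red _ _ _ k10 MS1).
apply/qzP; rewrite -mulrBl -intrB -dotBl Tu -dot_sym MS' dotC dotMnl.
rewrite rmorphMn/= -mulr_natr mulfK ?pnatr_eq0 -?lt0n//.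
Qed.

Lemma sylow_pairing_value (p : nat) (x y : sylow p (cok M)) :
  (0 < p)%N -> exists q, pairing_value (x : cok M) (y : cok M) q.
Proof.
move=> p0.
have lift (z : sylow p (cok M)) : exists (T S : 'cV[int]_n) (k : nat),
    [/\ ker_perp M T, cok_class M T = z, (0 < k)%N & M *m S = T *+ k].
  have /asboolP[a za] : ppower_torsion p (sylow_val z) by case: z.
  pose T : 'cV[int]_n := repr (sylow_val z).
  have Tz : cok_class M T = z by exact: reprK.
  have /cok_classP[S TS] : cok_class M (T *+ p ^ a) = cok_class M 0.
    by rewrite /cok_class raddfMn raddf0 -[RHS]za -Tz.
  have ka : (0 < p ^ a)%N by rewrite expn_gt0 p0.
  rewrite subr0 in TS; exists T, S, (p ^ a)%N; split=> // v Mv.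
  have : dot T v *+ p ^ a = 0.
    by rewrite -dotMnl TS -dot_sym Mv /dot mulmx0 mxE.
  by move/eqP; rewrite mulrn_eq0 gtn_eqF //= => /eqP.
have [T [S [k [? ? ? ?]]]] := lift x.
have [T' [S' [k' [? ? ? ?]]]] := lift y.
by eexists; exists T, T', S, S', k, k'; split.
Qed.

Lemma canonical_pairingE (x y : cok M) q :
  pairing_value x y q -> canonical_pairing x y = q.
Proof.
move=> xyq; apply: (@pairing_value_uniq x y) (xyq).
exact: (xgetPex 0 (ex_intro _ q xyq)).
Qed.

End canonical_pairing_theory.

Definition is_duality_pairing (A : zmodType) (b : A -> A -> QmodZ) : Prop :=
  [/\ forall x y, b x y = b y x,
      forall x y z, b (x + y) z = b x z + b y z
    & forall chi : {additive A -> QmodZ}, exists! a, forall x, b a x = chi x].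

Definition pairing_isomorphic (A B : zmodType)
    (bA : A -> A -> QmodZ) (bB : B -> B -> QmodZ) : Prop :=
  exists2 f : {additive A -> B},
    bijective f & forall x y, bB (f x) (f y) = bA x y.

Definition pairing_Aut (G : finZmodType) (b : G -> G -> QmodZ) : {set {perm G}} :=
  [set f in Aut [set: G] | [forall x, forall y, b (f x) (f y) == b x y]]%SET.

(* Integer-valued random variables, int carrying the discrete sigma-algebra. *)
Definition int_random_variable (d : measure_display) (T : measurableType d)
    (X : T -> int) : Prop :=
  forall B : set int, measurable (X @^-1` B).

Definition mutually_independent (R : realType) (d : measure_display)
    (T : measurableType d) (P : probability T R) (I : finType)
    (X : I -> T -> int) : Prop :=
  forall (J : {set I}) (B : I -> set int),
    P [set w | forall i, i \in J -> B i (X i w)] =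
    (\prod_(i in J) P (X i @^-1` B i))%E.

Definition upper_index (n : nat) : finType :=
  {ij : 'I_n * 'I_n | (ij.1 <= ij.2)%N}.

Definition upper_entry (n : nat) (T : Type) (M : T -> 'M[int]_n)
    (ij : upper_index n) : T -> int :=
  fun w => M w (val ij).1 (val ij).2.

Definition odd_power_product (R : realType) (p : nat) : R :=
  limn (fun N => \prod_(1 <= k < N.+1) (1 - p%:R ^ (1 - 2 * k%:Z)) : R).

Lemma is_cvg_odd_power_product (R : realType) (p : nat) : (0 < p)%N ->
  cvgn (fun N => \prod_(1 <= k < N.+1) (1 - p%:R ^ (1 - 2 * k%:Z)) : R).
Proof.
move=> p0.
have factor01 k : (0 < k)%N -> 0 <= 1 - (p%:R : R) ^ (1 - 2 * k%:Z) <= 1.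
  move=> k0; have -> : 1 - 2 * k%:Z = - (k.*2.-1)%:Z by lia.
  rewrite -exprnN subr_ge0 lerBlDr lerDl invr_ge0 exprn_ge0// andbT.
  by rewrite invf_le1 ?exprn_gt0 ?ltr0n// exprn_ege1// ler1n.
apply: nonincreasing_is_cvgn => [|].
  apply/nonincreasing_seqP => N; rewrite [leLHS]big_nat_recr//=.
  apply: ler_piMr; last by have /andP[] := factor01 N.+1 isT.
  rewrite big_nat; apply: prodr_ge0 => k /andP[k0 _].
  by have /andP[] := factor01 k k0.
exists 0 => _ [N _ <-]; rewrite big_nat; apply: prodr_ge0 => k /andP[k0 _].
by have /andP[] := factor01 k k0.
Qed.

(* Main.v *)
(** Fix a large modulus q = p^(l+1), a basis g_a of G of orders p^(e_a), and the
    dual basis k_a = sum_b theta_ab g_b with respect to the pairing of G. An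
    r x n matrix Y modulo q describes a homomorphism Z^n -> G. It kills col(M)
    and transports the canonical pairing to that of G exactly when Y M and
    Y M Y^T satisfy congruences ([quad_cond]), and when moreover M mod p has
    corank r it induces an isomorphism from the Sylow p-subgroup onto G. Hence for
    nonsingular M the number of such Y is a constant times |Aut(G)| if cok(M)_p
    is isomorphic to G, and 0 otherwise: the probability becomes the expectation
    of a count that only depends on M mod q.

    Expanding the count in additive characters of Z/q, the isotropic terms do not
    depend on the law of M, and the balanced entries make all the others
    negligible ([near_nonisotropic_sum]); so the uniform law may be used instead
    ([universality]). The corank condition is approximated by polynomials in
    the number of kernel vectors of M mod p, powers of which only add rows to Y.
    For uniform M a change of basis brings Y to the form (I 0), and the kernel of
    a uniform symmetric matrix mod p obeys a recurrence in n, which yields the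
    product of the 1 - p^(1-2k). Finally a singular M has at least p^l primitive
    kernel vectors modulo q, while the expected number of these is bounded. *)

Require Import Defs.
From HB Require Import structures.
From mathcomp Require Import all_boot all_order all_algebra all_fingroup pgroup.
From mathcomp Require Import all_classical all_reals all_analysis.
From mathcomp Require Import gproduct cyclic abelian separable cyclotomic complex zify ring lra.

Set Implicit Arguments.
Unset Strict Implicit.
Unset Printing Implicit Defensive.

Import Order.TTheory GRing.Theory Num.Theory.
Import numFieldNormedType.Exports.

Local Open Scope classical_set_scope.
Local Open Scope ring_scope.

(** * Sums over non-isotropic configurations *)

(** A given Y satisfies the congruences with exponentially small probability, and there are
    exponentially many Y. The expected count is of order A^n, where A is the product of the orders
    of the annihilators of the weights, and the error has to be o(A^n): no exponential loss is
    affordable. For this reason the i-th column of Y and the i-th column of dual variables are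
    joined into one vector x_i. In the character sum the coefficient of m_ij is then a bilinear form
    in x_i and x_j, every nonzero coefficient costs a factor rho < 1, and configurations with few
    nonzero coefficients essentially live in a set S orthogonal to itself. By Parseval such a set
    has at most Lam elements, and Lam^n divided by the number of characters is again of order A^n.
    The moments of the number of kernel vectors grow roughly like p^(k(k-1)/2), too fast for a
    classical moment argument. But this number is a power of p: a polynomial that is 1 at p^r and 0
    at the next J powers leaves an error that decays geometrically in J. *)

Section isotropic_sum.
Variables (W : finType) (orth : rel W) (nil : pred W).

(** [W] stands for the possible vectors x_i, [orth] for a vanishing coefficient of m_ij with i < j,
    and [nil] for a vanishing coefficient of m_ii. The two differ because a diagonal entry carries
    the form itself and not its symmetrisation. *)
Definition pair_ok n (x : {ffun 'I_n -> W}) (u : upper_index n) : bool :=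
  if (val u).1 == (val u).2 then nil (x (val u).1)
  else orth (x (val u).1) (x (val u).2).

Definition defects n (x : {ffun 'I_n -> W}) : nat :=
  #|[pred u | ~~ pair_ok x u]|.

Definition isotropic n (x : {ffun 'I_n -> W}) : bool :=
  [forall u, pair_ok x u].

Definition perp (S : {set W}) : {set W} :=
  [set w | [forall s in S, orth w s]]%SET.

Definition nonorth_pairs n (x : {ffun 'I_n -> W}) : {set 'I_n * 'I_n} :=
  [set ik | (ik.1 != ik.2) && ~~ orth (x ik.1) (x ik.2)]%SET.

Hypothesis orthC : symmetric orth.

Lemma nonorth_pairs_le n (x : {ffun 'I_n -> W}) :
  (#|nonorth_pairs x| <= 2 * defects x)%N.
Proof.
pose A := [set ik : 'I_n * 'I_n | (ik.1 < ik.2)%N &&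
             ~~ orth (x ik.1) (x ik.2)]%SET.
pose swap (ik : 'I_n * 'I_n) := (ik.2, ik.1).
have Ale : (#|A| <= defects x)%N.
  apply: leq_trans (leq_image_card val _); apply: subset_leq_card.
  apply/fintype.subsetP => -[i k] ikA.
  have /andP[ik nik] : (i < k)%N && ~~ orth (x i) (x k) by rewrite inE in ikA.
  have ik' : (i <= k)%N by exact: ltnW.
  apply/fintype.imageP; exists (exist _ (i, k) ik') => //=.
  by rewrite inE /pair_ok /= -val_eqE /= ltn_eqF.
have sub : nonorth_pairs x \subset A :|: swap @: A.
  apply/fintype.subsetP => -[i k]; rewrite !inE /= => /andP[ik nik].
  move: ik; rewrite -val_eqE neq_ltn => /orP[ik|ki]; apply/orP; [left|right].
    by rewrite ik.
  by apply/imsetP; exists (k, i); rewrite // inE /= ki /= orthC.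
apply: leq_trans (subset_leq_card sub) _.
apply: leq_trans (leq_card_setU _ _) _.
rewrite mul2n -addnn leq_add //; apply: leq_trans Ale.
exact: leq_imset_card.
Qed.

Lemma sum_config_prod (R : comNzRingType) n (F : W -> R) :
  \sum_(x : {ffun 'I_n -> W}) \prod_i F (x i) = (\sum_w F w) ^+ n.
Proof.
rewrite -(bigA_distr_bigA (fun (_ : 'I_n) w => F w)) prodr_const.
by rewrite card_ord.
Qed.

(** The sum factors over the indices; it serves as a generating function for the number of values
    outside [S]. *)
Lemma sum_config_weight (R : comNzRingType) n (S : {set W}) (z : R) :
  \sum_(x : {ffun 'I_n -> W}) z ^+ #|[set i | x i \notin S]%SET| =
  (#|S|%:R + #|~: S|%:R * z) ^+ n.
Proof.
transitivity (\sum_(x : {ffun 'I_n -> W}) \prod_i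
   (if x i \in S then 1 else z)).
  apply: eq_bigr => x _; rewrite (bigID (fun i => x i \in S)) /=.
  rewrite big1 ?mul1r; last by move=> i ->.
  under eq_bigr => i /negbTE -> do [].
  by rewrite prodr_const cardsE; congr (_ ^+ _); apply: eq_card => i.
rewrite (sum_config_prod n (fun w => if w \in S then 1 else z)).
congr (_ ^+ _); rewrite (bigID (mem S)) /=; congr (_ + _).
  by under eq_bigr => w -> do []; rewrite sumr_const.
under eq_bigr => w /negbTE -> do [].
by rewrite sumr_const mulr_natl; congr (_ *+ _); apply: eq_card => w; rewrite !inE.
Qed.

End isotropic_sum.

Section isotropic_sum_bound.
Variables (R : realType) (W : finType) (orth : rel W) (nil : pred W).
Variables (rho : R) (Lam : nat).
Hypotheses (orthC : symmetric orth) (rho01 : 0 < rho < 1) (Lam0 : (0 < Lam)%N).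
Hypothesis perp_card : forall S : {set W}, (#|S| * #|perp orth S| <= Lam ^ 2)%N.

(** [nonorth_pairs] is made of ordered pairs and sees a defect up to twice, so each of its elements
    is worth the square root of [rho]. *)
Let tau := Num.sqrt rho.

Let tau01 : 0 < tau < 1.
Proof.
case/andP: rho01 => r0 r1; rewrite /tau sqrtr_gt0 r0 /=.
by rewrite -(sqrtr1 R) ltr_sqrt.
Qed.

Let tau0 : 0 < tau. Proof. by case/andP: tau01. Qed.
Let tau1 : tau < 1. Proof. by case/andP: tau01. Qed.

Lemma rho_defects_le n (x : {ffun 'I_n -> W}) k :
  (k <= #|nonorth_pairs orth x|)%N -> rho ^+ defects orth nil x <= tau ^+ k.
Proof.
move=> kle; have -> : rho = tau ^+ 2.
  by rewrite sqr_sqrtr// ltW//; case/andP: rho01.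
rewrite -exprM; apply: ler_wiXn2l; rewrite ?(ltW tau0) ?(ltW tau1)//.
by apply: leq_trans kle _; exact: nonorth_pairs_le.
Qed.

Lemma near_expr_le (a eps : R) : 0 <= a < 1 -> 0 < eps ->
  \forall n \near \oo, a ^+ n <= eps.
Proof.
move=> /andP[a0 a1] e0.
have /cvgrPdist_le/(_ _ e0) : (fun n => a ^+ n) @ \oo --> (0 : R).
  by apply: cvg_expr; rewrite ger0_norm.
by apply: filterS => n; rewrite sub0r normrN ger0_norm// exprn_ge0.
Qed.

Lemma near_divn h (P : nat -> Prop) : (0 < h)%N ->
  (\forall m \near \oo, P m) -> \forall n \near \oo, P (n %/ h)%N.
Proof.
move=> h0 [N _ HN]; exists (N * h)%N => // n /= Nn.
by apply: HN => /=; rewrite leq_divRL.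
Qed.

Definition heavy (m n : nat) (x : {ffun 'I_n -> W}) : {set W} :=
  [set w | (m <= #|[set i | x i == w]%SET|)%N]%SET.

(** Every index with value [s] forms a defective pair with every index with value [t]. The case s =
    t is allowed, and discarding the diagonal then turns [m * m] into [m * m.-1]. *)
Lemma heavy_nonclique m n (x : {ffun 'I_n -> W}) s t :
  s \in heavy m x -> t \in heavy m x -> ~~ orth s t ->
  (m * m.-1 <= #|nonorth_pairs orth x|)%N.
Proof.
rewrite !inE => ms mt nst.
pose A := [set i | x i == s]%SET; pose B := [set i | x i == t]%SET.
pose D := [set ik : 'I_n * 'I_n | (ik.1 \in A) && (ik.1 == ik.2)]%SET.
have sub : (finset.setX A B :\: D)%SET \subset nonorth_pairs orth x.
  apply/fintype.subsetP => -[i k]; rewrite !inE /=.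
  by move=> /andP[+ /andP[/eqP xi /eqP xk]]; rewrite xi xk eqxx /= => -> /=.
apply: leq_trans (subset_leq_card sub).
rewrite cardsD cardsX; set c := #|_ :&: _|.
have cA : (c <= #|A|)%N.
  apply: leq_trans (subset_leq_card (subsetIr _ _)) _.
  rewrite -(card_imset (mem A) (f := fun i => (i, i))); last by move=> i j [].
  apply: subset_leq_card; apply/fintype.subsetP => -[i k]; rewrite inE /=.
  by move=> /andP[iA /eqP <-]; apply/imsetP; exists i.
apply: leq_trans (leq_sub2l _ cA).
rewrite -[X in (_ <= _ - X)%N]muln1 -mulnBr leq_mul // -subn1.
exact: leq_sub2r.
Qed.

Lemma light_card m n (x : {ffun 'I_n -> W}) :
  (#|[set i | x i \notin heavy m x]%SET| <= #|W| * m)%N.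
Proof.
have -> : #|[set i | x i \notin heavy m x]%SET| =
    (\sum_(w | w \notin heavy m x) #|[set i | x i == w]%SET|)%N.
  rewrite -sum1dep_card (partition_big x (fun w => w \notin heavy m x)) //=.
  apply: eq_bigr => w wS; rewrite -sum1dep_card; apply: eq_bigl => i.
  by case: eqP => [->|]; rewrite ?wS ?andbF.
apply: leq_trans (_ : \sum_(w : W | w \notin heavy m x) m <= _)%N.
  by apply: leq_sum => w; rewrite inE -ltnNge => /ltnW.
by rewrite sum_nat_const leq_mul2r max_card orbT.
Qed.

(** A value outside [heavy m x], which is its own orthogonal, fails to be orthogonal to some heavy
    value, and that one is taken at least [m] times. *)
Lemma heavy_perp m n (x : {ffun 'I_n -> W}) : perp orth (heavy m x) = heavy m x ->
  (m * #|[set i | x i \notin heavy m x]%SET| <= #|nonorth_pairs orth x|)%N.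
Proof.
move=> SS; set O := [set i | _]%SET.
pose T i := [set ik in nonorth_pairs orth x | ik.1 == i]%SET.
apply: leq_trans (_ : \sum_(i in O) #|T i| <= _)%N.
  rewrite mulnC -sum_nat_const; apply: leq_sum => i.
  move=> iO; have iS : x i \notin heavy m x by rewrite inE in iO.
  have := iS; rewrite -{1}SS inE negb_forall => /existsP[s].
  rewrite negb_imply => /andP[sS nis].
  have := sS; rewrite inE => /leq_trans; apply.
  rewrite -(card_imset (mem [set j | x j == s]%SET) (f := pair i)); last by move=> j k [].
  apply: subset_leq_card; apply/fintype.subsetP => _ /imsetP[k + ->].
  rewrite !inE /= => /eqP xk; rewrite eqxx andbT xk nis andbT.
  by apply: contraNneq iS => ->; rewrite xk.
rewrite -[X in (_ <= X)%N]sum1_card.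
rewrite (partition_big (fun ik => ik.1) predT) //=.
rewrite [X in (_ <= X)%N](bigID (mem O)) /=.
apply: leq_trans (leq_addr _ _); apply: eq_leq; apply: eq_bigr => i iO.
by rewrite -sum1dep_card; apply: eq_bigl => ik; rewrite !inE.
Qed.

Section fixed_heavy_set.
Variables (h : nat) (S : {set W}).
Hypothesis h0 : (0 < h)%N.

Let sum_heavy n : R := \sum_(x : {ffun 'I_n -> W} |
  ~~ isotropic orth nil x && (heavy (n %/ h) x == S)) rho ^+ defects orth nil x.

Let rho_ge0 : 0 <= rho. Proof. by case/andP: rho01 => /ltW. Qed.

Lemma sum_heavy_le (F : forall n, {ffun 'I_n -> W} -> R) n :
  (forall x, 0 <= F n x) ->
  (forall x, ~~ isotropic orth nil x -> heavy (n %/ h) x = S ->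
     rho ^+ defects orth nil x <= F n x) ->
  sum_heavy n <= \sum_x F n x.
Proof.
move=> F0 FS; rewrite [leRHS](bigID (fun x : {ffun 'I_n -> W} =>
  ~~ isotropic orth nil x && (heavy (n %/ h) x == S))) /=.
apply: ler_wpDr; first by apply: sumr_ge0 => x _; exact: F0.
by apply: ler_sum => x /andP[? /eqP ?]; exact: FS.
Qed.

(** The crude count |W|^n suffices: with m = n/h there are m(m-1) defective pairs, and tau^(m(m-1))
    beats |W|^(2hm). *)
Lemma near_sum_heavy_nonclique (eps : R) s t : 0 < eps ->
  s \in S -> t \in S -> ~~ orth s t ->
  \forall n \near \oo, sum_heavy n <= eps * Lam%:R ^+ n.
Proof.
move=> e0 sS tS nst.
have W1 : (1 <= #|W|)%N by apply/card_gt0P; exists s.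
have [K _ HK] : \forall k \near \oo,
    tau ^+ k <= 2^-1 / (#|W| ^ (2 * h))%:R.
  apply: near_expr_le; first by rewrite (ltW tau0).
  by rewrite divr_gt0 ?invr_gt0// ltr0n expn_gt0 W1.
have half01 : 0 <= (2^-1 : R) < 1 by lra.
near=> n; set m := (n %/ h)%N.
have m1 : (0 < m)%N.
  by rewrite /m; near: n; apply: (@near_divn h (fun m => (0 < m)%N)).
have mK : (K <= m.-1)%N.
  have : (K.+1 <= m)%N.
    by rewrite /m; near: n; apply: (@near_divn h (fun m => (K.+1 <= m)%N)).
  by rewrite -[X in (_ < X)%N -> _](prednK m1).
have small : 2^-1 ^+ m <= eps.
  by rewrite /m; near: n; apply: (@near_divn h (fun m => 2^-1 ^+ m <= eps)) => //;
     exact: near_expr_le.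
apply: le_trans (_ : #|W|%:R ^+ n * tau ^+ (m * m.-1) <= _).
  apply: le_trans (@sum_heavy_le (fun n x => tau ^+ (m * m.-1)) n _ _) _.
  - by move=> x; rewrite exprn_ge0// ltW.
  - move=> x _ xS; apply: rho_defects_le.
    by apply: (heavy_nonclique (s := s) (t := t)); rewrite ?xS.
  - by rewrite sumr_const card_ffun card_ord -natrX mulr_natl.
have nm : (n <= 2 * h * m)%N.
  apply: leq_trans (ltnW (ltn_ceil n h0)) _; rewrite -/m -mulnA mulnCA [leqLHS]mulnC leq_mul2l.
  by rewrite mul2n -addnn -addn1 leq_add2l m1 orbT.
have Wn : #|W|%:R ^+ n <= (#|W| ^ (2 * h))%:R ^+ m :> R.
  by rewrite -!natrX ler_nat -expnM leq_pexp2l.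
have tm : tau ^+ (m * m.-1) <= (2^-1 / (#|W| ^ (2 * h))%:R) ^+ m.
  rewrite mulnC exprM; apply: lerXn2r; rewrite ?nnegrE ?exprn_ge0 ?(ltW tau0)//.
  exact: HK.
apply: le_trans (ler_pM _ _ Wn tm) _; rewrite ?exprn_ge0 ?(ltW tau0)//.
rewrite -exprMn mulrCA mulfV ?mulr1; last first.
  by rewrite pnatr_eq0 -lt0n expn_gt0 W1.
apply: le_trans small _; rewrite ler_peMr ?(ltW e0)// exprn_ege1//.
by rewrite ler1n.
Unshelve. all: by end_near. Qed.

(** At most |W| m indices have their value outside [S], so z^(outside - |W| m) is at least 1 for 0 <
    z <= 1 and may replace the weight. For small z the base |S| + |~S| z stays below Lam by a
    constant factor, and the price z^(-|W| m) is absorbed because [h] is large. *)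
Lemma near_sum_heavy_small (eps : R) : 0 < eps -> (0 < #|W|)%N -> (#|S| < Lam)%N ->
  (1 - (2 * Lam%:R)^-1) ^+ h * ((2 * #|W|%:R) ^+ #|W|) <= 2^-1 :> R ->
  \forall n \near \oo, sum_heavy n <= eps * Lam%:R ^+ n.
Proof.
move=> e0 W1 SL hh.
have L0 : 0 < Lam%:R :> R by rewrite ltr0n.
have L1 : 1 <= Lam%:R :> R by rewrite ler1n.
have W0 : 1 <= #|W|%:R :> R by rewrite ler1n.
(* With this z the values outside [S] weigh at most 1/2 together, less than the gap Lam - |S| >=
   1. *)
pose z : R := (2 * #|W|%:R)^-1.
have z0 : 0 < z by rewrite invr_gt0; lra.
have z1 : z <= 1 by rewrite invf_le1; lra.
have half01 : 0 <= (2^-1 : R) < 1 by lra.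
near=> n; set m := (n %/ h)%N.
have small : 2^-1 ^+ m <= eps.
  by rewrite /m; near: n; apply: (@near_divn h (fun m => 2^-1 ^+ m <= eps)) => //;
     exact: near_expr_le.
apply: le_trans (@sum_heavy_le (fun n x => z ^- (#|W| * m) *
  z ^+ #|[set i | x i \notin S]%SET|) n _ _) _.
- by move=> x; rewrite mulr_ge0 ?invr_ge0 ?exprn_ge0 ?ltW.
- move=> x _ xS; apply: le_trans (_ : 1 <= _).
    by rewrite exprn_ile1// ltW//; case/andP: rho01.
  rewrite mulrC ler_pdivlMr ?exprn_gt0// mul1r.
  by apply: ler_wiXn2l; rewrite ?(ltW z0)// -xS; exact: light_card.
rewrite -mulr_sumr sum_config_weight.
have le1 : #|S|%:R + #|~: S|%:R * z <= Lam%:R - 2^-1.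
  have : #|~: S|%:R * z <= 2^-1.
    apply: le_trans (_ : #|W|%:R * z <= _).
      by rewrite ler_wpM2r ?(ltW z0)// ler_nat max_card.
    by rewrite /z invfM mulrCA mulfV ?mulr1//; lra.
  have : #|S|%:R + 1 <= Lam%:R :> R by rewrite natr1 ler_nat.
  by lra.
set a := 1 - (2 * Lam%:R)^-1 in hh.
have aE : Lam%:R - 2^-1 = Lam%:R * a.
  by rewrite /a mulrBr mulr1 invfM mulrCA mulfV ?mulr1// gt_eqF.
have a0 : 0 <= a by rewrite /a subr_ge0 invf_le1; lra.
have a1 : a <= 1 by rewrite /a lerBlDr lerDl invr_ge0; lra.
have le2 : (#|S|%:R + #|~: S|%:R * z) ^+ n <= (Lam%:R * a) ^+ n.
  rewrite -aE; apply: lerXn2r => //; rewrite nnegrE.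
    by rewrite addr_ge0// mulr_ge0// ltW.
  by rewrite aE mulr_ge0// ltW.
apply: le_trans (ler_wpM2l _ le2) _.
  by rewrite invr_ge0 exprn_ge0 ?ltW.
rewrite exprMn mulrCA [leRHS]mulrC ler_wpM2l ?exprn_ge0 ?(ltW L0)//.
have le3 : a ^+ n <= (a ^+ h) ^+ m.
  by rewrite -exprM; apply: ler_wiXn2l => //; rewrite mulnC leq_trunc_div.
apply: le_trans (ler_wpM2l _ le3) _.
  by rewrite invr_ge0 exprn_ge0 ?ltW.
rewrite exprM -exprVn -exprMn; apply: le_trans small.
apply: lerXn2r; rewrite ?nnegrE ?invr_ge0//.
  by rewrite mulr_ge0 ?exprn_ge0 ?invr_ge0 ?exprn_ge0 ?(ltW z0).
by rewrite mulrC -exprVn /z invrK.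
Unshelve. all: by end_near. Qed.

Lemma expr1D_le (x : R) n : 0 <= x -> n%:R * x <= 2^-1 ->
  (1 + x) ^+ n <= 1 + 2 * (n%:R * x).
Proof.
move=> x0; elim: n => [|n IH] nx; first by rewrite expr0 mul0r mulr0 addr0.
have nx' : n%:R * x <= 2^-1.
  by apply: le_trans nx; rewrite ler_wpM2r// ler_nat.
rewrite exprSr; apply: le_trans (ler_wpM2r _ (IH nx')) _; first lra.
have -> : n.+1%:R * x = n%:R * x + x by rewrite -natr1 mulrDl mul1r.
set y := n%:R * x in nx' *.
have : y * x <= 2^-1 * x by rewrite ler_wpM2r.
by lra.
Qed.

Lemma near_natr_expr_le (eps : R) : 0 < eps ->
  \forall m \near \oo, m.+1%:R * tau ^+ m <= eps.
Proof.
(* tau^m is split into two powers sg^m: one absorbs m+1, by comparison with the geometric series,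
   and the other tends to 0. *)
move=> e0; pose sg := Num.sqrt tau.
have sg0 : 0 < sg by rewrite sqrtr_gt0.
have sg1 : sg < 1 by rewrite -(sqrtr1 R) ltr_sqrt.
have sg2 : tau = sg ^+ 2 by rewrite sqr_sqrtr// ltW.
have bound m : m.+1%:R * sg ^+ m <= (1 - sg)^-1.
  rewrite -[leRHS]mul1r ler_pdivlMr ?subr_gt0//.
  apply: le_trans (_ : (\sum_(i < m.+1) sg ^+ i) * (1 - sg) <= _).
    rewrite ler_wpM2r ?subr_ge0 ?(ltW sg1)// mulr_natl.
    rewrite -[m.+1 in leLHS]card_ord -sumr_const; apply: ler_sum => i _.
    by apply: ler_wiXn2l; rewrite ?(ltW sg0) ?(ltW sg1)// -ltnS.
  have -> : (\sum_(i < m.+1) sg ^+ i) * (1 - sg) = 1 - sg ^+ m.+1.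
    by rewrite -[RHS]opprB subrX1; ring.
  by rewrite lerBlDr lerDl exprn_ge0// ltW.
have e1 : 0 < eps * (1 - sg) by rewrite mulr_gt0// subr_gt0.
have := @near_expr_le sg _ (introT andP (conj (ltW sg0) sg1)) e1.
apply: filterS => m smm.
rewrite sg2 -exprM mulnC muln2 -addnn exprD mulrA.
apply: le_trans (ler_pM _ _ (bound m) smm) _; rewrite ?exprn_ge0 ?(ltW sg0)//.
  by rewrite mulr_ge0// exprn_ge0// ltW.
by rewrite mulrC mulfK// subr_eq0 gt_eqF.
Qed.

(** Two kinds of configurations remain. If some values lie outside [S], each of these indices costs
    tau^m, and (Lam + |~S| tau^m)^n - Lam^n is small against Lam^n since n tau^m tends to 0. If all
    values lie in [S], all pairs are orthogonal and the defects sit on the diagonal; a value of [S]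
    that is not [nil] then lowers the base Lam by 1 - rho. *)
Lemma near_sum_heavy_lagrangian (eps : R) : 0 < eps -> #|S| = Lam -> perp orth S = S ->
  \forall n \near \oo, sum_heavy n <= eps * Lam%:R ^+ n.
Proof.
move=> e0 SL SS.
have L0 : 0 < Lam%:R :> R by rewrite ltr0n.
have L1 : 1 <= Lam%:R :> R by rewrite ler1n.
(* Chosen so that n |~S| tau^m <= c (m+1) tau^m, by n <= h (m+1). *)
pose c : R := h%:R * #|W|%:R + 1.
have c0 : 0 < c by rewrite /c ltr_wpDl// mulr_ge0.
pose a : R := 1 - (1 - rho) / Lam%:R.
have a01 : 0 <= a < 1.
  case/andP: rho01 => r0 r1; rewrite /a subr_ge0 ler_pdivrMr// mul1r.
  rewrite ltrBlDr ltrDl divr_gt0 ?subr_gt0// andbT.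
  by apply: le_trans L1; lra.
have a_ge0 : 0 <= a by case/andP: a01.
near=> n; set m := (n %/ h)%N.
have mt1 : m.+1%:R * tau ^+ m <= 2^-1 / c.
  rewrite /m; near: n; apply: (@near_divn h (fun m => m.+1%:R * tau ^+ m <= 2^-1 / c)) => //.
  by apply: near_natr_expr_le; rewrite divr_gt0 ?invr_gt0.
have mt2 : m.+1%:R * tau ^+ m <= eps / 4 / c.
  rewrite /m; near: n; apply: (@near_divn h (fun m => m.+1%:R * tau ^+ m <= eps / 4 / c)) => //.
  by apply: near_natr_expr_le; rewrite divr_gt0 ?divr_gt0.
have an : a ^+ n <= eps / 2.
  by near: n; apply: near_expr_le => //; rewrite divr_gt0.
(* The subtracted power of 0 is 1 exactly when no value lies outside [S]; it removes the
   configurations that [F2] takes care of. *)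
pose F1 (x : {ffun 'I_n -> W}) : R := (tau ^+ m) ^+ #|[set i | x i \notin S]%SET|
  - 0 ^+ #|[set i | x i \notin S]%SET|.
(* When every value of [S] is [nil], the configurations inside [S] are isotropic, whence the 0. *)
pose F2 (x : {ffun 'I_n -> W}) : R := if [exists s in S, ~~ nil s] then
  \prod_i (if x i \in S then rho ^+ (~~ nil (x i)) else 0) else 0.
have tm0 : 0 <= tau ^+ m by rewrite exprn_ge0// ltW.
have F10 x : 0 <= F1 x.
  rewrite /F1; case: (#|_|) => [|k]; first by rewrite !expr0 subrr.
  by rewrite expr0n subr0 exprn_ge0.
have F20 x : 0 <= F2 x.
  rewrite /F2; case: ifP => // _; apply: prodr_ge0 => i _.
  by case: ifP; rewrite // exprn_ge0.
have le0 : sum_heavy n <= \sum_(x : {ffun 'I_n -> W}) (F1 x + F2 x).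
  rewrite /sum_heavy.
  apply: le_trans (_ : \sum_(x : {ffun 'I_n -> W} | ~~ isotropic orth nil x &&
     (heavy (n %/ h) x == S)) (F1 x + F2 x) <= _); last first.
    rewrite [leRHS](bigID (fun x : {ffun 'I_n -> W} =>
      ~~ isotropic orth nil x && (heavy (n %/ h) x == S))) /=.
    by rewrite lerDl sumr_ge0// => x _; rewrite addr_ge0.
  apply: ler_sum => x /andP[xiso /eqP xS].
  have [out0|out0] := posnP #|[set i | x i \notin S]%SET|; last first.
    apply: le_trans (_ : F1 x <= _); last by rewrite lerDl.
    rewrite /F1 [0 ^+ _]expr0n gtn_eqF//= subr0 -exprM.
    by apply: rho_defects_le; rewrite -{1}xS; apply: heavy_perp; rewrite xS.
  have allS i : x i \in S.
    apply/negPn/negP => niS; move/eqP: out0; rewrite cards_eq0 => /eqP out0.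
    by have := finset.in_set0 i; rewrite -out0 inE niS.
  have orthS s t : s \in S -> t \in S -> orth s t.
    by rewrite -{1}SS inE => /forall_inP; apply.
  have [u uP] : exists u, ~~ pair_ok orth nil x u.
    by apply/existsP; rewrite -negb_forall.
  have uD : (val u).1 = (val u).2.
    by apply/eqP/negPn/negP => nu; move: uP; rewrite /pair_ok (negbTE nu) orthS.
  have nu : ~~ nil (x (val u).1) by move: uP; rewrite /pair_ok uD eqxx.
  apply: le_trans (_ : F2 x <= _); last by rewrite lerDr.
  have -> : F2 x = rho ^+ (\sum_i ~~ nil (x i)).
    rewrite /F2 ifT; last by apply/existsP; exists (x (val u).1); rewrite allS nu.
    by rewrite expr_sum; apply: eq_bigr => i _; rewrite allS.
  apply: ler_wiXn2l => //; first by case/andP: rho01 => _ /ltW.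
  pose dg (i : 'I_n) : upper_index n := exist _ (i, i) (leqnn i).
  have -> : (\sum_i ~~ nil (x i))%N = #|[pred i | ~~ nil (x i)]|.
    by rewrite -sum1_card [RHS]big_mkcond; apply: eq_bigr => i _; rewrite inE; case: (nil _).
  have dgI : injective dg by move=> i j /(congr1 val) [].
  rewrite /defects -(fintype.card_image dgI).
  apply: subset_leq_card; apply/fintype.subsetP => _ /fintype.imageP[i ni ->].
  by rewrite inE /pair_ok /= eqxx.
apply: le_trans le0 _; rewrite big_split /= [X in _ <= X * _](splitr eps) mulrDl.
apply: lerD.
  rewrite sumrB !sum_config_weight SL mulr0 addr0.
  set y := #|~: S|%:R * tau ^+ m.
  have y0 : 0 <= y by rewrite mulr_ge0.
  have ny (d : R) : m.+1%:R * tau ^+ m <= d / c -> n%:R * y <= d.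
    move=> md; apply: le_trans (_ : c * (m.+1%:R * tau ^+ m) <= _); last first.
      by rewrite mulrC -ler_pdivlMr.
    rewrite /y !mulrA ler_wpM2r// -natrM.
    apply: le_trans (_ : (h * #|W|)%:R * m.+1%:R <= _); last first.
      by rewrite ler_wpM2r// /c natrM lerDl.
    rewrite -natrM ler_nat mulnAC leq_mul ?max_card//.
    by rewrite mulnC ltnW// ltn_ceil.
  have -> : Lam%:R + y = Lam%:R * (1 + y / Lam%:R).
    by rewrite mulrDr mulr1 mulrCA mulfV ?mulr1// gt_eqF.
  have yL : y / Lam%:R <= y by rewrite ler_pdivrMr// ler_peMr.
  rewrite exprMn -[X in _ - X]mulr1 -mulrBr mulrC ler_wpM2r ?exprn_ge0 ?(ltW L0)//.
  rewrite lerBlDl; apply: le_trans (expr1D_le (n := n) _ _) _.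
  - by rewrite divr_ge0// ltW.
  - by apply: le_trans (ny _ mt1); rewrite ler_wpM2l.
  rewrite lerD2l; apply: le_trans (_ : 2 * (n%:R * y) <= _).
    by rewrite ler_wpM2l// ler_wpM2l.
  by have := ny _ mt2; lra.
rewrite /F2; case: (boolP [exists s in S, ~~ nil s]) =>
  [/existsP[s /andP[sS ns]]|_]; last first.
  by rewrite big1// mulr_ge0 ?exprn_ge0 ?(ltW L0)// divr_ge0// ltW.
rewrite (sum_config_prod n (fun w => if w \in S then rho ^+ (~~ nil w) else 0)).
rewrite -big_mkcond /= (bigD1 s) //= ns expr1.
apply: le_trans (_ : (Lam%:R * a) ^+ n <= _); last first.
  by rewrite exprMn mulrC ler_wpM2r// exprn_ge0// ltW.
apply: lerXn2r; rewrite ?nnegrE.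
- by rewrite addr_ge0// sumr_ge0// => i _; rewrite exprn_ge0.
- by rewrite mulr_ge0 ?(ltW L0).
have -> : Lam%:R * a = rho + (Lam%:R - 1).
  by rewrite /a mulrBr mulr1 mulrCA mulfV ?gt_eqF// mulr1; ring.
rewrite lerD2l; apply: le_trans (_ : \sum_(i in S | i != s) 1 <= _).
  by apply: ler_sum => i _; rewrite exprn_ile1//; case/andP: rho01 => _ /ltW.
have S1 : (#|S| = 1 + #|[pred i | (i \in S) && (i != s)]|)%N.
  by rewrite (cardD1 s) sS; congr (_ + _)%N; apply: eq_card => i; rewrite !inE andbC.
by rewrite sumr_const -SL S1 natrD addrAC subrr add0r.
Unshelve. all: by end_near. Qed.

End fixed_heavy_set.

(* Split according to the set S of the values taken at least n/h times. If S
   contains a non-orthogonal pair, there are quadratically many defects; if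
   #|S| < Lam, there are few configurations; otherwise S = perp S, and each value
   outside S causes at least n/h defects. *)
Lemma near_nonisotropic_sum (eps : R) : 0 < eps -> \forall n \near \oo,
  \sum_(x : {ffun 'I_n -> W} | ~~ isotropic orth nil x)
     rho ^+ defects orth nil x <= eps * Lam%:R ^+ n.
Proof.
move=> e0.
have L0 : 0 < Lam%:R :> R by rewrite ltr0n.
have L1 : 1 <= Lam%:R :> R by rewrite ler1n.
have [W0|W0] := posnP #|W|.
  exists 1%N => // n /= n0; rewrite big1 ?mulr_ge0 ?exprn_ge0 ?ltW// => x _.
  by have := card0_eq W0 (x (Ordinal n0)).
pose a : R := 1 - (2 * Lam%:R)^-1.
have a01 : 0 <= a < 1.
  by rewrite /a subr_ge0 invf_le1 ?ltrBlDr ?ltrDl ?invr_gt0; lra.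
pose b : R := (2 * #|W|%:R) ^+ #|W|.
have b0 : 0 < b by rewrite exprn_gt0// mulr_gt0// ltr0n.
have [h0 _ Hh] : \forall h \near \oo, a ^+ h <= 2^-1 / b.
  by apply: near_expr_le => //; rewrite divr_gt0.
have hh : a ^+ h0.+1 * b <= 2^-1 by rewrite -ler_pdivlMr//; apply: Hh => /=.
pose N : R := #|{set W}|%:R.
have N0 : 0 < N by rewrite /N ltr0n; apply/card_gt0P; exists finset.set0.
have eN : 0 < eps / N by rewrite divr_gt0.
have : \forall n \near \oo, forall S : {set W},
  \sum_(x : {ffun 'I_n -> W} | ~~ isotropic orth nil x &&
    (heavy (n %/ h0.+1) x == S)) rho ^+ defects orth nil x
   <= eps / N * Lam%:R ^+ n.
  apply: filter_forall => S.
  have [/existsP[s /andP[sS /existsP[t /andP[tS nst]]]]|] :=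
    boolP [exists s in S, exists t in S, ~~ orth s t].
    exact: near_sum_heavy_nonclique nst.
  move=> cl; have [SL|SL] := ltnP #|S| Lam; first exact: near_sum_heavy_small.
  have SP : S \subset perp orth S.
    apply/fintype.subsetP => s sS; rewrite inE; apply/forall_inP => t tS.
    apply/negPn/negP => nst; case/negP: cl.
    by apply/existsP; exists s; rewrite sS; apply/existsP; exists t; rewrite tS.
  have PL := perp_card S; have := subset_leq_card SP => SPle.
  have SE : #|S| = Lam.
    apply/eqP; rewrite eqn_leq SL andbT -leq_sqr.
    by apply: leq_trans PL; rewrite leq_mul2l SPle orbT.
  have PE : perp orth S = S.
    apply/eqP; rewrite eq_sym eqEcard SP SE -(@leq_pmul2l Lam)//.
    by move: PL; rewrite SE.
  exact: near_sum_heavy_lagrangian.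
apply: filterS => n Hn.
rewrite (partition_big (heavy (n %/ h0.+1) (n:=n)) predT)//=.
apply: le_trans (ler_sum _ (fun S _ => Hn S)) _.
rewrite sumr_const -mulrnAl -[_ *+ _]mulr_natr -/N mulfVK ?gt_eqF//.
Qed.

End isotropic_sum_bound.

(** * Characters and universality *)

Section characters.
Variables (R : realType) (q : nat).
Hypothesis q1 : (1 < q)%N.

Local Notation C := R[i].

Lemma prim_root_exists : exists z : C, q.-primitive_root z.
Proof.
pose f : {poly C} := 'X^q - 1; have [r Dp] := closed_field_poly_normal f.
have q0 : (0 < q)%N by exact: ltnW.
rewrite (monicP _) ?monicXnsubC // scale1r in Dp.
have rn1 : all q.-unity_root r.
  by apply/allP => z; rewrite -root_prod_XsubC -Dp.
have sz_r : (q < (size r).+1)%N.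
  by rewrite -(size_prod_XsubC r id) -Dp size_XnsubC.
have [|z _ zp] := hasP (has_prim_root q0 rn1 _ sz_r); last by exists z.
by rewrite -separable_prod_XsubC -Dp separable_Xn_sub_1 // pnatr_eq0 -lt0n.
Qed.

Definition zeta : C := xchoose prim_root_exists.

Lemma zeta_prim : q.-primitive_root zeta.
Proof. exact: xchooseP. Qed.

Definition chi (x : 'Z_q) : C := zeta ^+ x.

Lemma chi0 : chi 0 = 1. Proof. by []. Qed.

Lemma chiD x y : chi (x + y) = chi x * chi y.
Proof.
have e : (x + y)%R = ((x + y) %% q)%N :> nat.
  exact: (congr1 (modn (x + y)%N) (Zp_cast q1)).
by rewrite /chi e prim_expr_mod ?exprD//; exact: zeta_prim.
Qed.

Lemma chi_sum (I : Type) (s : seq I) (P : pred I) (F : I -> 'Z_q) :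
  chi (\sum_(i <- s | P i) F i) = \prod_(i <- s | P i) chi (F i).
Proof. exact: (big_morph chi chiD chi0). Qed.

Lemma chi_eq1 x : (chi x == 1) = (x == 0).
Proof.
rewrite /chi -(prim_order_dvd zeta_prim) -val_eqE /=.
have [x0|x0] := posnP (x : nat); first by rewrite x0 dvdn0.
by apply/negbTE; rewrite gtnNdvd// -[X in (_ < X)%N](Zp_cast q1) ltn_ord.
Qed.

Lemma norm_chi x : `|chi x| = 1.
Proof.
suff z1 : `|zeta| = 1 by rewrite normrX z1 expr1n.
have := congr1 Num.norm (prim_expr_order zeta_prim).
rewrite normrX normr1 => /eqP; rewrite pexpr_eq1// ?(ltnW q1)//.
by move/eqP.
Qed.

Lemma conj_chi x : (chi x)^* = chi (- x).
Proof.
have nz : chi x != 0 by rewrite -normr_eq0 norm_chi oner_eq0.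
apply: (mulfI nz); rewrite -chiD subrr chi0.
by rewrite -normCK norm_chi expr1n.
Qed.

Lemma card_Zq : #|'Z_q| = q.
Proof. by rewrite card_ord Zp_cast. Qed.

Lemma sum_chiM x : \sum_(d : 'Z_q) chi (d * x) = if x == 0 then q%:R else 0.
Proof.
case: eqP => [->|/eqP x0].
  by under eq_bigr do rewrite mulr0 chi0; rewrite sumr_const card_Zq.
apply/eqP; rewrite -(mulIr_eq0 _ (mulIf (_ : chi x - 1 != 0))); last first.
  by rewrite subr_eq0 chi_eq1.
rewrite mulrBr mulr1 subr_eq0 mulr_suml [X in _ == X](reindex_inj (addIr 1)) /=.
by apply/eqP/eq_bigr => d _; rewrite mulrDl mul1r chiD.
Qed.

Lemma sum_chi_ffun (J : finType) (z : J -> 'Z_q) :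
  \sum_(d : {ffun J -> 'Z_q}) chi (\sum_j d j * z j) =
  if [forall j, z j == 0] then q%:R ^+ #|J| else 0.
Proof.
under eq_bigr do rewrite chi_sum.
rewrite -(bigA_distr_bigA (fun j d => chi (d * z j))).
under eq_bigr do rewrite sum_chiM.
case: ifP => [/forallP z0|/negbT].
  by under eq_bigr do rewrite z0; rewrite prodr_const.
by rewrite negb_forall => /existsP[j /negbTE zj]; rewrite (bigD1 j)//= zj mul0r.
Qed.

Lemma sum_chi_ffun2 (I J : finType) (z : I -> J -> 'Z_q) :
  \sum_(d : {ffun I -> {ffun J -> 'Z_q}}) chi (\sum_i \sum_j d i j * z i j) =
  if [forall i, forall j, z i j == 0] then q%:R ^+ (#|J| * #|I|) else 0.
Proof.
under eq_bigr do rewrite chi_sum.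
rewrite -(bigA_distr_bigA (fun i (d : {ffun J -> 'Z_q}) => chi (\sum_j d j * z i j))).
under eq_bigr do rewrite sum_chi_ffun.
case: ifP => [/forallP z0|/negbT].
  by under eq_bigr do rewrite z0; rewrite prodr_const exprM.
by rewrite negb_forall => /existsP[j /negbTE zj]; rewrite (bigD1 j)//= zj mul0r.
Qed.

End characters.

Section upper_triangle.
Variable n : nat.

Lemma uidx_subproof (i j : 'I_n) :
  let ij := if (i <= j)%N then (i, j) else (j, i) in (ij.1 <= ij.2)%N.
Proof. by case: ifP => //= /negbT; rewrite -ltnNge => /ltnW. Qed.

Definition uidx (i j : 'I_n) : upper_index n :=
  exist (fun ij : 'I_n * 'I_n => (ij.1 <= ij.2)%N) _ (uidx_subproof i j).

Lemma uidxC i j : uidx i j = uidx j i.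
Proof.
apply: val_inj; rewrite /=; case: (ltngtP i j) => // /val_inj ->//.
Qed.

Lemma uidxK (u : upper_index n) : uidx (val u).1 (val u).2 = u.
Proof. by apply: val_inj; case: u => -[i j] /= ->. Qed.

Definition symx (T : Type) (a : {ffun upper_index n -> T}) : 'M[T]_n :=
  \matrix_(i, j) a (uidx i j).

Lemma symx_sym T (a : {ffun upper_index n -> T}) : (symx a)^T = symx a.
Proof. by apply/matrixP => i j; rewrite !mxE uidxC. Qed.

Lemma symxK T (M : 'M[T]_n) : M^T = M ->
  symx [ffun u => M (val u).1 (val u).2] = M.
Proof.
move=> Ms; apply/matrixP => i j; rewrite !mxE ffunE /=.
by case: ifP => //= _; rewrite -[in LHS]Ms mxE.
Qed.

Lemma symx_inj T : injective (@symx T).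
Proof.
move=> a b ab; apply/ffunP => u.
by have := congr1 (fun M : 'M[T]_n => M (val u).1 (val u).2) ab; rewrite !mxE uidxK.
Qed.

Lemma sum_pairs_upper (V : zmodType) (F : 'I_n -> 'I_n -> V) :
  \sum_i \sum_j F i j = \sum_(u : upper_index n)
    (if (val u).1 == (val u).2 then F (val u).1 (val u).1
     else F (val u).1 (val u).2 + F (val u).2 (val u).1).
Proof.
rewrite pair_big /= (partition_big (fun ij => uidx ij.1 ij.2) predT)//=.
apply: eq_bigr => u _.
have uP (ij : 'I_n * 'I_n) : (uidx ij.1 ij.2 == u) =
    (ij == val u) || (ij == ((val u).2, (val u).1)).
  case: ij => i j; case: u => -[k l] kl /=; rewrite -val_eqE /= !xpair_eqE.
  case: ifP => ij /=; rewrite xpair_eqE.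
    case: (i =P k) => [->|ik]; case: (j =P l) => [->|jl] //=.
    - by apply/esym/negbTE/negP => /andP[/eqP Ek /eqP El]; case: jl; rewrite El -Ek.
    - by apply/esym/negbTE/negP => /andP[/eqP Ek /eqP El]; case: ik; rewrite Ek -El.
    - apply/esym/negbTE/negP => /andP[/eqP Ek /eqP El]; case: ik.
      by move: ij; rewrite Ek El => lk; apply/val_inj/eqP; rewrite eqn_leq lk kl.
  case: (i =P k) => [ik|ik]; case: (j =P l) => [jl|jl] //=;
    rewrite ?andbF ?andbT ?orbF.
  - by move: ij; rewrite ik jl kl.
  1, 2, 3: exact: andbC.
rewrite (eq_bigl _ _ uP); case: ifP => [/eqP u12|/negbT u12].
  rewrite (eq_bigl (pred1 (val u))) ?big_pred1_eq ?u12// => ij /=.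
  by case: (val u) u12 => i j /= ->; rewrite orbb.
rewrite (bigD1 (val u)) ?eqxx//=; congr (_ + _).
rewrite (eq_bigl (pred1 ((val u).2, (val u).1))) ?big_pred1_eq// => ij /=.
case: (altP (ij =P val u)) => [->|]/=; last by rewrite andbT.
by move: u12; case: (sval u) => i j /= /negbTE u12; rewrite xpair_eqE u12.
Qed.

End upper_triangle.

Section universality.
Variables (R : realType) (q r : nat).
Hypothesis q1 : (1 < q)%N.
Variables (c1 : 'I_r -> 'Z_q) (c2 T : 'I_r -> 'I_r -> 'Z_q).

Local Notation C := R[i].
Local Notation chi := (chi R q1).
Local Notation colv := {ffun 'I_r -> 'Z_q}.
Local Notation W := (colv * colv)%type.

(** Y is indexed by its columns because m_ij interacts with the columns i and j of Y only. *)
Definition colmx n (y : {ffun 'I_n -> colv}) : 'M['Z_q]_(r, n) :=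
  \matrix_(s, i) y i s.

(** The weights encode divisibility: for q = p^(l+1) and c = p^(l+1-j), the equation c x = 0 in Z/q
    says that p^j divides x. Congruences modulo different powers of p thus become equations in Z/q,
    which characters detect. *)
Definition quad_cond n (Y : 'M['Z_q]_(r, n)) (M : 'M['Z_q]_n) : bool :=
  [forall i, forall s, c1 s * (Y *m M) s i == 0] &&
  [forall st, c2 st.1 st.2 * ((Y *m M *m Y^T) st.1 st.2 - T st.1 st.2) == 0].

Definition weighted_count n (c : 'M['Z_q]_(r, n) -> R) (M : 'M['Z_q]_n) : R :=
  \sum_Y c Y * (quad_cond Y M)%:R.

Definition expect n (w : upper_index n -> 'Z_q -> R) (h : 'M['Z_q]_n -> R) : R :=
  \sum_(a : {ffun upper_index n -> 'Z_q}) (\prod_u w u (a u)) * h (symx a).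

Definition fourier n (w : upper_index n -> 'Z_q -> R) u (t : 'Z_q) : C :=
  \sum_x (w u x)%:C%C * chi (x * t).

Section form.
Variable E : {ffun 'I_r * 'I_r -> 'Z_q}.

(** For w = (y_i, d_i) and w' = (y_j, d_j) this is a coefficient of m_ij in the exponent: the dual
    variables d_i test the i-th column of Y M, and [E] tests Y M Y^T. *)
Definition form (w w' : W) : 'Z_q :=
  \sum_s w.2 s * (c1 s * w'.1 s) +
  \sum_st E st * (c2 st.1 st.2 * (w.1 st.1 * w'.1 st.2)).

Definition bil (w w' : W) : 'Z_q := form w w' + form w' w.

Lemma bilC w w' : bil w w' = bil w' w.
Proof. exact: addrC. Qed.

Lemma formDl u v w : form (u + v) w = form u w + form v w.
Proof.
rewrite /form addrACA -!big_split /=.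
by congr (_ + _); apply: eq_bigr => s _; rewrite !ffunE; ring.
Qed.

Lemma formDr u v w : form w (u + v) = form w u + form w v.
Proof.
rewrite /form addrACA -!big_split /=.
by congr (_ + _); apply: eq_bigr => s _; rewrite !ffunE; ring.
Qed.

Lemma bilDl u v w : bil (u + v) w = bil u w + bil v w.
Proof. by rewrite /bil formDl formDr addrACA. Qed.

Lemma bilNl v w : bil (- v) w = - bil v w.
Proof.
apply/eqP; rewrite -addr_eq0 -bilDl addNr.
by apply/eqP; rewrite -[LHS](addrK (bil 0 w)) -bilDl addr0 subrr.
Qed.

Lemma bilBr u v w : bil u (v - w) = bil u v - bil u w.
Proof. by rewrite bilC bilDl bilNl !(bilC _ u). Qed.

Definition orthb (w w' : W) := bil w w' == 0.
Definition nilb (w : W) := form w w == 0.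

Lemma orthbC : symmetric orthb.
Proof. by move=> w w'; rewrite /orthb bilC. Qed.

Definition radical : {set W} := [set w | [forall w', bil w' w == 0]]%SET.

Lemma sum_chi_bil v : \sum_w chi (bil w v) = if v \in radical then #|{: W}|%:R else 0.
Proof.
rewrite inE; case: ifP => [/forallP v0|/negbT].
  by under eq_bigr do rewrite (eqP (v0 _)); rewrite sumr_const.
rewrite negb_forall => /existsP[w0 w0v].
have nz : chi (bil w0 v) - 1 != 0 by rewrite subr_eq0 chi_eq1.
apply: (mulIf nz); rewrite mul0r mulrBr mulr1 mulr_suml.
rewrite [X in _ - X](reindex_inj (addIr w0)) /= -sumrB big1// => w _.
by rewrite bilDl chiD subrr.
Qed.

(** Parseval for f w, the sum of chi (bil w s) over s in [S]: f equals |S| on the orthogonal of [S],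
    while the sum of |f|^2 is |W| times the number of pairs in [S] that differ by an element of the
    radical. [S] is an arbitrary subset, as a set of heavy values is. *)
Lemma card_perp_radical (S : {set W}) :
  (#|S| * #|perp orthb S| <= #|{: W}| * #|radical|)%N.
Proof.
have [->|[s0 s0S]] := set_0Vmem S; first by rewrite cards0.
have S0 : (0 < #|S|)%N by apply/card_gt0P; exists s0.
pose f w : C := \sum_(s in S) chi (bil w s).
have up : \sum_w `|f w| ^+ 2 <= (#|S| * #|radical| * #|{: W}|)%:R.
  have -> : \sum_w `|f w| ^+ 2 =
      \sum_(s in S) \sum_(t in S) \sum_w chi (bil w (s - t)).
    transitivity (\sum_w \sum_(s in S) \sum_(t in S) chi (bil w (s - t))).
      apply: eq_bigr => w _; rewrite normCK /f rmorph_sum /= mulr_suml.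
      apply: eq_bigr => s _; rewrite mulr_sumr; apply: eq_bigr => t _.
      by rewrite conj_chi -chiD bilBr.
    rewrite exchange_big; apply: eq_bigr => s _; exact: exchange_big.
  rewrite -mulnA natrM mulr_natl -sumr_const; apply: ler_sum => s sS.
  under eq_bigr do rewrite sum_chi_bil.
  rewrite -big_mkcondr /= sumr_const -[leLHS]mulr_natr -natrM ler_nat mulnC leq_mul2r.
  apply/orP; right; rewrite -(card_imset (mem radical) (subrI s)).
  apply: subset_leq_card; apply/fintype.subsetP => t /andP[tS tr].
  by apply/imsetP; exists (s - t); rewrite // subKr.
have lo : (#|perp orthb S| * (#|S| * #|S|))%:R <= \sum_w `|f w| ^+ 2.
  rewrite (bigID (mem (perp orthb S))) /= natrM mulr_natl -sumr_const.
  apply: ler_wpDr; first by apply: sumr_ge0 => w _; rewrite exprn_ge0.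
  apply: ler_sum => w; rewrite inE => /forall_inP wS.
  have -> : f w = #|S|%:R.
    rewrite /f (eq_bigr (fun _ => 1)) ?sumr_const// => s /wS.
    by move=> /eqP ->; rewrite chi0.
  by rewrite normr_nat -natrX.
have := le_trans lo up; rewrite ler_nat mulnCA -[(_ * _ * #|{: W}|)%N]mulnA leq_pmul2l//.
by rewrite mulnC [(#|radical| * _)%N]mulnC.
Qed.

Definition annihilator (s : 'I_r) : {set 'Z_q} := [set x | c1 s * x == 0]%SET.

Let Ann : {set colv} := [set f : colv | [forall s, f s \in annihilator s]]%SET.

Lemma card_Ann : #|Ann| = (\prod_s #|annihilator s|)%N.
Proof.
have -> : #|Ann| = #|family (fun s => mem (annihilator s))|.
  by apply: eq_card => f; rewrite inE; apply/forallP/familyP.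
by rewrite card_family foldrE big_image.
Qed.

Let single1 s : W := ([ffun t => (t == s)%:R], 0).
Let single2 s : W := (0, [ffun t => (t == s)%:R]).

Lemma radical_fst w : w \in radical -> w.1 \in Ann.
Proof.
rewrite inE => /forallP wr; rewrite inE; apply/forallP => s; rewrite inE.
have := wr (single2 s); rewrite /bil /form /= (bigD1 s)//= !ffunE eqxx mul1r.
rewrite !big1 ?addr0//.
1, 2, 3: by move=> t _; rewrite !ffunE ?(mul0r, mulr0).
by move=> t /negbTE ts; rewrite ffunE ts mul0r.
Qed.

Lemma radical_snd w w' : w \in radical -> w' \in radical -> w.1 = w'.1 ->
  w.2 - w'.2 \in Ann.
Proof.
rewrite !inE => /forallP wr /forallP wr' ww'; apply/forallP => s; rewrite inE.
have := wr (single1 s); have := wr' (single1 s) => /eqP e' /eqP e.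
have : bil (single1 s) (w - w') = 0 by rewrite bilBr e e' subrr.
have f1 : form (single1 s) (w - w') = 0.
  by rewrite /form /= ww' subrr !big1 ?addr0// => t _; rewrite !ffunE ?(mul0r, mulr0).
have f2 : form (w - w') (single1 s) = c1 s * (w.2 - w'.2) s.
  rewrite /form /= ww' subrr (bigD1 s)//= !big1 ?addr0.
  - by rewrite [X in _ * (_ * X)]ffunE eqxx mulr1 mulrC.
  - by move=> t _; rewrite !ffunE ?(mul0r, mulr0).
  - by move=> t /negbTE ts; rewrite !ffunE ts !mulr0.
by rewrite /bil f1 f2 add0r => ->.
Qed.

(** A radical vector has its first component in [Ann], and two radical vectors with the same first
    component have second components that differ by an element of [Ann]. Subtracting a chosen [d0]
    on each fibre embeds the radical into Ann x Ann. *)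
Lemma card_radical : (#|radical| <= (\prod_s #|annihilator s|) ^ 2)%N.
Proof.
rewrite -card_Ann -mulnn -cardsX.
pose d0 (y : colv) : colv := if [pick d | (y, d) \in radical] is Some d then d else 0.
pose g (w : W) : W := (w.1, w.2 - d0 w.1).
have gI : injective g.
  by move=> [y d] [y' d'] /= [-> /addIr ->].
rewrite -(card_imset _ gI); apply: subset_leq_card; apply/fintype.subsetP.
move=> _ /imsetP[w wr ->]; rewrite inE /= radical_fst//=.
rewrite /d0; case: pickP => [d dr|/(_ w.2)].
  exact: (@radical_snd w (w.1, d)).
by case: w wr => y d /= ->.
Qed.

End form.

(** The origin of Lam: |W| = q^(2r), and the radical has at most A^2 elements, so that Lam = q^r
    A. *)
Lemma card_perp E (S : {set W}) : (#|S| * #|perp (orthb E) S| <=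
  (\prod_s (q * #|annihilator s|)) ^ 2)%N.
Proof.
apply: leq_trans (card_perp_radical E S) _.
rewrite big_split /= expnMn leq_mul ?card_radical//.
rewrite card_prod !card_ffun card_ord card_ord Zp_cast// prod_nat_const card_ord.
by rewrite mulnn.
Qed.

Definition coef E n (x : {ffun 'I_n -> W}) (u : upper_index n) : 'Z_q :=
  if (val u).1 == (val u).2 then form E (x (val u).1) (x (val u).1)
  else bil E (x (val u).1) (x (val u).2).

Definition fstc n (x : {ffun 'I_n -> W}) : {ffun 'I_n -> colv} := [ffun i => (x i).1].
Definition sndc n (x : {ffun 'I_n -> W}) : {ffun 'I_n -> colv} := [ffun i => (x i).2].

Definition offset (E : {ffun 'I_r * 'I_r -> 'Z_q}) : 'Z_q :=
  \sum_st E st * (c2 st.1 st.2 * T st.1 st.2).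

Lemma phaseE (E : {ffun 'I_r * 'I_r -> 'Z_q}) n (x : {ffun 'I_n -> W}) (a : {ffun upper_index n -> 'Z_q}) :
  let Y := colmx (fstc x) in let M := symx a in
  \sum_i \sum_s sndc x i s * (c1 s * (Y *m M) s i) +
  \sum_st E st * (c2 st.1 st.2 * ((Y *m M *m Y^T) st.1 st.2 - T st.1 st.2)) =
  \sum_u a u * coef E x u - offset E.
Proof.
move=> Y M.
have -> : \sum_u a u * coef E x u = \sum_i \sum_j M i j * form E (x i) (x j).
  rewrite sum_pairs_upper; apply: eq_bigr => u _; rewrite /coef.
  have M12 : M (val u).1 (val u).2 = a u by rewrite mxE uidxK.
  have M21 : M (val u).2 (val u).1 = a u by rewrite mxE uidxC uidxK.
  case: eqP => [e|_]; first by rewrite -[in LHS]M12 -e.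
  by rewrite M12 M21 /bil mulrDr.
have -> : \sum_st E st * (c2 st.1 st.2 * ((Y *m M *m Y^T) st.1 st.2 - T st.1 st.2)) =
    \sum_st E st * (c2 st.1 st.2 * (Y *m M *m Y^T) st.1 st.2) - offset E.
  by rewrite /offset -sumrB; apply: eq_bigr => st _; rewrite !mulrBr.
rewrite addrA; congr (_ - _).
have -> : \sum_i \sum_j M i j * form E (x i) (x j) =
   \sum_i \sum_j M i j * (\sum_s (x i).2 s * (c1 s * (x j).1 s)) +
   \sum_i \sum_j M i j * (\sum_st E st * (c2 st.1 st.2 * ((x i).1 st.1 * (x j).1 st.2))).
  rewrite -big_split; apply: eq_bigr => i _; rewrite -big_split.
  by apply: eq_bigr => j _; rewrite /form mulrDr.
congr (_ + _).
  apply: eq_bigr => i _.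
  under [RHS]eq_bigr do rewrite mulr_sumr.
  rewrite exchange_big; apply: eq_bigr => s _; rewrite mxE !mulr_sumr.
  apply: eq_bigr => j _; rewrite !mxE !ffunE uidxC; ring.
transitivity (\sum_st \sum_i \sum_j
   M i j * (E st * (c2 st.1 st.2 * ((x i).1 st.1 * (x j).1 st.2)))).
  apply: eq_bigr => st _; rewrite mxE exchange_big !mulr_sumr.
  apply: eq_bigr => j _; rewrite mxE mulr_suml !mulr_sumr.
  apply: eq_bigr => i _; rewrite !mxE !ffunE; ring.
rewrite exchange_big; apply: eq_bigr => i _; rewrite exchange_big.
by apply: eq_bigr => j _; rewrite mulr_sumr.
Qed.

(** The power of q on the left is the number of choices of the dual variables d and [E] over which
    the indicator of [quad_cond] is averaged. *)
Lemma weighted_count_chi n (c : 'M['Z_q]_(r, n) -> R) (a : {ffun upper_index n -> 'Z_q}) :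
  (weighted_count c (symx a))%:C%C * q%:R ^+ (r * n + r * r) =
  \sum_E \sum_(x : {ffun 'I_n -> W})
    (c (colmx (fstc x)))%:C%C * chi (- offset E) * \prod_u chi (a u * coef E x u).
Proof.
pose F (y d : {ffun 'I_n -> colv}) : {ffun 'I_n -> W} := [ffun i => (y i, d i)].
have Fb : bijective (fun yd => F yd.1 yd.2).
  exists (fun x => (fstc x, sndc x)) => [[y d]|x] /=.
    by congr (_, _); apply/ffunP => i; rewrite !ffunE.
  by apply/ffunP => i; rewrite !ffunE; case: (x i).
have cb : bijective (@colmx n).
  exists (fun Y : 'M['Z_q]_(r, n) => [ffun i => [ffun s => Y s i]]).
    by move=> y; apply/ffunP => i; apply/ffunP => s; rewrite !ffunE mxE.
  by move=> Y; apply/matrixP => s i; rewrite mxE !ffunE.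
rewrite /weighted_count (reindex _ (onW_bij _ cb)) /= rmorph_sum mulr_suml.
under [RHS]eq_bigr => E _ do rewrite (reindex _ (onW_bij _ Fb)) /=.
under [RHS]eq_bigr => E _ do
  rewrite -(pair_bigA _ (fun y d => (c (colmx (fstc (F y d))))%:C%C * chi (- offset E) *
    \prod_u chi (a u * coef E (F y d) u))) /=.
rewrite [RHS]exchange_big; apply: eq_bigr => y _; rewrite [RHS]exchange_big /=.
have yE d : fstc (F y d) = y by apply/ffunP => i; rewrite !ffunE.
have dE d : sndc (F y d) = d by apply/ffunP => i; rewrite !ffunE.
transitivity ((c (colmx y))%:C%C * \sum_(d : {ffun 'I_n -> colv})
  \sum_(E : {ffun 'I_r * 'I_r -> 'Z_q})
   chi (\sum_i \sum_s d i s * (c1 s * (colmx y *m symx a) s i) +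
   \sum_st E st * (c2 st.1 st.2 *
     ((colmx y *m symx a *m (colmx y)^T) st.1 st.2 - T st.1 st.2)))); last first.
  rewrite mulr_sumr; apply: eq_bigr => d _; rewrite mulr_sumr.
  apply: eq_bigr => E _; have := phaseE E (F y d) a; rewrite /= yE dE => ->.
  by rewrite addrC chiD chi_sum mulrA.
under eq_bigr => d _ do under eq_bigr => E _ do rewrite chiD.
under eq_bigr => d _ do rewrite -mulr_sumr sum_chi_ffun.
rewrite -mulr_suml sum_chi_ffun2 rmorphM /= -mulrA; congr (_ * _).
rewrite /quad_cond; case: ifP => _; case: ifP => _;
  by rewrite ?mul1r ?mul0r ?mulr0 // card_prod !card_ord exprD.
Qed.

Lemma expect_chi n (w : upper_index n -> 'Z_q -> R) (c : 'M['Z_q]_(r, n) -> R) :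
  (expect w (weighted_count c))%:C%C * q%:R ^+ (r * n + r * r) =
  \sum_E \sum_(x : {ffun 'I_n -> W})
    (c (colmx (fstc x)))%:C%C * chi (- offset E) * \prod_u fourier w u (coef E x u).
Proof.
rewrite /expect rmorph_sum mulr_suml.
under eq_bigr => a _ do rewrite rmorphM /= -mulrA weighted_count_chi mulr_sumr.
rewrite exchange_big; apply: eq_bigr => E _.
under eq_bigr => a _ do rewrite mulr_sumr.
rewrite exchange_big; apply: eq_bigr => x _.
rewrite /fourier bigA_distr_bigA mulr_sumr; apply: eq_bigr => a _.
by rewrite rmorph_prod mulrCA -big_split.
Qed.

Definition is_law n (w : upper_index n -> 'Z_q -> R) : Prop :=
  (forall u x, 0 <= w u x) /\ (forall u, \sum_x w u x = 1).

Definition fourier_le (rho : R) n (w : upper_index n -> 'Z_q -> R) : Prop :=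
  forall u t, t != 0 -> `|fourier w u t| <= rho%:C%C.

Lemma fourier0 n (w : upper_index n -> 'Z_q -> R) u : is_law w -> fourier w u 0 = 1.
Proof.
move=> [_ w1]; rewrite /fourier.
under eq_bigr do rewrite mulr0 chi0 mulr1.
by rewrite -rmorph_sum w1.
Qed.

Lemma fourier_prod_le rho n (w : upper_index n -> 'Z_q -> R) E x :
  0 <= rho -> is_law w -> fourier_le rho w ->
  `|\prod_u fourier w u (coef E x u)| <= (rho ^+ defects (orthb E) (nilb E) x)%:C%C.
Proof.
move=> rho0 wl wr; rewrite normr_prod /defects.
have ok u : pair_ok (orthb E) (nilb E) x u = (coef E x u == 0).
  by rewrite /pair_ok /coef; case: ifP.
rewrite (bigID (fun u => ~~ pair_ok (orthb E) (nilb E) x u)) /=.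
rewrite [X in _ * X]big1 ?mulr1; last first.
  by move=> u; rewrite negbK ok => /eqP ->; rewrite fourier0// normr1.
rewrite -prodr_const rmorph_prod /=; apply: ler_prod => u uok.
by rewrite normr_ge0 wr//; move: uok; rewrite ok.
Qed.

Lemma normC_real (x : R) : `|x%:C%C| = `|x|%:C%C.
Proof. by rewrite normc_def /= expr0n addr0 sqrtr_sqr. Qed.

(** The weight [c] enters the estimate only through |c| <= 1; it will serve to restrict to primitive
    rows. The order A^n is exact: Lam = q^r A, and the number of dual variables cancels q^(r n) as
    well as the sum over [E]. The threshold for n is the same for all pairs of laws. *)
Theorem universality (rho eps : R) : 0 < rho < 1 -> 0 < eps ->
  \forall n \near \oo, forall (w w' : upper_index n -> 'Z_q -> R) c,
    is_law w -> is_law w' -> fourier_le rho w -> fourier_le rho w' ->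
    (forall Y, `|c Y| <= 1) ->
    `|expect w (weighted_count c) - expect w' (weighted_count c)| <=
      eps * (\prod_s #|annihilator s|)%:R ^+ n.
Proof.
move=> rho01 e0; set A := (\prod_s _)%N.
have rho_ge0 : 0 <= rho by case/andP: rho01 => /ltW.
pose Lam := (\prod_s (q * #|annihilator s|))%N.
have q0 : (0 < q)%N by exact: ltnW.
have Lam0 : (0 < Lam)%N.
  rewrite prodn_gt0// => s; rewrite muln_gt0 q0; apply/card_gt0P.
  by exists 0; rewrite inE mulr0.
have LamE : Lam = (q ^ r * A)%N.
  by rewrite /Lam big_split /= prod_nat_const card_ord.
have e2 : 0 < eps / 2 by rewrite divr_gt0.
have : \forall n \near \oo, forall E : {ffun 'I_r * 'I_r -> 'Z_q},
    \sum_(x : {ffun 'I_n -> W} | ~~ isotropic (orthb E) (nilb E) x)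
      rho ^+ defects (orthb E) (nilb E) x <= eps / 2 * Lam%:R ^+ n.
  apply: filter_forall => E.
  exact: (near_nonisotropic_sum (nilb E) (@orthbC E) rho01 Lam0 (card_perp E) e2).
apply: filterS => n Hn w w' c wl wl' wr wr' c1'.
have qn0 : 0 < q%:R ^+ (r * n + r * r) :> R by rewrite exprn_gt0// ltr0n.
rewrite -(ler_pM2r qn0) -lecR rmorphM /= -normC_real rmorphB /=.
have -> : ((q%:R ^+ (r * n + r * r))%:C%C = q%:R ^+ (r * n + r * r) :> C).
  by rewrite rmorphXn rmorph_nat.
rewrite -[X in `|_| * X]ger0_norm ?exprn_ge0// -normrM mulrBl !expect_chi.
rewrite -sumrB; apply: le_trans (ler_norm_sum _ _ _) _.
apply: le_trans (_ : \sum_(E : {ffun 'I_r * 'I_r -> 'Z_q}) (eps * Lam%:R ^+ n)%:C%C <= _);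
  last first.
  rewrite sumr_const card_ffun card_prod !card_ord Zp_cast// LamE.
  rewrite -rmorphMn lecR natrM natrX exprMn -exprM exprD -mulr_natr natrX.
  by rewrite le_eqVlt; apply/orP; left; apply/eqP; ring.
apply: ler_sum => E _; rewrite -sumrB; apply: le_trans (ler_norm_sum _ _ _) _.
rewrite (bigID (fun x => isotropic (orthb E) (nilb E) x)) /= big1 ?add0r; last first.
  move=> x /forallP xi.
  have x0 u : coef E x u = 0.
    by apply/eqP; have := xi u; rewrite /pair_ok /coef; case: ifP.
  rewrite -mulrBr (eq_bigr (fun _ => 1)); last by move=> u _; rewrite x0 fourier0.
  rewrite [in X in _ - X](eq_bigr (fun _ => 1)); last first.
    by move=> u _; rewrite x0 fourier0.
  by rewrite subrr mulr0 normr0.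
apply: le_trans (_ : \sum_(x | ~~ isotropic (orthb E) (nilb E) x)
   (rho ^+ defects (orthb E) (nilb E) x + rho ^+ defects (orthb E) (nilb E) x)%:C%C <= _).
  apply: ler_sum => x _; rewrite -mulrBr normrM normrM norm_chi mulr1 normC_real.
  rewrite -[leRHS]mul1r ler_pM//; first by rewrite ler0c.
    by rewrite -[1]/(1%:C%C) lecR.
  rewrite rmorphD; apply: le_trans (ler_normB _ _) _.
  by apply: lerD; apply: fourier_prod_le.
rewrite -rmorph_sum lecR big_split /= [X in _ <= X * _](splitr eps) mulrDl.
by apply: lerD; apply: Hn.
Qed.

End universality.

(** * Matrices modulo a prime power *)

Section prime_power_ring.
Variables (p l : nat).
Hypothesis p_pr : prime p.
Local Notation q := (p ^ l.+1)%N.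

Lemma prime_power_gt1 : (1 < q)%N.
Proof. by rewrite -(exp1n l.+1) ltn_exp2r// prime_gt1. Qed.

Let q1 := prime_power_gt1.
Let p0 : (0 < p)%N := prime_gt0 p_pr.

Lemma intr_Zq_eq0 (z : int) : ((z%:~R : 'Z_q) == 0) = (q%:Z %| z)%Z.
Proof.
have nat_case (k : nat) : ((k%:R : 'Z_q) == 0) = (q %| k)%N.
  by rewrite Zp_nat -val_eqE /= Zp_cast// /dvdn.
case: z => k; first by rewrite /= -pmulrn nat_case dvdzE.
by rewrite NegzE mulrNz oppr_eq0 -pmulrn nat_case dvdzE abszN.
Qed.

Lemma Zq_natmul_eq0 (e : nat) (z : int) : (e <= l.+1)%N ->
  ((p ^ (l.+1 - e))%:R * z%:~R == 0 :> 'Z_q) = ((p ^ e)%:Z %| z)%Z.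
Proof.
move=> el; have -> : (p ^ (l.+1 - e))%:R * z%:~R = ((p ^ (l.+1 - e))%:Z * z)%:~R :> 'Z_q.
  by rewrite intrM.
have qE : q = (p ^ (l.+1 - e) * p ^ e)%N by rewrite -expnD subnK.
rewrite intr_Zq_eq0 qE PoszM dvdz_mul2l//.
by rewrite -lt0n expn_gt0 p0.
Qed.

Lemma Zq_lift (x : 'Z_q) : ((x : nat)%:Z)%:~R = x.
Proof. by rewrite -pmulrn natr_Zp. Qed.

Lemma card_Zq_ann (j : nat) : (j <= l.+1)%N ->
  #|[set x : 'Z_q | (p ^ j)%:R * x == 0]%SET| = (p ^ j)%N.
Proof.
move=> jl; have p' : (0 < p ^ (l.+1 - j))%N by rewrite expn_gt0 p0.
have lt (i : 'I_(p ^ j)) : (p ^ (l.+1 - j) * i < (Zp_trunc q).+2)%N.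
  by rewrite Zp_cast// -{2}(subnK jl) expnD ltn_pmul2l.
pose f (i : 'I_(p ^ j)) : 'Z_q := Ordinal (lt i).
have fI : injective f.
  by move=> i k /(congr1 val)/eqP /=; rewrite eqn_pmul2l// => /eqP/val_inj.
rewrite -[RHS]card_ord -(card_imset _ fI); apply: eq_card => x; rewrite inE.
have := Zq_natmul_eq0 (x : nat)%:Z (leq_subr j l.+1).
rewrite subKn// Zq_lift => ->; rewrite dvdzE /=.
apply/dvdnP/imsetP => [[k xk]|[i _ ->]]; last by exists (i : nat); rewrite mulnC.
have kp : (k < p ^ j)%N.
  rewrite -(@ltn_pmul2l (p ^ (l.+1 - j)))// mulnC -xk -expnD subnK//.
  by rewrite -[X in (_ < X)%N](Zp_cast q1) ltn_ord.
by exists (Ordinal kp) => //; apply: val_inj; rewrite /= mulnC.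
Qed.

Definition redp (x : 'Z_q) : 'F_p := (x : nat)%:R.

Lemma redp_nat (k : nat) : redp k%:R = k%:R.
Proof.
rewrite /redp val_Zp_nat//; apply/eqP; rewrite -val_eqE /= !val_Fp_nat//.
by rewrite modn_dvdm// expnS dvdn_mulr.
Qed.

Lemma redp_is_zmod_morphism : zmod_morphism redp.
Proof.
move=> x y; have nx := natr_Zp x; have ny := natr_Zp y.
have -> : x - y = ((x : nat) + (q - y))%:R.
  rewrite natrD natrB; last by rewrite -[X in (_ <= X)%N](Zp_cast q1) ltnW.
  by rewrite pchar_Zp// sub0r nx ny.
rewrite redp_nat natrD natrB; last by rewrite -[X in (_ <= X)%N](Zp_cast q1) ltnW.
by rewrite natrX pchar_Fp_0// expr0n sub0r.
Qed.

Lemma redp_is_monoid_morphism : monoid_morphism redp.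
Proof.
split; first by rewrite -[1 in LHS]/(1%:R) redp_nat.
by move=> x y; rewrite -[x in LHS]natr_Zp -[y in LHS]natr_Zp -natrM redp_nat natrM.
Qed.

HB.instance Definition _ := GRing.isZmodMorphism.Build 'Z_q 'F_p redp
  redp_is_zmod_morphism.
HB.instance Definition _ := GRing.isMonoidMorphism.Build 'Z_q 'F_p redp
  redp_is_monoid_morphism.

Definition red : {rmorphism 'Z_q -> 'F_p} := redp.

Lemma red_eq0 x : (red x == 0) = ((p ^ l)%:R * x == 0).
Proof.
have := Zq_natmul_eq0 (x : nat)%:Z (isT : 1 <= l.+1)%N.
rewrite subn1 Zq_lift expn1 dvdzE /= => ->; rewrite /redp -val_eqE /=.
by rewrite val_Fp_nat.
Qed.

Lemma red_unit x : (x \is a GRing.unit) = (red x != 0).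
Proof.
rewrite -[x in LHS]natr_Zp unitZpE// coprime_pexpl// /red /= /redp -val_eqE /=.
by rewrite val_Fp_nat// prime_coprime.
Qed.

Definition lift (a : 'F_p) : 'Z_q := (a : nat)%:R.

Lemma liftK : cancel lift red.
Proof.
move=> a; rewrite /lift /red /= redp_nat; apply: val_inj.
by rewrite /= val_Fp_nat// modn_small// -[X in (_ < X)%N](Fp_cast p_pr) ltn_ord.
Qed.

Lemma map_liftK m n (A : 'M['F_p]_(m, n)) : map_mx red (map_mx lift A) = A.
Proof. by apply/matrixP => i j; rewrite !mxE liftK. Qed.

Lemma unitmx_red n (U : 'M['Z_q]_n) : (U \in unitmx) = (map_mx red U \in unitmx).
Proof. by rewrite !unitmxE det_map_mx red_unit unitfE. Qed.

Lemma card_red_eq0 : #|[set x : 'Z_q | red x == 0]%SET| = (p ^ l)%N.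
Proof.
rewrite -(card_Zq_ann (leqnSn l)); apply: eq_card => x.
by rewrite !inE red_eq0.
Qed.

(* Invertibility over Z/p^L is tested mod p. *)
Lemma complete_rows r m (Y : 'M['Z_q]_(r, r + m)) : row_free (map_mx red Y) ->
  exists2 U : 'M['Z_q]_(r + m), U \in unitmx & Y *m U = row_mx 1%:M 0.
Proof.
set Yb := map_mx red Y => Yf.
(* [row_ebase] supplies rows that complete [Yb] to a basis over F_p; an arbitrary lift of them
   works. *)
pose Q : 'M['F_p]_(m, r + m) := row_mx 0 1%:M *m row_ebase Yb.
pose V : 'M['Z_q]_(r + m) := col_mx Y (map_mx lift Q).
have VU : V \in unitmx.
  rewrite unitmx_red map_col_mx map_liftK -/Yb -[Yb in col_mx Yb _]mulmx_ebase.
  rewrite (eqP Yf) -mul_col_mx unitmx_mul row_ebase_unit andbT.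
  have -> : col_mx (col_ebase Yb *m pid_mx r) (row_mx 0 1%:M) =
            block_mx (col_ebase Yb) 0 0 1%:M :> 'M['F_p]_(r + m).
    by rewrite pid_mx_row mul_mx_row mulmx1 mulmx0.
  by rewrite unitmxE det_ublock det1 mulr1 -unitmxE col_ebase_unit.
exists (invmx V); first by rewrite unitmx_inv.
have := mulmxV VU; rewrite mul_col_mx -[1%:M]vsubmxK => /eq_col_mx[-> _].
by rewrite scalar_mx_block /block_mx col_mxKu.
Qed.

(** The vectors are taken modulo p and not modulo q: this number serves to read off the corank of M
    mod p. *)
Definition kercard n (M : 'M['Z_q]_n) : nat :=
  #|[set v : 'rV['F_p]_n | v *m map_mx red M == 0]%SET|.

Lemma kercard_congr n (U M : 'M['Z_q]_n) : U \in unitmx ->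
  kercard (U *m M *m U^T) = kercard M.
Proof.
rewrite unitmx_red; set Ub := map_mx red U => UU.
have inj : injective (fun v : 'rV_n => v *m Ub) by apply: can_inj (mulmxK UU).
rewrite /kercard -(card_imset _ inj); apply: eq_card => v; rewrite !inE.
apply/imsetP/eqP => [[u + ->]|v0].
  rewrite inE !map_mxM -/Ub -map_trmx -/Ub !mulmxA => /eqP u0.
  have UTU : Ub^T \in unitmx by rewrite unitmx_tr.
  by apply: (can_inj (mulmxK UTU)); rewrite u0 mul0mx.
exists (v *m invmx Ub); last by rewrite mulmxKV.
by rewrite inE !map_mxM -/Ub !mulmxA mulmxKV// v0 mul0mx.
Qed.

Lemma kercardE n (M : 'M['Z_q]_n) : kercard M = (p ^ (n - \rank (map_mx red M)))%N.
Proof.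
set B := map_mx _ _; rewrite -mxrank_ker.
have -> : (p ^ \rank (kermx B))%N = #|{: 'rV['F_p]_(\rank (kermx B))}|.
  by rewrite card_mx card_Fp// mul1n.
have inj : injective (fun v : 'rV['F_p]_(\rank (kermx B)) => v *m row_base (kermx B)).
  exact: (row_free_inj (row_base_free _)).
rewrite -(card_imset _ inj); apply: eq_card => v; rewrite inE.
have -> : (v *m B == 0) = (v <= row_base (kermx B))%MS.
  by rewrite eq_row_base (sameP sub_kermxP eqP).
by apply/submxP/imsetP => [[z ->]|[z _ ->]]; exists z.
Qed.

End prime_power_ring.

(** * Fourier decay of balanced laws *)

Section balanced.
Variables (R : realType) (p l : nat).
Hypothesis p_pr : prime p.
Local Notation q := (p ^ l.+1)%N.
Local Notation q1 := (prime_power_gt1 l p_pr).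
Local Notation red := (red l p_pr).

Definition balanced (alpha : R) n (w : upper_index n -> 'Z_q -> R) : Prop :=
  forall u (a : 'F_p), \sum_(x | red x == a) w u x <= 1 - alpha.

Lemma chi_gap : exists2 kappa : R, 0 < kappa <= 1 &
  forall t : 'Z_q, t != 0 -> complex.Re (chi R q1 t) <= 1 - kappa.
Proof.
(* A minimum over finitely many t; the default value 1 ensures kappa <= 1. *)
exists (\big[Num.min/1]_(t : 'Z_q | t != 0) (1 - complex.Re (chi R q1 t))).
  apply/andP; split; last by rewrite bigmin_le_id.
  apply: (big_ind (fun x => 0 < x)) => //= [x y x0 y0|t t0]; first by rewrite lt_min x0.
  have z1 := norm_chi R q1 t.
  have : (complex.Re (chi R q1 t)) ^+ 2 + (complex.Im (chi R q1 t)) ^+ 2 = 1.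
    by apply: complexI; rewrite add_Re2_Im2 z1 expr1n.
  have : chi R q1 t != 1 by rewrite chi_eq1.
  case: (chi R q1 t) => x y /=; rewrite eq_complex /= => n1 xy.
  rewrite subr_gt0 ltNge; apply: contra n1 => x1.
  have y2 : 0 <= y ^+ 2 by rewrite sqr_ge0.
  have xE : x = 1 by nra.
  by move: xy; rewrite xE expr1n => /eqP; rewrite -subr_eq0 addrAC subrr add0r sqrf_eq0 eqxx.
move=> t t0; rewrite lerBrDl -lerBrDr; exact: bigmin_le_cond.
Qed.

(** The squared modulus is the mean of chi ((x - y) t) for independent x and y. Given y, and as t is
    nonzero, (x - y) t vanishes only if x - y is not a unit, that is x = y mod p, which has
    probability at most 1 - alpha; otherwise the real part drops by kappa. *)
Lemma balanced_fourier_le (alpha : R) : 0 < alpha <= 1 ->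
  exists2 rho : R, 0 < rho < 1 & forall n (w : upper_index n -> 'Z_q -> R),
    is_law w -> balanced alpha w -> fourier_le q1 rho w.
Proof.
move=> /andP[a0 a1]; have [kappa /andP[k0 k1] kP] := chi_gap.
have ka0 : 0 < kappa * alpha by rewrite mulr_gt0.
have ka1 : kappa * alpha <= 1 by rewrite -[leRHS]mulr1 ler_pM// ltW.
(* 1 - kappa alpha <= (1 - kappa alpha / 2)^2 passes from the squared modulus to the modulus. *)
exists (1 - kappa * alpha / 2); first by lra.
move=> n w [w0 w1] wb u t t0.
set f := fourier q1 w u t.
have Re_sum (I : finType) (F : I -> R[i]) :
    complex.Re (\sum_i F i) = \sum_i complex.Re (F i).
  by apply: (big_morph (@complex.Re R)) => // -[a b] [c d].
have f2 : complex.Re (f * f^*) <= 1 - kappa * alpha.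
  have -> : f * f^* = \sum_y \sum_x ((w u x * w u y)%:C%C * chi R q1 ((x - y) * t)).
    rewrite /f /fourier rmorph_sum /= mulr_sumr; apply: eq_bigr => y _.
    rewrite mulr_suml; apply: eq_bigr => x _.
    rewrite rmorphM /= conj_chi mulrBl chiD rmorphM /= conj_Creal; last first.
      by apply/complex_realP; exists (w u y).
    by rewrite mulrACA.
  rewrite Re_sum.
  have -> : 1 - kappa * alpha = \sum_y w u y * (1 - kappa * alpha).
    by rewrite -mulr_suml w1 mul1r.
  apply: ler_sum => y _; rewrite Re_sum.
  apply: le_trans (_ : \sum_x (w u x * w u y - (if (x - y) * t != 0 then
     kappa * (w u x * w u y) else 0)) <= _).
    apply: ler_sum => x _.
    have -> : complex.Re ((w u x * w u y)%:C%C * chi R q1 ((x - y) * t)) =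
        w u x * w u y * complex.Re (chi R q1 ((x - y) * t)).
      by case: (chi _ _ _) => a b /=; rewrite mul0r subr0.
    have ww : 0 <= w u x * w u y by rewrite mulr_ge0.
    case: ifP => [xy|/negbFE/eqP ->]; last by rewrite chi0 /= mulr1 subr0.
    apply: le_trans (ler_wpM2l ww (kP _ xy)) _; rewrite mulrBr mulr1.
    by rewrite [kappa * _]mulrC.
  rewrite sumrB -mulr_suml w1 mul1r mulrBr mulr1 lerD2l lerN2 -big_mkcond /=.
  rewrite -mulr_sumr -mulr_suml mulrCA.
  apply: ler_wpM2l; first exact: ltW.
  rewrite mulrC; apply: ler_wpM2r => //.
  have : \sum_(x | ~~ ((x - y) * t != 0)) w u x <= 1 - alpha.
    apply: le_trans (wb u (red y)).
    rewrite [leRHS](bigID (fun x => ~~ ((x - y) * t != 0))) /=.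
    rewrite -[leLHS]addr0; apply: lerD; last exact: sumr_ge0.
    rewrite [leRHS](eq_bigl (fun x => ~~ ((x - y) * t != 0)))// => x.
    rewrite andb_idl// negbK => /eqP xy0; rewrite -subr_eq0 -rmorphB.
    apply: contraT => nz; rewrite -red_unit in nz.
    by case/negP: t0; apply/eqP; apply: (mulrI nz); rewrite xy0 mulr0.
  have := w1 u; rewrite (bigID (fun x => (x - y) * t != 0)) /=; lra.
have rho0 : 0 <= 1 - kappa * alpha / 2 by lra.
rewrite -ler_sqr ?nnegrE ?normr_ge0 ?ler0c// normCK.
have -> : f * f^* = (complex.Re (f * f^*))%:C%C.
  by rewrite -normCK RRe_real// realX// normr_real.
by rewrite -rmorphXn lecR; apply: le_trans f2 _; nra.
Qed.

End balanced.

(** * Uniform symmetric matrices *)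

Lemma sumr_constE (R : nzRingType) (I : finType) (A : pred I) (c : R) :
  \sum_(i | A i) c = #|[pred i | A i]|%:R * c.
Proof. by rewrite mulr_natl -sumr_const. Qed.

Section symmetric_sums.
Variables (R : realType) (p l : nat).
Hypothesis p_pr : prime p.
Local Notation q := (p ^ l.+1)%N.
Local Notation red := (red l p_pr).
Local Notation kercard := (kercard (l := l) p_pr).

Definition symsum n (h : 'M['Z_q]_n -> R) : R := \sum_(M | M^T == M) h M.

Definition symcount n : R := symsum (fun _ : 'M['Z_q]_n => 1).

Lemma eq_symsum n (h h' : 'M['Z_q]_n -> R) : (forall M, M^T = M -> h M = h' M) ->
  symsum h = symsum h'.
Proof. by move=> hh; apply: eq_bigr => M /eqP /hh. Qed.

Lemma symsumZ n (c : R) (h : 'M['Z_q]_n -> R) :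
  symsum (fun M => c * h M) = c * symsum h.
Proof. by rewrite /symsum mulr_sumr. Qed.

Lemma symsum_block r m (h : 'M['Z_q]_(r + m) -> R) : symsum h =
  \sum_(A : 'M['Z_q]_r | A^T == A) \sum_(B : 'M['Z_q]_(r, m))
    symsum (fun D : 'M['Z_q]_m => h (block_mx A B B^T D)).
Proof.
pose f (t : 'M['Z_q]_r * ('M['Z_q]_(r, m) * 'M['Z_q]_m)) : 'M['Z_q]_(r + m) :=
  block_mx t.1 t.2.1 t.2.1^T t.2.2.
pose g (M : 'M['Z_q]_(r + m)) := (ulsubmx M, (ursubmx M, drsubmx M)).
transitivity (\sum_(A : 'M['Z_q]_r | A^T == A)
   \sum_(t : 'M['Z_q]_(r, m) * 'M['Z_q]_m | t.2^T == t.2) h (f (A, t))); last first.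
  apply: eq_bigr => A _; rewrite /symsum.
  rewrite (pair_big predT (fun D : 'M['Z_q]_m => D^T == D)
    (fun B D => h (block_mx A B B^T D))) /=.
  by apply: eq_bigl => -[B D].
rewrite (pair_big (fun A : 'M['Z_q]_r => A^T == A)
   (fun t : 'M['Z_q]_(r, m) * 'M['Z_q]_m => t.2^T == t.2)
   (fun A t => h (f (A, t)))) /=.
rewrite /symsum (reindex_onto f g) /=.
  apply: eq_big => [[A [B D]]|[A [B D]] _] //=.
  rewrite /g /f /= block_mxKul block_mxKur block_mxKdr eqxx andbT.
  rewrite tr_block_mx trmxK; apply/eqP/andP => [/eq_block_mx[-> _ _ ->]//|].
  by move=> [/eqP -> /eqP ->].
move=> M /eqP Ms; rewrite /f /g /= -[RHS]submxK; congr block_mx.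
by rewrite trmx_ursub Ms.
Qed.

Lemma symsum_congr n (U : 'M['Z_q]_n) (h : 'M['Z_q]_n -> R) : U \in unitmx ->
  symsum h = symsum (fun M => h (U *m M *m U^T)).
Proof.
move=> UU; have UTU : U^T \in unitmx by rewrite unitmx_tr.
have inj : injective (fun M => U *m M *m U^T).
  by move=> M N /(can_inj (mulmxK UTU)) /(can_inj (mulKmx UU)).
rewrite /symsum (reindex_inj inj); apply: eq_bigl => M.
by rewrite !trmx_mul trmxK mulmxA (inj_eq inj).
Qed.

Lemma symsum_shift n (N : 'M['Z_q]_n) (h : 'M['Z_q]_n -> R) : N^T = N ->
  symsum h = symsum (fun M => h (M - N)).
Proof.
move=> Ns; rewrite /symsum (reindex_inj (subIr N)); apply: eq_bigl => M.
by rewrite linearB /= Ns (inj_eq (subIr N)).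
Qed.

Lemma card_mx_Zq m n : #|{: 'M['Z_q]_(m, n)}| = (q ^ (m * n))%N.
Proof. by rewrite card_mx card_ord Zp_cast ?prime_power_gt1. Qed.

Lemma symcount_block r m : symcount (r + m) =
  symcount r * (q ^ (r * m))%:R * symcount m.
Proof.
rewrite /symcount symsum_block.
under eq_bigr do rewrite sumr_constE card_mx_Zq.
by rewrite sumr_constE [X in _ = X * _ * _]/symsum sumr_constE mulr1 mulrA.
Qed.

Lemma symcount_gt0 n : 0 < symcount n.
Proof.
rewrite /symcount /symsum sumr_constE mulr1 ltr0n; apply/card_gt0P; exists 0.
by rewrite inE trmx0 eqxx.
Qed.

Lemma mx1_sym (A : 'M['Z_q]_1) : A^T == A.
Proof. by apply/eqP/matrixP => i j; rewrite mxE !ord1. Qed.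

Lemma symcount1 : symcount 1 = q%:R.
Proof.
rewrite /symcount /symsum (eq_bigl predT) => [|A]; last by rewrite mx1_sym.
by rewrite sumr_const card_mx_Zq muln1 expn1.
Qed.

Lemma symcount0 : symcount 0 = 1.
Proof.
rewrite /symcount /symsum (eq_bigl (pred1 0)) ?big_pred1_eq// => A.
by rewrite [A]flatmx0 trmx0 /= !eqxx.
Qed.

Lemma kercard_gt0 n (M : 'M['Z_q]_n) : (0 < kercard M)%N.
Proof. by apply/card_gt0P; exists 0; rewrite inE mul0mx. Qed.

Lemma kercard_diag0 r m (A : 'M['Z_q]_r) (B : 'M['Z_q]_(r, m)) (D : 'M['Z_q]_m) :
  map_mx red A = 0 -> map_mx red B = 0 ->
  kercard (block_mx A B B^T D) = (p ^ r * kercard D)%N.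
Proof.
move=> A0 B0; rewrite /kercard map_block_mx A0 B0 -map_trmx B0 trmx0.
pose f (t : 'rV['F_p]_r * 'rV['F_p]_m) : 'rV['F_p]_(r + m) := row_mx t.1 t.2.
have fI : injective f by move=> [a b] [c d] /eq_row_mx[/= -> ->].
set K := [set v | v *m map_mx red D == 0]%SET.
have -> : (p ^ r)%N = #|[set: 'rV['F_p]_r]%SET|.
  by rewrite cardsT card_mx card_Fp// mul1n.
rewrite -cardsX -(card_imset _ fI); apply: eq_card => v; rewrite inE.
rewrite -[v in LHS]hsubmxK mul_row_block !mulmx0 !add0r.
apply/eqP/imsetP => [v0|[[a b] + ->]]; last first.
  by rewrite !inE /= row_mxKr => /eqP ->; rewrite row_mx0.
exists (lsubmx v, rsubmx v); last by rewrite /f hsubmxK.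
by rewrite !inE /=; apply/eqP; move: v0; rewrite -row_mx0 => /eq_row_mx[].
Qed.

Lemma kercard_unit m (a : 'M['Z_q]_1) (D : 'M['Z_q]_m) : a \in unitmx ->
  kercard (block_mx a 0 0 D) = kercard D.
Proof.
rewrite unitmx_red => aU; rewrite /kercard map_block_mx !map_mx0.
pose f (v : 'rV['F_p]_m) : 'rV['F_p]_(1 + m) := row_mx 0 v.
have fI : injective f by move=> a' b /eq_row_mx[_ /= ->].
rewrite -(card_imset _ fI); apply: eq_card => v; rewrite inE.
rewrite -[v in LHS]hsubmxK mul_row_block !mulmx0 !add0r addr0.
apply/eqP/imsetP => [v0|[b + ->]]; last first.
  by rewrite !inE /f row_mxKr row_mxKl mul0mx => /eqP ->; rewrite row_mx0.
move: v0; rewrite -row_mx0 => /eq_row_mx[v1 v2].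
exists (rsubmx v); first by rewrite inE v2.
rewrite /f -[LHS]hsubmxK; congr row_mx.
by apply: (can_inj (mulmxK aU)); rewrite v1 mul0mx.
Qed.

(** The corner with rows (0, 1) and (1, b) is invertible modulo p, so a kernel vector is determined
    by its last m coordinates z: the second coordinate is 0 and the first is - z w^T. *)
Lemma kercard_hyperbolic m (a b : 'M['Z_q]_1) (w : 'M['Z_q]_(1, m)) (D : 'M['Z_q]_m) :
  map_mx red a = 0 ->
  kercard (block_mx a (row_mx 1%:M 0) (row_mx 1%:M 0)^T (block_mx b w w^T D)) =
  kercard D.
Proof.
move=> a0; rewrite /kercard !map_block_mx a0 tr_row_mx trmx1 trmx0.
rewrite map_row_mx map_col_mx map_mx1 !map_mx0 -map_trmx.
set bb := map_mx red b; set wb := map_mx red w; set Db := map_mx red D.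
pose f (v : 'rV['F_p]_m) : 'rV['F_p]_(1 + (1 + m)) :=
  row_mx (- (v *m wb^T)) (row_mx 0 v).
have fI : injective f by move=> x y /eq_row_mx[_ /eq_row_mx[_ /= ->]].
rewrite -(card_imset _ fI); apply: eq_card => v; rewrite inE.
have vE : v = row_mx (lsubmx v) (row_mx (lsubmx (rsubmx v)) (rsubmx (rsubmx v))).
  by rewrite !hsubmxK.
set x := lsubmx v in vE; set y := lsubmx _ in vE; set z := rsubmx _ in vE.
have -> : v *m block_mx 0 (row_mx 1%:M 0) (col_mx 1%:M 0) (block_mx bb wb wb^T Db) =
    row_mx y (row_mx (x + (y *m bb + z *m wb^T)) (y *m wb + z *m Db)).
  rewrite vE mul_row_block mulmx0 add0r mul_row_col mulmx0 addr0 mulmx1.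
  by rewrite mul_mx_row mulmx1 mulmx0 mul_row_block add_row_mx add0r.
apply/eqP/imsetP => [|[z' + v'E]].
  rewrite -row_mx0 => /eq_row_mx[y0]; rewrite -row_mx0 => /eq_row_mx[].
  rewrite y0 !mul0mx !add0r => xz zD; exists z; first by rewrite inE zD.
  by rewrite vE y0 /f; congr row_mx; apply/eqP; rewrite -addr_eq0 xz.
move: vE; rewrite v'E => /eq_row_mx[xE /eq_row_mx[yE zE]].
rewrite inE -yE -zE -xE => /eqP ->.
by rewrite !mul0mx !add0r addNr !row_mx0.
Qed.

Lemma unit_mx1 (a : 'M['Z_q]_1) : (a \in unitmx) = (map_mx red a != 0).
Proof.
rewrite unitmx_red unitmxE det_mx11 unitfE; congr (~~ _).
apply/eqP/eqP => [a0|->]; last by rewrite mxE.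
by apply/matrixP => i j; rewrite !ord1 a0 mxE.
Qed.

Lemma card_red_mx0 m n : #|[set v : 'M['Z_q]_(m, n) | map_mx red v == 0]%SET| =
  (p ^ (l * (m * n)))%N.
Proof.
pose F (f : {ffun 'I_m * 'I_n -> 'Z_q}) : 'M['Z_q]_(m, n) := \matrix_(i, j) f (i, j).
have FI : injective F.
  by move=> f g /matrixP fg; apply/ffunP => -[i j]; have := fg i j; rewrite !mxE.
transitivity #|family (fun _ : 'I_m * 'I_n => mem [set x : 'Z_q | red x == 0]%SET)|.
  rewrite -(card_imset _ FI); apply: eq_card => v; rewrite inE.
  apply/eqP/imsetP => [v0|[f /familyP f0 ->]]; last first.
    by apply/matrixP => i j; have := f0 (i, j); rewrite !mxE inE => /eqP.
  exists [ffun ij => v ij.1 ij.2].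
    by apply/familyP => -[i j]; rewrite ffunE inE; move/matrixP: v0 => /(_ i j); rewrite !mxE => ->.
  by apply/matrixP => i j; rewrite mxE ffunE.
rewrite card_family foldrE big_image /= prod_nat_const card_prod !card_ord card_red_eq0//.
by rewrite -expnM.
Qed.

Section recurrence.
Variable g : nat -> R.

Let S n (g : nat -> R) := symsum (fun M : 'M['Z_q]_n => g (kercard M)).

(** Schur complement: D - v^T a^-1 v runs through all symmetric matrices when D does. *)
Lemma symsum_unit_corner m (a : 'M['Z_q]_1) (v : 'M['Z_q]_(1, m)) : a \in unitmx ->
  symsum (fun D : 'M['Z_q]_m => g (kercard (block_mx a v v^T D))) = S m g.
Proof.
move=> aU; pose N := v^T *m invmx a *m v.
have as_ : a^T = a by apply/eqP; exact: mx1_sym.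
have Ns : N^T = N by rewrite /N !trmx_mul trmxK trmx_inv as_ mulmxA.
rewrite /S [RHS](symsum_shift _ Ns); apply: eq_symsum => D _.
pose P : 'M['Z_q]_(1 + m) := block_mx 1%:M 0 (v^T *m invmx a) 1%:M.
have PU : P \in unitmx by rewrite unitmxE det_lblock !det1 mulr1 unitr1.
rewrite -(kercard_unit (D - N) aU) -[in RHS](kercard_congr p_pr _ PU).
congr (g (kercard _)); rewrite /P tr_block_mx !trmx1 trmx0 trmx_mul trmxK trmx_inv as_.
rewrite !mulmx_block !mul1mx !mulmx1 !mul0mx !mulmx0 !addr0 !add0r.
by rewrite (mulmxKV aU) (mulKVmx aU) mulmxA /N addrC subrK.
Qed.

(** A change of basis brings v to (1 0), and the hyperbolic corner splits off. The factor q^(m+1)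
    counts the entries [b] and [w] that no longer influence the kernel. *)
Lemma symsum_hyperbolic m (a : 'M['Z_q]_1) (v : 'M['Z_q]_(1, 1 + m)) :
  map_mx red a = 0 -> map_mx red v != 0 ->
  symsum (fun D : 'M['Z_q]_(1 + m) => g (kercard (block_mx a v v^T D))) =
  (q ^ m.+1)%:R * S m g.
Proof.
move=> a0 v0.
have [|U UU vU] := complete_rows (r := 1) (m := m) (Y := v) (p_pr := p_pr).
  by rewrite /row_free eqn_leq rank_leq_row lt0n mxrank_eq0.
have UV : (invmx U)^T \in unitmx by rewrite unitmx_tr unitmx_inv.
rewrite (symsum_congr _ UV).
transitivity (symsum (fun D : 'M['Z_q]_(1 + m) =>
    g (kercard (block_mx a (row_mx 1%:M 0) (row_mx 1%:M 0)^T D)))).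
  apply: eq_symsum => D _.
  pose P : 'M['Z_q]_(1 + (1 + m)) := block_mx 1%:M 0 0 U^T.
  have PU : P \in unitmx.
    by rewrite unitmxE det_ublock det1 mul1r -unitmxE unitmx_tr.
  rewrite -[in LHS](kercard_congr p_pr _ PU); congr (g (kercard _)).
  rewrite /P tr_block_mx !trmx1 !trmx0 trmxK.
  rewrite !mulmx_block !mul1mx !mulmx1 !mul0mx !mulmx0 !addr0 !add0r.
  rewrite vU -trmx_mul vU trmxK -!mulmxA mulVmx// mulmx1 mulmxA -trmx_mul mulVmx//.
  by rewrite trmx1 mul1mx.
rewrite symsum_block (eq_bigl predT) => [|A]; last by rewrite mx1_sym.
under eq_bigr => b _ do under eq_bigr => w _ do
  under eq_symsum => D _ do rewrite kercard_hyperbolic//.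
rewrite -/(S m g); under eq_bigr do rewrite sumr_constE card_mx_Zq.
by rewrite sumr_constE card_mx_Zq !mul1n expn1 mulrA -natrM -expnS.
Qed.

Lemma card_mx1_zero : #|[pred a : 'M['Z_q]_1 | a \notin unitmx]| = (p ^ l)%N.
Proof.
have := card_red_mx0 1 1; rewrite !muln1 => <-; apply: eq_card => a.
by rewrite !inE unit_mx1 negbK.
Qed.

Lemma card_mx1_unit : #|[pred a : 'M['Z_q]_1 | a \in unitmx]| = (q - p ^ l)%N.
Proof.
have e : #|[predC [pred a : 'M['Z_q]_1 | a \in unitmx]]| = (p ^ l)%N.
  by rewrite -card_mx1_zero; apply: eq_card => a; rewrite !inE.
have := cardC [pred a : 'M['Z_q]_1 | a \in unitmx].
by rewrite card_mx_Zq muln1 expn1 e => H; rewrite -[LHS](addnK (p ^ l)) H.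
Qed.

Lemma card_row_nonzero m : #|[pred v : 'M['Z_q]_(1, m) | map_mx red v != 0]| =
  (q ^ m - p ^ (l * m))%N.
Proof.
have := card_red_mx0 1 m; rewrite mul1n => <-.
have := card_mx_Zq 1 m; rewrite mul1n => <-.
rewrite -(cardC [pred v : 'M['Z_q]_(1, m) | map_mx red v != 0]).
rewrite [X in (_ = _ + X - _)%N](_ : _ = #|[set v : 'M['Z_q]_(1, m) | map_mx red v == 0]%SET|).
  by rewrite addnK.
by apply: eq_card => v; rewrite !inE negbK.
Qed.

(** Three cases for the first row: a unit in the corner; zero modulo p throughout, which multiplies
    the kernel by p; zero in the corner but v nonzero modulo p. The last sum is left as it is, since
    its reduction lowers the size by two. *)
Lemma symsum_kercard_split m : S (1 + m) g =
  (q - p ^ l)%:R * (q ^ m)%:R * S m g +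
  \sum_(a : 'M['Z_q]_1 | a \notin unitmx) ((p ^ (l * m))%:R * S m (fun k => g (p * k)%N) +
    \sum_(v : 'M['Z_q]_(1, m) | map_mx red v != 0)
      symsum (fun D : 'M['Z_q]_m => g (kercard (block_mx a v v^T D)))).
Proof.
rewrite /S symsum_block (eq_bigl predT) => [|A]; last by rewrite mx1_sym.
rewrite (bigID (fun a : 'M['Z_q]_1 => a \in unitmx)) /=; congr (_ + _).
  under eq_bigr => a aU do under eq_bigr => v _ do rewrite (symsum_unit_corner _ aU).
  under eq_bigr do rewrite sumr_constE card_mx_Zq mul1n.
  by rewrite sumr_constE card_mx1_unit mulrA.
apply: eq_bigr => a; rewrite unit_mx1 negbK => /eqP a0.
rewrite (bigID (fun v : 'M['Z_q]_(1, m) => map_mx red v == 0)) /=; congr (_ + _).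
rewrite (eq_bigr (fun _ => S m (fun k => g (p * k)%N))); last first.
  move=> v /eqP v0; apply: eq_symsum => D _; rewrite kercard_diag0// expn1//.
rewrite sumr_constE; congr (_%:R * _).
by have := card_red_mx0 1 m; rewrite mul1n => <-; apply: eq_card => v; rewrite !inE.
Qed.

Lemma symsum_kercard_rec m : S (1 + (1 + m)) g =
  (q - p ^ l)%:R * (q ^ (1 + m))%:R * S (1 + m) g +
  (p ^ l)%:R * ((p ^ (l * (1 + m)))%:R * S (1 + m) (fun k => g (p * k)%N) +
    (q ^ (1 + m) - p ^ (l * (1 + m)))%:R * (q ^ m.+1)%:R * S m g).
Proof.
rewrite symsum_kercard_split; congr (_ + _).
rewrite -card_mx1_zero -sumr_constE; apply: eq_bigr => a.
rewrite unit_mx1 negbK => /eqP a0; congr (_ + _).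
rewrite -card_row_nonzero -mulrA -sumr_constE.
by apply: eq_bigr => v v0; rewrite symsum_hyperbolic.
Qed.

Lemma symsum_kercard1 : S 1 g =
  (q - p ^ l)%:R * g 1%N + (p ^ l)%:R * g p.
Proof.
have S0 (g' : nat -> R) : S 0 g' = g' 1%N.
  rewrite /S /symsum (big_pred1 0) => [|M]; last by rewrite [M]flatmx0 trmx0 /= !eqxx.
  congr (g' _); rewrite /kercard -[RHS](cards1 (0 : 'rV['F_p]_0)); apply: eq_card => v.
  by rewrite !inE !thinmx0 !eqxx.
rewrite (symsum_kercard_split 0) !S0 expn0 mulr1; congr (_ + _).
rewrite -card_mx1_zero -sumr_constE; apply: eq_bigr => a _.
rewrite muln0 expn0 mul1r muln1 big_pred0 ?addr0// => v.
by apply/negbF/eqP; exact: thinmx0.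
Qed.

End recurrence.

Definition mean n (h : 'M['Z_q]_n -> R) : R := symsum h / symcount n.

Definition mean_ker n (g : nat -> R) : R := mean (fun M : 'M['Z_q]_n => g (kercard M)).

Let P : R := p%:R.
Let P0 : 0 < P. Proof. by rewrite ltr0n prime_gt0. Qed.
Let Pn0 : P != 0. Proof. by rewrite gt_eqF. Qed.

Lemma mean_ker0 g : mean_ker 0 g = g 1%N.
Proof.
rewrite /mean_ker /mean symcount0 divr1 /symsum (big_pred1 0) => [|M]; last first.
  by rewrite [M]flatmx0 trmx0 /= !eqxx.
congr (g _); rewrite /kercard -[RHS](cards1 (0 : 'rV['F_p]_0)); apply: eq_card => v.
by rewrite !inE !thinmx0 !eqxx.
Qed.

Lemma mean_ker1 g : mean_ker 1 g = (1 - P^-1) * g 1%N + P^-1 * g p.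
Proof.
rewrite /mean_ker /mean symsum_kercard1 symcount1 natrB; last first.
  by rewrite leq_exp2l ?prime_gt1.
rewrite !natrX exprS -/P; have : P ^+ l != 0 by rewrite expf_neq0.
by move=> Pl; field; rewrite Pl Pn0.
Qed.

(** All powers of p^l cancel, and the coefficients are the probabilities of the three cases for the
    first row. *)
Lemma mean_ker_rec m g : mean_ker m.+2 g =
  (1 - P^-1) * mean_ker m.+1 g + P^- m.+2 * mean_ker m.+1 (fun k => g (p * k)%N) +
  P^-1 * (1 - P^- m.+1) * mean_ker m g.
Proof.
rewrite /mean_ker /mean (symsum_kercard_rec g m).
have c2 : symcount m.+2 = q%:R * (q ^ m.+1)%:R * symcount m.+1.
  by rewrite -[m.+2]/(1 + m.+1)%N symcount_block symcount1 mul1n.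
have c1 : symcount m.+1 = q%:R * (q ^ m)%:R * symcount m.
  by rewrite -[m.+1]/(1 + m)%N symcount_block symcount1 mul1n.
have s0 : symcount m != 0 by rewrite gt_eqF// symcount_gt0.
have Pl : P ^+ l != 0 by rewrite expf_neq0.
have Pm : (P ^+ l) ^+ m != 0 by rewrite expf_neq0.
have Pm' : P ^+ m != 0 by rewrite expf_neq0.
rewrite c2 [in X in X / _]natrB; last by rewrite leq_exp2l ?prime_gt1.
rewrite [in X in X / _]natrB; last first.
  by rewrite -expnM leq_exp2l ?prime_gt1// leq_mul2r leqnSn orbT.
rewrite !add1n c1 !natrX -/P [P ^+ l.+1]exprS ![(P * P ^+ l) ^+ _]exprMn mulnS exprD exprM.
rewrite ![_ ^+ m.+2]exprS ![_ ^+ m.+1]exprS.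
field; rewrite ?s0 ?Pl ?Pm ?Pm' ?Pn0 //=.
Qed.

End symmetric_sums.

(** * Kernels of uniform symmetric matrices modulo p *)

Section haar.
Variables (R : realType) (p l : nat).
Hypothesis p_pr : prime p.
Local Notation mean_ker := (mean_ker (R := R) l p_pr).
Let P : R := p%:R.
Let P0 : 0 < P. Proof. by rewrite ltr0n prime_gt0. Qed.
Let P1 : 1 < P. Proof. by rewrite ltr1n prime_gt1. Qed.
Let Pn0 : P != 0. Proof. by rewrite gt_eqF. Qed.

Lemma mean_ker_ge0 n (g : nat -> R) : (forall k, 0 <= g k) -> 0 <= mean_ker n g.
Proof.
by move=> g0; rewrite divr_ge0 ?sumr_ge0 ?(ltW (symcount_gt0 _ _ p_pr _)).
Qed.

Lemma mean_kerZ n (c : R) (g : nat -> R) :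
  mean_ker n (fun k => c * g k) = c * mean_ker n g.
Proof. by rewrite /mean_ker /mean symsumZ mulrA. Qed.

Lemma eq_mean_ker n (g g' : nat -> R) : (forall k, (0 < k)%N -> g k = g' k) ->
  mean_ker n g = mean_ker n g'.
Proof.
move=> gg; congr (_ / _); apply: eq_symsum => M _; apply: gg; exact: kercard_gt0.
Qed.

(** The middle term of the recurrence vanishes, as p k = 1 has no solution. Passing from an odd size
    to the next even one leaves the probability unchanged, hence [uphalf]. *)
Lemma mean_ker_nonsingular n : mean_ker n (fun k => (k == 1)%N%:R) =
  \prod_(1 <= k < (uphalf n).+1) (1 - p%:R ^ (1 - 2 * k%:Z)).
Proof.
pose s n : R := mean_ker n (fun k => (k == 1)%N%:R); rewrite -[LHS]/(s n).
have sub m : mean_ker m (fun k => (p * k == 1)%N%:R) = 0.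
  rewrite (@eq_mean_ker m _ (fun k => 0 * 0)) ?mean_kerZ ?mul0r// => k _.
  case: eqP => // pk.
  have : (p %| 1)%N by rewrite -pk dvdn_mulr.
  by rewrite dvdn1 => /eqP pp; move: p_pr; rewrite pp.
have rec m : s m.+2 = (1 - P^-1) * s m.+1 + P^-1 * (1 - P^- m.+1) * s m.
  by rewrite /s mean_ker_rec sub mulr0 addr0.
have s0 : s 0%N = 1 by rewrite /s mean_ker0 eqxx.
have s1 : s 1%N = 1 - P^-1.
  rewrite /s mean_ker1 eqxx mulr1 gtn_eqF ?prime_gt1//.
  by rewrite mulr0 addr0.
pose Q m : R := \prod_(1 <= k < m.+1) (1 - p%:R ^ (1 - 2 * k%:Z)).
have QS m : Q m.+1 = Q m * (1 - P ^- (m.*2.+1)).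
  rewrite /Q big_nat_recr//=; congr (_ * (1 - _)).
  have -> : 1 - 2 * m.+1%:Z = - (m.*2.+1)%:Z by lia.
  by rewrite -exprnN.
suff H m : s m.*2 = Q m /\ s m.*2.+1 = Q m.+1.
  have [b [m ->]] : exists (b : bool) m, n = (b + m.*2)%N.
    by exists (odd n), n./2; rewrite odd_double_half.
  have [Hm1 Hm2] := H m; case: b; rewrite ?add0n ?add1n.
    by rewrite Hm2 /= doubleK.
  by rewrite Hm1 uphalf_double.
elim: m => [|m [IH1 IH2]].
  by rewrite QS /Q !big_geq// s0 s1 mul1r expr1.
have e1 : s m.+1.*2 = Q m.+1.
  by rewrite doubleS rec IH1 IH2 !QS; field; rewrite expf_neq0.
split=> //; rewrite doubleS rec -doubleS e1 IH2 [Q m.+2]QS.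
rewrite doubleS ![P ^+ _.+3]exprS ![P ^+ _.+2]exprS; field.
by rewrite !expf_neq0 ?Pn0.
Qed.

(** The recurrence has order two, so the bound is proved for two consecutive sizes at once. Since
    [b] increases, b m may be replaced by b (m+1), and the coefficients then add up to at most 1 +
    p^k / p^(m+2). *)
Lemma mean_ker_moment k n : mean_ker n (fun t => t%:R ^+ k) <=
  \prod_(1 <= i < n.+1) (1 + P ^+ k / P ^+ i).
Proof.
pose b n : R := \prod_(1 <= i < n.+1) (1 + P ^+ k / P ^+ i).
have bS m : b m.+1 = b m * (1 + P ^+ k / P ^+ m.+1) by rewrite /b big_nat_recr.
have b0 m : 0 <= b m.
  by rewrite prodr_ge0// => i _; rewrite addr_ge0// divr_ge0// exprn_ge0// ltW.
have bmono m : b m <= b m.+1.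
  by rewrite bS ler_peMr// lerDl divr_ge0// exprn_ge0// ltW.
have Pk : 1 <= P ^+ k by rewrite exprn_ege1// ltW.
have PV1 : P^-1 <= 1 by rewrite invf_le1// ltW.
suff H m : mean_ker m (fun t => t%:R ^+ k) <= b m /\
           mean_ker m.+1 (fun t => t%:R ^+ k) <= b m.+1 by case: (H n).
elim: m => [|m [IH1 IH2]]; first split.
- by rewrite mean_ker0 /b big_geq// expr1n.
- rewrite bS /b big_geq// mul1r mean_ker1 expr1n mulr1 expr1 -/P.
  by rewrite [P ^+ k / P]mulrC lerD2r lerBlDr lerDl invr_ge0 ltW.
split=> //; rewrite mean_ker_rec bS.
have -> : mean_ker m.+1 (fun t => (p * t)%N%:R ^+ k) =
    P ^+ k * mean_ker m.+1 (fun t => t%:R ^+ k).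
  by rewrite -mean_kerZ; apply: eq_mean_ker => t _; rewrite natrM exprMn.
set x := mean_ker m.+1 _ in IH2 *; set y := mean_ker m _ in IH1 *.
have yb : y <= b m.+1 by exact: le_trans IH1 (bmono m).
have Pm1 : P^- m.+1 <= 1 by rewrite invf_le1 ?exprn_gt0// exprn_ege1// ltW.
have Pm0 : 0 <= P^- m.+1 by rewrite invr_ge0 exprn_ge0// ltW.
have Pm2 : 0 <= P^- m.+2 by rewrite invr_ge0 exprn_ge0// ltW.
have t1 : (1 - P^-1) * x <= (1 - P^-1) * b m.+1 by rewrite ler_wpM2l// subr_ge0.
have t2 : P^- m.+2 * (P ^+ k * x) <= P^- m.+2 * (P ^+ k * b m.+1).
  by rewrite !ler_wpM2l// exprn_ge0// ltW.
have t3 : P^-1 * (1 - P^- m.+1) * y <= P^-1 * b m.+1.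
  rewrite -mulrA ler_wpM2l ?invr_ge0 ?(ltW P0)//.
  have y0 : 0 <= y by apply: mean_ker_ge0 => t; rewrite exprn_ge0.
  by apply: le_trans yb; rewrite ler_piMl// lerBlDr lerDl.
apply: le_trans (lerD (lerD t1 t2) t3) _.
rewrite le_eqVlt; apply/orP; left; apply/eqP; ring.
Qed.

Lemma prod_tail_le3 n : \prod_(1 <= i < n.+1) (1 + (P ^+ i)^-1) <= 3.
Proof.
have half i : (P ^+ i)^-1 <= 2^-1 ^+ i.
  rewrite -exprVn; apply: lerXn2r; rewrite ?nnegrE ?invr_ge0 ?(ltW P0)//.
  by rewrite lef_pV2 ?posrE// ler_nat prime_gt1.
case: n => [|n]; first by rewrite big_geq//; lra.
(* The stronger bound survives the induction by (1 - y)(1 + y/2) <= 1 - y/2; at n = 0 it reads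
   3/2. *)
suff : \prod_(1 <= i < n.+2) (1 + (P ^+ i)^-1) <= 3 * (1 - 2^-1 ^+ n.+1).
  move/le_trans; apply; have : 0 <= (2^-1 : R) ^+ n.+1 by rewrite exprn_ge0.
  by lra.
elim: n => [|n IH]; first by rewrite big_nat1; have := half 1%N; rewrite !expr1; lra.
rewrite big_nat_recr//=; apply: le_trans (ler_pM _ _ IH (lerD (lexx 1) (half n.+2))) _.
- by rewrite prodr_ge0// => i _; rewrite addr_ge0// invr_ge0 exprn_ge0// ltW.
- by rewrite addr_ge0// invr_ge0 exprn_ge0// ltW.
rewrite [2^-1 ^+ n.+2]exprS; set y := 2^-1 ^+ n.+1.
have y0 : 0 <= y by rewrite exprn_ge0.
have y2 : 0 <= y * y by rewrite mulr_ge0.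
have -> : 3 * (1 - y) * (1 + 2^-1 * y) = 3 * (1 - 2^-1 * y) - 3 * 2^-1 * (y * y).
  by field.
by lra.
Qed.

(** Read backwards, the first J+1 factors are 1 + p^i for 0 <= i <= J, where i = 0 gives 2; the
    later ones are 1 + p^-i and contribute at most 3. Hence 6, uniformly in n. *)
Lemma mean_ker_moment_bound J n : mean_ker n (fun t => t%:R ^+ J.+1) <=
  6 * \prod_(1 <= i < J.+1) (1 + P ^+ i).
Proof.
apply: le_trans (mean_ker_moment _ _) _.
pose F i : R := 1 + P ^+ J.+1 / P ^+ i.
have F1 i : 1 <= F i by rewrite lerDl divr_ge0// exprn_ge0// ltW.
have F0 i : 0 <= F i by exact: le_trans (F1 i).
apply: le_trans (_ : \prod_(1 <= i < (J.+1 + n).+1) F i <= _).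
  rewrite (@big_cat_nat _ _ _ n.+1 1 (J.+1 + n).+1)//=; last by rewrite ltnS leq_addl.
  rewrite -[leLHS]mulr1; apply: ler_wpM2l.
    by apply: prodr_ge0 => i _; exact: F0.
  by apply: (big_ind (fun x => 1 <= x)) => // x y x1 y1; rewrite mulr_ege1.
rewrite (@big_cat_nat _ _ _ J.+2 1 (J.+1 + n).+1)//=; last by rewrite !ltnS leq_addr.
have -> : \prod_(1 <= i < J.+2) F i = \prod_(0 <= i < J.+1) (1 + P ^+ i).
  rewrite big_nat_rev /= big_add1 /=; apply: eq_big_nat => i /andP[_ iJ].
  rewrite /F; congr (1 + _).
  set d := (1 + J.+2 - i.+2)%N.
  have e : (J.+1 = i + d)%N by rewrite /d; lia.
  by rewrite e exprD mulfK// expf_neq0.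
have -> : \prod_(J.+2 <= i < (J.+1 + n).+1) F i =
    \prod_(1 <= i < n.+1) (1 + (P ^+ i)^-1).
  rewrite -[J.+2]add1n -[(J.+1 + n).+1]addSn [(J.+1.+1 + n)%N]addSn -[(J.+1 + n).+1]addnS.
  rewrite [(J.+1 + n.+1)%N]addnC big_addn addnK; apply: eq_big_nat => i _; rewrite /F.
  by rewrite exprD invfM mulrCA mulfV ?mulr1 // expf_neq0.
rewrite big_nat_recl//= expr0 [X in _ <= 6 * X]big_add1 /=.
have : 0 <= \prod_(0 <= i < J) (1 + P ^+ i.+1).
  by apply: prodr_ge0 => i _; rewrite addr_ge0// exprn_ge0// ltW.
set z := \prod_(0 <= i < J) _ => z0; have t3 := prod_tail_le3 n.
have : (1 + 1) * z * (\prod_(1 <= i < n.+1) (1 + (P ^+ i)^-1)) <= (1 + 1) * z * 3.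
  by rewrite ler_wpM2l// mulr_ge0.
by lra.
Qed.

End haar.

Lemma card_additive (X Z : finZmodType) (f : {additive X -> Z}) z :
  z \in codom f -> (#|[pred x | f x == z]| * #|codom f| = #|X|)%N.
Proof.
move=> /codomP[x0 zE].
have fib z' : z' \in codom f -> #|[pred x | f x == z']| = #|[pred x | f x == z]|.
  move=> /codomP[x1 z1E].
  rewrite -(fintype.card_image (addIr (x1 - x0)) [pred x | f x == z]).
  apply: eq_card => x; rewrite inE; apply/eqP/fintype.imageP => [fx|[y /eqP fy ->]].
    exists (x - (x1 - x0)); last by rewrite subrK.
    by rewrite inE (raddfB f) (raddfB f) fx z1E subKr zE.
  by rewrite (raddfD f) fy zE (raddfB f) z1E addrC subrK.
rewrite mulnC -sum_nat_const -[RHS]sum1_card.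
rewrite (partition_big f (mem (codom f))) => [|x _]; last exact: codom_f.
by apply: eq_bigr => z' z'f; rewrite sum1_card -(fib z' z'f).
Qed.

Lemma card_surj_fiber (X Z : finZmodType) (f : {additive X -> Z}) :
  (forall z, exists x, f x = z) ->
  forall z, (#|[pred x | f x == z]| * #|Z| = #|X|)%N.
Proof.
move=> fs z; have im z' : z' \in codom f by have [x <-] := fs z'; exact: codom_f.
rewrite -(card_additive (im z)); congr (_ * _)%N.
by apply: eq_card => z'; rewrite im.
Qed.

(** * Expected counts under the uniform law *)

Section haar_count.
Variables (R : realType) (p l : nat).
Hypothesis p_pr : prime p.
Local Notation q := (p ^ l.+1)%N.
Local Notation q1 := (prime_power_gt1 l p_pr).
Local Notation red := (red l p_pr).
Local Notation kercard := (kercard (l := l) p_pr).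

Lemma card_red_fiber (a : 'F_p) : (#|[pred x : 'Z_q | red x == a]| * p = q)%N.
Proof.
have surj z : exists x, red x = z by exists (lift l z); rewrite liftK.
by have := card_surj_fiber surj a; rewrite card_Fp// card_Zq// q1.
Qed.

Section uniform.
Variable n : nat.

Definition uniform_law (u : upper_index n) (x : 'Z_q) : R := q%:R^-1.

Let q0 : (q%:R : R) != 0. Proof. by rewrite pnatr_eq0 -lt0n ltnW ?q1. Qed.

Lemma uniform_is_law : is_law uniform_law.
Proof.
split=> u *; first by rewrite invr_ge0.
by rewrite sumr_constE card_ord Zp_cast ?q1// mulfV.
Qed.

Lemma uniform_balanced : balanced p_pr (2^-1 : R) uniform_law.
Proof.
move=> u a; rewrite sumr_constE.
have P2 : 2 <= p%:R :> R by rewrite ler_nat prime_gt1.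
have e : #|[pred x : 'Z_q | red x == a]|%:R * p%:R = q%:R :> R.
  by rewrite -natrM card_red_fiber.
have q0' : 0 < q%:R :> R by rewrite ltr0n ltnW ?q1.
rewrite /uniform_law ler_pdivrMr// -e.
have : 0 <= #|[pred x : 'Z_q | red x == a]|%:R :> R by [].
by set c := _%:R => c0; nra.
Qed.

Lemma symsum_symx (h : 'M['Z_q]_n -> R) :
  symsum h = \sum_(a : {ffun upper_index n -> 'Z_q}) h (symx a).
Proof.
rewrite /symsum (reindex_onto (@symx n _)
  (fun M : 'M['Z_q]_n => [ffun u => M (val u).1 (val u).2])) /=; last first.
  by move=> M /eqP; exact: symxK.
apply: eq_bigl => a; rewrite symx_sym eqxx /=; apply/eqP/ffunP => u.
by rewrite ffunE mxE uidxK.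
Qed.

Lemma expect_uniform (h : 'M['Z_q]_n -> R) : expect uniform_law h = mean h.
Proof.
have e h' : expect uniform_law h' = q%:R^-1 ^+ #|{: upper_index n}| * symsum h'.
  rewrite symsum_symx mulr_sumr; apply: eq_bigr => a _.
  by rewrite /uniform_law prodr_const.
have c0 : symcount R p l n != 0 by rewrite gt_eqF// symcount_gt0.
(* Testing on the constant 1 identifies the normalisation without counting the upper triangle. *)
have : expect uniform_law (fun=> 1) = 1.
  rewrite /expect; under eq_bigr do rewrite mulr1.
  rewrite -(bigA_distr_bigA (fun u x => uniform_law u x)) big1// => u _.
  by have [_ ->] := uniform_is_law.
rewrite !e -/(symcount R p l n) => e1.
have -> : q%:R^-1 ^+ #|{: upper_index n}| = (symcount R p l n)^-1.
  by apply: (mulIf c0); rewrite e1 mulVf.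
by rewrite mulrC.
Qed.

End uniform.

Section quad.
Variable r : nat.
Variables (c1 : 'I_r -> 'Z_q) (c2 T : 'I_r -> 'I_r -> 'Z_q).
Local Notation cond := (quad_cond c1 c2 T).
Hypothesis c1_red : forall s x, c1 s * x = 0 -> red x = 0.

Let Dg : 'M['Z_q]_r := diag_mx (\row_s c1 s).

Lemma quad_condE n (Y : 'M['Z_q]_(r, n)) M : cond Y M =
  (Dg *m (Y *m M) == 0) &&
  [forall st, c2 st.1 st.2 * ((Y *m M *m Y^T) st.1 st.2 - T st.1 st.2) == 0].
Proof.
rewrite /quad_cond; congr (_ && _); apply/forallP/eqP => [H|/matrixP H i].
  apply/matrixP => s i; rewrite mul_diag_mx !mxE.
  by have /forallP/(_ s)/eqP := H i; rewrite !mxE.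
by apply/forallP => s; have := H s i; rewrite mul_diag_mx !mxE => ->.
Qed.

Lemma quad_cond_congr n (Y : 'M['Z_q]_(r, n)) (U M : 'M['Z_q]_n) : U \in unitmx ->
  cond Y (U *m M *m U^T) = cond (Y *m U) M.
Proof.
move=> UU; rewrite !quad_condE trmx_mul !mulmxA; congr (_ && _).
have UTU : U^T \in unitmx by rewrite unitmx_tr.
apply/eqP/eqP => [H|->]; last by rewrite mul0mx.
by rewrite -[LHS](mulmxK UTU) H mul0mx.
Qed.

(** For Y = (1 0) the conditions separate into one on the r x r corner of M and one on the block
    beside it; these are the admissible corners. *)
Definition corner_count : nat := #|[pred A : 'M['Z_q]_r | (A^T == A) && cond 1%:M A]|.

Lemma quad_cond_block m A (B : 'M['Z_q]_(r, m)) C D :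
  cond (row_mx 1%:M 0) (block_mx A B C D) = cond 1%:M A && (Dg *m B == 0).
Proof.
rewrite !quad_condE mul_row_block !mul1mx !mul0mx !addr0 tr_row_mx mul_row_col.
rewrite trmx1 trmx0 !mulmx1 mulmx0 addr0 mul_mx_row -row_mx0 andbAC; congr (_ && _).
by apply/eqP/andP => [/eq_row_mx[-> ->]|[/eqP -> /eqP ->]].
Qed.

Lemma card_side m : #|[pred B : 'M['Z_q]_(r, m) | Dg *m B == 0]| =
  ((\prod_s #|annihilator c1 s|) ^ m)%N.
Proof.
pose F (f : {ffun 'I_m * 'I_r -> 'Z_q}) : 'M['Z_q]_(r, m) := \matrix_(s, i) f (i, s).
have FI : injective F.
  by move=> f g /matrixP fg; apply/ffunP => -[i s]; have := fg s i; rewrite !mxE.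
transitivity #|family (fun is_ : 'I_m * 'I_r => mem (annihilator c1 is_.2))|.
  rewrite -(card_imset _ FI); apply: eq_card => B; rewrite inE.
  apply/eqP/imsetP => [B0|[f /familyP f0 ->]]; last first.
    apply/matrixP => s i; have := f0 (i, s); rewrite inE /= => /eqP.
    by rewrite mul_diag_mx !mxE.
  exists [ffun is_ => B is_.2 is_.1].
    apply/familyP => -[i s]; rewrite ffunE inE /=; move/matrixP: B0 => /(_ s i).
    by rewrite mul_diag_mx !mxE => ->.
  by apply/matrixP => s i; rewrite mxE ffunE.
rewrite card_family foldrE big_image /= -(pair_bigA _ (fun i s => #|annihilator c1 s|)).
by rewrite /= prod_nat_const card_ord.
Qed.

(** In a basis where Y is (1 0), the conditions bear on A and B only and force both to vanish modulo
    p. Hence r additional kernel dimensions, a free block D, and a value that is the same for all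
    such Y. *)
Lemma symsum_full_rank m (Y : 'M['Z_q]_(r, r + m)) (g : nat -> R) :
  row_free (map_mx red Y) ->
  symsum (fun M => (cond Y M)%:R * g (kercard M)) =
  corner_count%:R * ((\prod_s #|annihilator c1 s|) ^ m)%:R *
    symsum (fun D : 'M['Z_q]_m => g (p ^ r * kercard D)%N).
Proof.
move=> /complete_rows[U UU YU]; rewrite (symsum_congr _ UU).
under eq_symsum => M _ do rewrite quad_cond_congr// YU kercard_congr//.
rewrite symsum_block.
transitivity (\sum_(A : 'M['Z_q]_r | A^T == A) (cond 1%:M A)%:R *
   \sum_(B : 'M['Z_q]_(r, m)) (Dg *m B == 0)%:R *
     symsum (fun D : 'M['Z_q]_m => g (p ^ r * kercard D)%N)).
  apply: eq_bigr => A _; rewrite mulr_sumr; apply: eq_bigr => B _.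
  rewrite mulrA -symsumZ; apply: eq_symsum => D _; rewrite quad_cond_block.
  case: (boolP (cond _ _)) => [|_]; last by rewrite !mul0r.
  rewrite quad_condE mul1mx => /andP[/eqP/matrixP A0 _].
  case: eqP => [/matrixP B0|_]; last by rewrite mulr0 !mul0r.
  rewrite /= mulr1 !mul1r kercard_diag0//.
  - apply/matrixP => s t; have := A0 s t; rewrite mul_diag_mx !mxE.
    exact: c1_red.
  - apply/matrixP => s t; have := B0 s t; rewrite mul_diag_mx !mxE.
    exact: c1_red.
rewrite -mulr_suml -[X in X * _]mulr1 -mulrA mul1r.
have sum_ind (I : finType) (Q Q' : pred I) :
    \sum_(i | Q i) (Q' i)%:R = #|[pred i | Q i && Q' i]|%:R :> R.
  rewrite -[RHS]mulr1 -sumr_constE [RHS]big_mkcondr; apply: eq_bigr => i _.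
  by case: (Q' i).
by rewrite -mulr_suml !sum_ind mulrA card_side.
Qed.

Definition full_count n : nat := #|[pred Y : 'M['Z_q]_(r, n) | row_free (map_mx red Y)]|.

Lemma full_count_le n : (full_count n <= q ^ (r * n))%N.
Proof. by rewrite -(card_mx_Zq l p_pr); exact: max_card. Qed.

(** Union bound: a Y of smaller rank is killed modulo p by one of fewer than p^r nonzero rows v, and
    each v kills a proportion p^-n of all Y. *)
Lemma full_count_ge n : (q ^ (r * n) * p ^ n <= full_count n * p ^ n + p ^ r * q ^ (r * n))%N.
Proof.
rewrite -(card_mx_Zq l p_pr) -(cardC [pred Y : 'M['Z_q]_(r, n) | row_free (map_mx red Y)]).
rewrite mulnDl leq_add2l.
set X := finset.finset (fun Y : 'M['Z_q]_(r, n) => ~~ row_free (map_mx red Y)).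
pose Z (v : 'rV['F_p]_r) := [set Y : 'M['Z_q]_(r, n) | v *m map_mx red Y == 0]%SET.
have XZ : X \subset \bigcup_(v : 'rV['F_p]_r | v != 0) Z v.
  apply/fintype.subsetP => Y; rewrite inE => nf; apply/bigcupP.
  apply/exists_inP; apply: contraR nf; rewrite negb_exists_in => /forall_inP H.
  apply: inj_row_free => v v0; apply/eqP; apply: contraT => nz.
  by have := H v nz; rewrite inE v0 eqxx.
have Zc v : v != 0 -> (#|Z v| * p ^ n = #|{: 'M['Z_q]_(r, n)}|)%N.
  move=> v0; pose f (Y : 'M['Z_q]_(r, n)) : 'rV['F_p]_n := v *m map_mx red Y.
  have fadd : zmod_morphism f by move=> Y Y'; rewrite /f map_mxB mulmxBr.
  pose fA : {additive _ -> _} := HB.pack f (GRing.isZmodMorphism.Build _ _ f fadd).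
  have cn : #|{: 'rV['F_p]_n}| = (p ^ n)%N by rewrite card_mx card_Fp// mul1n.
  suff surj z : exists Y, fA Y = z.
    have := card_surj_fiber surj 0; rewrite cn => <-.
    by congr (_ * _)%N; apply: eq_card => Y; rewrite !inE.
  have /row_freeP[w vw] : row_free v.
    by rewrite /row_free eqn_leq rank_leq_row lt0n mxrank_eq0.
  exists (map_mx (lift l) (w *m z)).
  by rewrite /= /f map_liftK mulmxA vw mul1mx.
have cXE : #|[predC [pred Y : 'M['Z_q]_(r, n) | row_free (map_mx red Y)]]| = #|X|.
  by apply: eq_card => Y; rewrite !inE.
have ZU : (#|\bigcup_(v : 'rV['F_p]_r | v != 0%R) Z v| <=
    \sum_(v : 'rV['F_p]_r | v != 0%R) #|Z v|)%N.
  elim/big_rec2: _ => [|v y1 y2 _ H]; first by rewrite cards0.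
  by apply: leq_trans (leq_card_setU _ _) _; rewrite leq_add2l.
rewrite cXE; apply: leq_trans (leq_mul (leq_trans (subset_leq_card XZ) ZU) (leqnn _)) _.
rewrite big_distrl /=.
have -> : (p ^ r = #|{: 'rV['F_p]_r}|)%N by rewrite card_mx card_Fp// mul1n.
rewrite -sum_nat_const [X in (_ <= X)%N](bigID (fun v => v != 0)) /=.
apply: leq_trans (leq_addr _ _); apply: leq_sum => v v0; rewrite Zc//.
by rewrite -(cardC [pred Y : 'M['Z_q]_(r, n) | row_free (map_mx red Y)]) cXE.
Qed.

Hypothesis cond_full : forall n (Y : 'M['Z_q]_(r, n)) M, M^T = M -> cond Y M ->
  row_free (map_mx red Y).

Lemma mean_quad_count m (g : nat -> R) :
  mean (fun M : 'M['Z_q]_(r + m) => weighted_count c1 c2 T (fun=> 1) M * g (kercard M)) =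
  (full_count (r + m))%:R * corner_count%:R *
    ((\prod_s #|annihilator c1 s|) ^ m)%:R / symcount R p l r / (q ^ (r * m))%:R *
    mean_ker l p_pr m (fun k => g (p ^ r * k)%N).
Proof.
have s1 : symcount R p l r != 0 by rewrite gt_eqF// symcount_gt0.
have s2 : symcount R p l m != 0 by rewrite gt_eqF// symcount_gt0.
have s3 : (q ^ (r * m))%:R != 0 :> R.
  by rewrite pnatr_eq0 -lt0n expn_gt0 (ltnW q1).
rewrite /mean_ker /mean symcount_block//.
have -> : symsum (fun M : 'M['Z_q]_(r + m) =>
      weighted_count c1 c2 T (fun=> 1) M * g (kercard M)) =
    (full_count (r + m))%:R * (corner_count%:R * ((\prod_s #|annihilator c1 s|) ^ m)%:R *
    symsum (fun D : 'M['Z_q]_m => g (p ^ r * kercard D)%N)).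
  transitivity (\sum_Y symsum (fun M : 'M['Z_q]_(r + m) =>
      (cond Y M)%:R * g (kercard M))).
    rewrite /symsum exchange_big; apply: eq_bigr => M _; rewrite /weighted_count.
    by rewrite mulr_suml; apply: eq_bigr => Y _; rewrite mul1r.
  rewrite (bigID (fun Y : 'M['Z_q]_(r, r + m) => row_free (map_mx red Y))) /=.
  rewrite [X in _ + X]big1 ?addr0; last first.
    move=> Y nf; rewrite /symsum big1// => M /eqP Ms.
    case: (boolP (cond Y M)) => [/(cond_full Ms)|_]; last by rewrite mul0r.
    by rewrite (negbTE nf).
  under eq_bigr => Y Yf do rewrite symsum_full_rank//.
  by rewrite sumr_constE.
by field; rewrite s1 s2 s3.
Qed.

(** What remains of the mean count after division by A^n and by the proportion of Y of full rank;
    for the weights attached to G it turns out to be 1/|G|. *)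
Definition quad_const : R :=
  (q ^ (r * r))%:R * corner_count%:R /
  (symcount R p l r * ((\prod_s #|annihilator c1 s|) ^ r)%:R).

Lemma mean_quad_countE n (g : nat -> R) : (r <= n)%N ->
  mean (fun M : 'M['Z_q]_n => weighted_count c1 c2 T (fun=> 1) M * g (kercard M)) /
    (\prod_s #|annihilator c1 s|)%:R ^+ n =
  (full_count n)%:R / (q ^ (r * n))%:R * quad_const *
    mean_ker l p_pr (n - r) (fun k => g (p ^ r * k)%N).
Proof.
move=> rn; rewrite -(subnKC rn); move: (n - r)%N => m.
rewrite mean_quad_count (addnC r m) addnK addnC /quad_const.
set A := (\prod_s _)%N; have A0 : A%:R != 0 :> R.
  rewrite pnatr_eq0 -lt0n prodn_gt0// => s; apply/card_gt0P; exists 0.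
  by rewrite inE mulr0.
have s1 : symcount R p l r != 0 by rewrite gt_eqF// symcount_gt0.
have q0 : p%:R != 0 :> R by rewrite pnatr_eq0 -lt0n prime_gt0.
rewrite mulnDr !natrX !exprD.
by field; do ?[apply/andP; split]; rewrite ?s1 ?expf_neq0.
Qed.

End quad.

Section extra_rows.
Variables (r k : nat).
Variables (c1 : 'I_r -> 'Z_q) (c2 T : 'I_r -> 'I_r -> 'Z_q).

(** An additional row F receives the weight p^l, which asks for F M = 0 modulo p, and no quadratic
    condition. *)
Definition ext1 (s : 'I_(r + k)) : 'Z_q :=
  match fintype.split s with inl a => c1 a | inr _ => (p ^ l)%:R end.

Definition ext2 (f : 'I_r -> 'I_r -> 'Z_q) (s t : 'I_(r + k)) : 'Z_q :=
  match fintype.split s, fintype.split t with inl a, inl b => f a b | _, _ => 0 end.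

Lemma card_ext_ann : (\prod_s #|annihilator ext1 s| =
  (\prod_s #|annihilator c1 s|) * (p ^ l) ^ k)%N.
Proof.
rewrite big_split_ord; congr (_ * _)%N.
  apply: eq_bigr => s _; apply: eq_card => x; rewrite !inE /ext1.
  by rewrite (unsplitK (inl s)).
rewrite -[X in (_ = _ ^ X)%N]card_ord -prod_nat_const; apply: eq_bigr => s _.
rewrite -(card_Zq_ann p_pr (leqnSn l)); apply: eq_card => x; rewrite !inE /ext1.
by rewrite (unsplitK (inr s)).
Qed.

Lemma quad_cond_ext n (Y : 'M['Z_q]_(r, n)) (F : 'M['Z_q]_(k, n)) M :
  quad_cond ext1 (ext2 c2) (ext2 T) (col_mx Y F) M =
  quad_cond c1 c2 T Y M && (map_mx red F *m map_mx red M == 0).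
Proof.
rewrite /quad_cond mul_col_mx tr_col_mx mul_col_row.
have -> : (map_mx red F *m map_mx red M == 0) =
    [forall i, forall j, (p ^ l)%:R * (F *m M) j i == 0].
  rewrite -map_mxM; apply/eqP/forallP => [/matrixP H i|H].
    apply/forallP => j; have : red ((F *m M) j i) = 0.
      by have := H j i; rewrite mxE [RHS]mxE.
    by move/eqP; rewrite red_eq0.
  apply/matrixP => j i; have /forallP/(_ j) := H i.
  by rewrite -red_eq0 => /eqP; rewrite !mxE.
rewrite [RHS]andbAC; congr (_ && _).
  apply/forallP/andP => [H|[/forallP H1 /forallP H2] i].
    split; apply/forallP => i; apply/forallP => s; have /forallP := H i.
      by move=> /(_ (lshift k s)); rewrite /ext1 (unsplitK (inl s)) col_mxEu.
    by move=> /(_ (rshift r s)); rewrite /ext1 (unsplitK (inr s)) col_mxEd.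
  apply/forallP => s; rewrite -[s]splitK /ext1 unsplitK.
  case: (fintype.split s) => a /=; rewrite ?col_mxEu ?col_mxEd.
    by have /forallP := H1 i.
  by have /forallP := H2 i.
apply/forallP/forallP => H [s t] /=.
  have := H (lshift k s, lshift k t); rewrite /= /ext2 !(unsplitK (inl _)).
  by rewrite block_mxEul.
rewrite -[s]splitK -[t]splitK /ext2 !unsplitK.
case: (fintype.split s) => a; case: (fintype.split t) => b /=; rewrite ?mul0r//.
by rewrite block_mxEul; exact: (H (a, b)).
Qed.

Lemma card_red_row_fiber n (z : 'rV['F_p]_n) :
  #|[pred v : 'rV['Z_q]_n | map_mx red v == z]| = (p ^ (l * n))%N.
Proof.
have fadd : zmod_morphism (fun v : 'rV['Z_q]_n => map_mx red v).
  by move=> u v; rewrite map_mxB.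
pose fA : {additive 'rV['Z_q]_n -> 'rV['F_p]_n} :=
  HB.pack (fun v : 'rV['Z_q]_n => map_mx red v) (GRing.isZmodMorphism.Build _ _ _ fadd).
have surj z' : exists v, fA v = z' by exists (map_mx (lift l) z'); rewrite /= map_liftK.
have := card_surj_fiber surj z.
have -> : #|{: 'rV['F_p]_n}| = (p ^ n)%N by rewrite card_mx card_Fp// mul1n.
have -> : #|{: 'rV['Z_q]_n}| = (p ^ (l * n) * p ^ n)%N.
  by rewrite (card_mx_Zq l p_pr) mul1n -expnM -expnD mulSn addnC.
by move/eqP; rewrite eqn_pmul2r ?expn_gt0 ?prime_gt0// => /eqP.
Qed.

Lemma card_lifted_ker n (M : 'M['Z_q]_n) :
  #|[pred F : 'M['Z_q]_(k, n) | map_mx red F *m map_mx red M == 0]| =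
  ((p ^ (l * n) * kercard M) ^ k)%N.
Proof.
pose K := [set v : 'rV['Z_q]_n | map_mx red v *m map_mx red M == 0]%SET.
have cK : #|K| = (p ^ (l * n) * kercard M)%N.
  rewrite -sum1_card (partition_big (fun v : 'rV['Z_q]_n => map_mx red v)
     (mem [set z : 'rV['F_p]_n | z *m map_mx red M == 0]%SET)) /=; last first.
    by move=> v; rewrite !inE.
  rewrite mulnC -sum_nat_const; apply: eq_bigr => z; rewrite inE => z0.
  rewrite sum1_card -(card_red_row_fiber z); apply: eq_card => v.
  by rewrite unfold_in !inE andb_idl// => /eqP ->.
pose G (f : {ffun 'I_k -> 'rV['Z_q]_n}) : 'M['Z_q]_(k, n) := \matrix_(j, i) f j 0 i.
have GI : injective G.
  move=> f g /matrixP fg; apply/ffunP => j; apply/rowP => i.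
  by have := fg j i; rewrite !mxE.
have Grow f j : row j (map_mx red (G f)) = map_mx red (f j).
  by apply/rowP => i; rewrite !mxE.
have -> : ((p ^ (l * n) * kercard M) ^ k)%N = 
    #|(ffun_on (mem K) : {pred {ffun 'I_k -> 'rV['Z_q]_n}})|.
  by rewrite card_ffun_on card_ord -cK.
rewrite -(card_imset _ GI).
apply: eq_card => F; rewrite inE; apply/eqP/imsetP => [F0|[f /ffun_onP fK ->]].
  exists [ffun j => row j F]; last by apply/matrixP => j i; rewrite !mxE ffunE mxE.
  by apply/ffun_onP => j; rewrite ffunE inE map_row -row_mul F0 row0.
by apply/row_matrixP => j; rewrite row_mul Grow row0; have := fK j; rewrite inE => /eqP.
Qed.

(** The factor p^(l n) is the number of lifts to Z/q of a row over F_p. *)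
Lemma weighted_count_ext n (M : 'M['Z_q]_n) :
  weighted_count ext1 (ext2 c2) (ext2 T) (fun=> (1 : R)) M =
  weighted_count c1 c2 T (fun=> 1) M * ((p ^ (l * n) * kercard M) ^ k)%:R.
Proof.
pose f (t : 'M['Z_q]_(r, n) * 'M['Z_q]_(k, n)) := col_mx t.1 t.2.
have fb : bijective f.
  exists (fun Y => (usubmx Y, dsubmx Y)) => [[a b]|Y] /=; last exact: vsubmxK.
  by rewrite /f col_mxKu col_mxKd.
rewrite /weighted_count (reindex _ (onW_bij _ fb)) /=.
rewrite -(pair_bigA _ (fun Y F => 1 * (quad_cond ext1 (ext2 c2) (ext2 T) (col_mx Y F) M)%:R)).
rewrite mulr_suml; apply: eq_bigr => Y _ /=; rewrite mul1r -card_lifted_ker.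
rewrite -[X in _ = _ * X]mulr1 -sumr_constE [X in _ = _ * X]big_mkcond mulr_sumr; apply: eq_bigr => F _.
by rewrite mul1r quad_cond_ext; case: quad_cond; case: eqP; rewrite /= ?mulr1 ?mulr0.
Qed.

End extra_rows.
End haar_count.

(** * Limits of expected counts *)

Section limit.
Variables (R : realType) (p l : nat).
Hypothesis p_pr : prime p.
Local Notation q := (p ^ l.+1)%N.
Local Notation q1 := (prime_power_gt1 l p_pr).
Local Notation red := (red l p_pr).
Local Notation kercard := (kercard (l := l) p_pr).
Variable r : nat.
Variables (c1 : 'I_r -> 'Z_q) (c2 T : 'I_r -> 'I_r -> 'Z_q).
Local Notation cond := (quad_cond c1 c2 T).
Local Notation N := (weighted_count c1 c2 T (fun=> (1 : R))).
Local Notation A := (\prod_s #|annihilator c1 s|)%N.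
Hypothesis c1_red : forall s x, c1 s * x = 0 -> red x = 0.
Hypothesis cond_full : forall n (Y : 'M['Z_q]_(r, n)) M, M^T = M -> cond Y M ->
  row_free (map_mx red Y).

Let P : R := p%:R.
Let P0 : 0 < P. Proof. by rewrite ltr0n prime_gt0. Qed.
Let P1 : 1 < P. Proof. by rewrite ltr1n prime_gt1. Qed.
Let Pn0 : P != 0. Proof. by rewrite gt_eqF. Qed.

Let A0 : 0 < A%:R :> R.
Proof.
rewrite ltr0n prodn_gt0// => s; apply/card_gt0P; exists 0.
by rewrite inE mulr0.
Qed.

Lemma N_ge0 n (M : 'M['Z_q]_n) : 0 <= N M.
Proof. by apply: sumr_ge0 => Y _; rewrite mul1r. Qed.

Section fixed_law.
Variables (n : nat) (w : upper_index n -> 'Z_q -> R).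
Hypothesis wl : is_law w.

Lemma expectZ (c : R) (h : 'M['Z_q]_n -> R) : expect w (fun M => c * h M) = c * expect w h.
Proof. by rewrite /expect mulr_sumr; apply: eq_bigr => a _; rewrite mulrCA. Qed.

Lemma expectB (h h' : 'M['Z_q]_n -> R) : expect w (fun M => h M - h' M) = expect w h - expect w h'.
Proof.
by rewrite /expect -sumrB; apply: eq_bigr => a _; rewrite mulrBr.
Qed.

Lemma eq_expect (h h' : 'M['Z_q]_n -> R) : (forall M, M^T = M -> h M = h' M) -> expect w h = expect w h'.
Proof. by move=> hh; apply: eq_bigr => a _; rewrite hh// symx_sym. Qed.

Lemma le_expect (h h' : 'M['Z_q]_n -> R) : (forall M, M^T = M -> h M <= h' M) ->
  expect w h <= expect w h'.
Proof.
move=> hh; apply: ler_sum => a _; apply: ler_wpM2l; last by rewrite hh// symx_sym.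
by apply: prodr_ge0 => u _; case: wl.
Qed.

Lemma expect_sum (I : finType) (h : I -> 'M['Z_q]_n -> R) :
  expect w (fun M => \sum_i h i M) = \sum_i expect w (h i).
Proof.
rewrite /expect exchange_big; apply: eq_bigr => a _; by rewrite mulr_sumr.
Qed.

End fixed_law.

(** Universality for r + k rows. The annihilators of the additional weights have p^l elements each,
    which cancels the number p^(l n k) of lifts. *)
Lemma moment_universality k (rho eps : R) : 0 < rho < 1 -> 0 < eps ->
  \forall n \near \oo, forall (w w' : upper_index n -> 'Z_q -> R),
    is_law w -> is_law w' -> fourier_le q1 rho w -> fourier_le q1 rho w' ->
    `|expect w (fun M => N M * (kercard M)%:R ^+ k) -
      expect w' (fun M => N M * (kercard M)%:R ^+ k)| <= eps * A%:R ^+ n.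
Proof.
move=> rho01 e0.
have := universality q1 (@ext1 p l r k c1) (@ext2 p l r k c2) (@ext2 p l r k T) rho01 e0.
apply: filterS => n H w w' wl wl' wr wr'.
have := H w w' (fun=> 1) wl wl' wr wr'; rewrite normr1 => /(_ (fun=> lexx 1)).
pose c : R := (p ^ (l * n))%:R ^+ k.
have c0 : 0 < c by rewrite exprn_gt0// ltr0n expn_gt0 prime_gt0.
have ext (v : upper_index n -> 'Z_q -> R) : expect v (weighted_count (@ext1 p l r k c1) (@ext2 p l r k c2) (@ext2 p l r k T) (fun=> 1)) =
    c * expect v (fun M => N M * (kercard M)%:R ^+ k).
  rewrite -expectZ; apply: eq_expect => M _.
  by rewrite weighted_count_ext natrX natrM exprMn mulrCA.
rewrite !ext -mulrBr normrM gtr0_norm// card_ext_ann// natrM exprMn.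
have -> : ((p ^ l) ^ k)%:R ^+ n = c.
  by rewrite /c !natrX -!exprM; congr (_ ^+ _); lia.
by rewrite mulrA [_ * c]mulrC ler_pM2l.
Qed.

Lemma poly_universality (f : {poly R}) (rho eps : R) : 0 < rho < 1 -> 0 < eps ->
  \forall n \near \oo, forall (w w' : upper_index n -> 'Z_q -> R),
    is_law w -> is_law w' -> fourier_le q1 rho w -> fourier_le q1 rho w' ->
    `|expect w (fun M => N M * f.[(kercard M)%:R]) -
      expect w' (fun M => N M * f.[(kercard M)%:R])| <= eps * A%:R ^+ n.
Proof.
move=> rho01 e0.
pose d (i : nat) : R := eps / (size f).+1%:R / (1 + `|f`_i|).
have f1 i : 0 < 1 + `|f`_i| by rewrite ltr_wpDr.
have d0 i : 0 < d i by rewrite /d divr_gt0 ?divr_gt0.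
have : \forall n \near \oo, forall i : 'I_(size f),
  forall (w w' : upper_index n -> 'Z_q -> R),
    is_law w -> is_law w' -> fourier_le q1 rho w -> fourier_le q1 rho w' ->
    `|expect w (fun M => N M * (kercard M)%:R ^+ i) -
      expect w' (fun M => N M * (kercard M)%:R ^+ i)| <= d i * A%:R ^+ n.
  by apply: filter_forall => i; exact: moment_universality.
apply: filterS => n H w w' wl wl' wr wr'.
have E v : expect v (fun M => N M * f.[(kercard M)%:R]) =
    \sum_(i < size f) f`_i * expect v (fun M => N M * (kercard M)%:R ^+ i).
  under [RHS]eq_bigr do rewrite -expectZ.
  rewrite -expect_sum; apply: eq_expect => M _; rewrite horner_coef mulr_sumr.
  by apply: eq_bigr => i _; rewrite mulrCA.
rewrite !E -sumrB; apply: le_trans (ler_norm_sum _ _ _) _.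
apply: le_trans (_ : \sum_(i < size f) eps / (size f).+1%:R * A%:R ^+ n <= _).
  apply: ler_sum => i _; rewrite -mulrBr normrM.
  apply: le_trans (ler_wpM2l (normr_ge0 _) (H i w w' wl wl' wr wr')) _.
  rewrite mulrA ler_wpM2r ?exprn_ge0 ?(ltW A0)// /d mulrCA.
  rewrite ler_piMr ?divr_ge0 ?(ltW e0)// ler_pdivrMr// mul1r.
  by rewrite lerDr.
rewrite sumr_constE mulrA ler_wpM2r ?exprn_ge0 ?(ltW A0)// mulrCA.
rewrite ler_piMr ?(ltW e0)// ler_pdivrMr// mul1r ler_nat.
by rewrite (_ : #|_| = size f) ?leqnSn// -[RHS]card_ord; apply: eq_card => i.
Qed.

(* [trunc_poly J] takes the value [1] at [p ^ r], vanishes at [p ^ (r + s)] for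
   [1 <= s <= J], and is dominated by a high power beyond. *)
Definition trunc_poly J : {poly R} :=
  \prod_(1 <= i < J.+1) ((P ^+ i)%:P - P ^- r *: 'X) *
    ((\prod_(1 <= i < J.+1) (P ^+ i - 1))^-1)%:P.

Definition trunc_const J : R := (P ^+ J.+1 * \prod_(1 <= i < J.+1) (P ^+ i - 1))^-1.

Let den_gt0 J : 0 < \prod_(1 <= i < J.+1) (P ^+ i - 1).
Proof.
rewrite big_nat; apply: prodr_gt0 => i /andP[i0 _].
by rewrite subr_gt0 exprn_egt1// -lt0n.
Qed.

Lemma trunc_polyE J s : (trunc_poly J).[P ^+ (r + s)] =
  \prod_(1 <= i < J.+1) (P ^+ i - P ^+ s) / \prod_(1 <= i < J.+1) (P ^+ i - 1).
Proof.
rewrite /trunc_poly hornerM hornerC horner_prod; congr (_ / _).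
apply: eq_bigr => i _; rewrite !hornerE exprD mulKf//.
by rewrite expf_neq0.
Qed.

(** For s > J each of the J factors is at most p^s, and p^(s J) <= p^(s (J+1)) / p^(J+1). The gain
    p^-(J+1), paid for by one more moment, is what makes the error tend to 0. *)
Lemma trunc_poly_approx J s :
  `|(s == 0%N)%:R - (trunc_poly J).[P ^+ (r + s)]| <= trunc_const J * (P ^+ s) ^+ J.+1.
Proof.
rewrite trunc_polyE; have d0 := den_gt0 J; set D := \prod_(_ <= _ < _) (_ - 1) in d0 *.
have rhs0 : 0 <= trunc_const J * (P ^+ s) ^+ J.+1.
  by rewrite mulr_ge0 ?invr_ge0 ?mulr_ge0 ?exprn_ge0 ?(ltW P0) ?(ltW d0).
have [->|s0] := posnP s.
  rewrite expr0 -/D mulfV ?gt_eqF// subrr normr0 expr1n mulr1 invr_ge0.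
  by rewrite mulr_ge0 ?exprn_ge0 ?(ltW P0) ?(ltW d0).
rewrite sub0r normrN.
have [sJ|Js] := leqP s J.
  have -> : \prod_(1 <= i < J.+1) (P ^+ i - P ^+ s) = 0.
    rewrite (big_cat_nat _ (n := s))//=; last by rewrite ltnW.
    by rewrite [X in _ * X]big_ltn ?ltnS// subrr mul0r mulr0.
  by rewrite mul0r normr0.
rewrite normrM normfV (gtr0_norm d0) /trunc_const invfM -/D mulrAC ler_wpM2r ?invr_ge0 ?(ltW d0)//.
apply: le_trans (_ : (P ^+ s) ^+ J <= _).
  rewrite normr_prod.
  have -> : (P ^+ s) ^+ J = \prod_(1 <= i < J.+1) P ^+ s.
    by rewrite prodr_const_nat subn1.
  rewrite !big_nat; apply: ler_prod => i /andP[_ iJ]; rewrite normr_ge0 /=.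
  rewrite distrC ger0_norm ?subr_ge0; last by rewrite ler_weXn2l ?(ltW P1)//; lia.
  by rewrite lerBlDr lerDl exprn_ge0// ltW.
rewrite mulrC ler_pdivlMr ?exprn_gt0// -!exprM -exprD ler_weXn2l ?(ltW P1)//.
by rewrite mulnS addnC leq_add2r.
Qed.

Lemma kercard_ppower n (M : 'M['Z_q]_n) : exists j, kercard M = (p ^ j)%N.
Proof. by eexists; exact: kercardE. Qed.

(** The rows of Y are r independent kernel vectors modulo p; so the truncation polynomial has to be
    controlled at the powers p^(r+s) only. *)
Lemma cond_kercard n (Y : 'M['Z_q]_(r, n)) M : M^T = M -> cond Y M ->
  exists s, kercard M = (p ^ (r + s))%N.
Proof.
move=> Ms cY; have Yf := cond_full Ms cY; have [j kj] := kercard_ppower M.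
have YM : map_mx red Y *m map_mx red M = 0.
  move: cY; rewrite -map_mxM /quad_cond => /andP[/forallP H _].
  apply/matrixP => s i; have /forallP/(_ s)/eqP/c1_red := H i.
  by move=> e; rewrite mxE e mxE.
have : (p ^ r <= kercard M)%N.
  have -> : (p ^ r)%N = #|{: 'rV['F_p]_r}| by rewrite card_mx card_Fp// mul1n.
  have inj : injective (fun v : 'rV['F_p]_r => v *m map_mx red Y).
    by move=> u v /(row_free_inj Yf).
  rewrite -(card_imset _ inj); apply: subset_leq_card; apply/fintype.subsetP.
  by move=> _ /imsetP[v _ ->]; rewrite inE -mulmxA YM mulmx0.
rewrite kj leq_exp2l ?prime_gt1// => rj.
by exists (j - r)%N; rewrite subnKC.
Qed.

Lemma expect_trunc J n (w : upper_index n -> 'Z_q -> R) : is_law w ->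
  `|expect w (fun M => N M * (kercard M == p ^ r)%N%:R) -
    expect w (fun M => N M * (trunc_poly J).[(kercard M)%:R])| <=
  trunc_const J / P ^+ (r * J.+1) *
    expect w (fun M => N M * (kercard M)%:R ^+ J.+1).
Proof.
move=> wl; rewrite -expectB -expectZ.
have key (M : 'M['Z_q]_n) : M^T = M -> `|N M * (kercard M == p ^ r)%N%:R -
    N M * (trunc_poly J).[(kercard M)%:R]| <=
    trunc_const J / P ^+ (r * J.+1) * (N M * (kercard M)%:R ^+ J.+1).
  move=> Ms; have [/existsP[Y cY]|/existsPn nY] := boolP [exists Y, cond Y M]; last first.
    have -> : N M = 0.
      by apply: big1 => Y _; rewrite (negbTE (nY Y)) mulr0.
    by rewrite !mul0r mulr0 subrr normr0.
  have [s ks] := cond_kercard Ms cY.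
  have -> : (kercard M == p ^ r)%N = (s == 0)%N.
    by rewrite ks eqn_exp2l ?prime_gt1// -{2}(addn0 r) eqn_add2l.
  rewrite ks natrX -/P -mulrBr normrM (ger0_norm (N_ge0 M)) mulrCA.
  apply: ler_wpM2l; first exact: N_ge0.
  apply: le_trans (trunc_poly_approx J s) _.
  have -> : (P ^+ (r + s)) ^+ J.+1 = P ^+ (r * J.+1) * (P ^+ s) ^+ J.+1.
    by rewrite exprD exprMn exprM.
  by rewrite -mulrA mulKf ?expf_neq0.
rewrite ler_norml; apply/andP; split.
  rewrite lerNl -mulN1r -expectZ; apply: le_expect => // M Ms.
  have := key M Ms; rewrite ler_norml => /andP[+ _].
  by rewrite mulN1r lerNl.
apply: le_expect => // M Ms.
by have := key M Ms; rewrite ler_norml => /andP[].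
Qed.

Let K0 : R := quad_const R c1 c2 T.

Let K0_ge0 : 0 <= K0.
Proof.
rewrite /K0 /quad_const divr_ge0 ?mulr_ge0//.
by rewrite ltW// symcount_gt0.
Qed.

Lemma uniform_moment_le J n : (r <= n)%N ->
  expect (@uniform_law R p l n) (fun M => N M * (kercard M)%:R ^+ J.+1) <=
  P ^+ (r * J.+1) * (K0 * (6 * \prod_(1 <= i < J.+1) (1 + P ^+ i))) * A%:R ^+ n.
Proof.
move=> rn; have An : 0 < A%:R ^+ n :> R by rewrite exprn_gt0.
rewrite expect_uniform// -[leLHS](divfK (lt0r_neq0 An)).
apply: ler_wpM2r; first exact: ltW.
rewrite (mean_quad_countE c1_red cond_full (fun k => k%:R ^+ J.+1) rn).
rewrite (_ : mean_ker _ _ _ _ = P ^+ (r * J.+1) *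
   mean_ker l p_pr (n - r) (fun k => k%:R ^+ J.+1)); last first.
  rewrite -mean_kerZ; apply: eq_mean_ker => k _.
  by rewrite natrM natrX exprMn exprM.
rewrite mulrCA -/K0; apply: ler_wpM2l; first by rewrite exprn_ge0// ltW.
apply: ler_pM.
- by rewrite mulr_ge0// divr_ge0.
- by apply: mean_ker_ge0 => k; rewrite exprn_ge0.
- rewrite ler_piMl// ler_pdivrMr ?mul1r ?ler_nat ?full_count_le//.
  by rewrite ltr0n expn_gt0 (ltnW q1).
- exact: mean_ker_moment_bound.
Qed.

Let tail J : R := trunc_const J * (K0 * (6 * \prod_(1 <= i < J.+1) (1 + P ^+ i))).

(** Up to a constant, [tail J] is p^-(J+1) times the product of the ratios (1 + p^i) / (p^i - 1). As
    p >= 2, the ratio is at most 3 for i = 1 and at most 5/3 for i >= 2, so the tail is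
    O((5/6)^J). *)
Lemma tail_small (eps : R) : 0 < eps -> exists J, tail J <= eps.
Proof.
move=> e0.
have bound J : tail J <= K0 * 18 * (5 / 6) ^+ J.
  have ratio : \prod_(1 <= i < J.+1) ((1 + P ^+ i) / (P ^+ i - 1)) <= 3 * (5 / 3) ^+ J.
    have P2 : 2 <= P by rewrite ler_nat prime_gt1.
    elim: J => [|J IH]; first by rewrite big_geq// expr0; lra.
    rewrite big_nat_recr//= [(5 / 3) ^+ J.+1]exprSr [leRHS]mulrA.
    have Pge : 2 ^+ J.+1 <= P ^+ J.+1.
      by apply: lerXn2r; rewrite ?nnegrE ?(ltW P0).
    have pos : 0 < P ^+ J.+1 - 1.
      by rewrite subr_gt0 exprn_egt1.
    case: J IH Pge pos => [|J] IH Pge pos.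
      rewrite !expr1 in Pge pos; rewrite big_geq// !expr0 !expr1 mul1r mulr1.
      by rewrite ler_pdivrMr//; lra.
    apply: ler_pM => //.
    - rewrite big_nat; apply: prodr_ge0 => i /andP[i0 _]; rewrite divr_ge0//.
        by rewrite addr_ge0// exprn_ge0// ltW.
      by rewrite subr_ge0 exprn_ege1// ltW.
    - by rewrite divr_ge0 ?(ltW pos)// addr_ge0// exprn_ge0// ltW.
    rewrite ler_pdivrMr//.
    have : 4 <= P ^+ J.+2.
      apply: le_trans Pge; rewrite !exprS mulrA.
      have : 1 <= (2 : R) ^+ J by rewrite exprn_ege1//; lra.
      lra.
    lra.
  have -> : tail J = K0 * 6 * P ^- J.+1 *
     \prod_(1 <= i < J.+1) ((1 + P ^+ i) / (P ^+ i - 1)).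
    rewrite /tail /trunc_const invfM big_split /= prodfV; ring.
  apply: le_trans (_ : K0 * 6 * 2^-1 ^+ J.+1 * (3 * (5 / 3) ^+ J) <= _).
    apply: ler_pM => //.
    - apply: divr_ge0; last exact: exprn_ge0 (ltW P0).
      by apply: mulr_ge0.
    - rewrite big_nat; apply: prodr_ge0 => i /andP[i0 _]; rewrite divr_ge0//.
        by rewrite addr_ge0// exprn_ge0// ltW.
      by rewrite subr_ge0 exprn_ege1// ltW.
    apply: ler_wpM2l; first by apply: mulr_ge0.
    rewrite -exprVn; apply: lerXn2r.
    + by rewrite nnegrE invr_ge0 ltW.
    + by rewrite nnegrE invr_ge0.
    + by rewrite lef_pV2 ?posrE// ler_nat prime_gt1.
  have -> : (5 / 6 : R) = 2^-1 * (5 / 3) by field.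
  rewrite [(2^-1 * (5 / 3)) ^+ J]exprMn [2^-1 ^+ J.+1]exprS.
  have : 0 <= K0 * (2^-1 ^+ J * (5 / 3) ^+ J).
    by apply: mulr_ge0 => //; apply: mulr_ge0; apply: exprn_ge0; lra.
  set x := 2^-1 ^+ J; set y := (5 / 3) ^+ J => xy0.
  have -> : K0 * 6 * (2^-1 * x) * (3 * y) = 9 * (K0 * (x * y)) by field.
  have -> : K0 * 18 * (x * y) = 18 * (K0 * (x * y)) by ring.
  lra.
have e1 : 0 < eps / (K0 * 18 + 1) by rewrite divr_gt0// ltr_wpDl// mulr_ge0.
have [J _ HJ] : \forall J \near \oo, (5 / 6 : R) ^+ J <= eps / (K0 * 18 + 1).
  by apply: near_expr_le => //; lra.
exists J; apply: le_trans (bound J) _.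
have K18 : 0 <= K0 * 18 by rewrite mulr_ge0.
have := HJ J (leqnn J); rewrite ler_pdivlMr; last lra.
have : 0 <= (5 / 6 : R) ^+ J by rewrite exprn_ge0// divr_ge0.
set x := _ ^+ J; move=> x0; rewrite mulrDr mulr1 [x * _]mulrC; lra.
Qed.

Lemma full_count_cvg :
  (fun n => (full_count l p_pr r n)%:R / (q ^ (r * n))%:R : R) @ \oo --> (1 : R).
Proof.
apply/cvgrPdist_le => e e0.
have e1 : 0 < e / P ^+ r by rewrite divr_gt0// exprn_gt0.
have PV : 0 <= P^-1 < 1 by rewrite invr_ge0 (ltW P0) invf_lt1.
near=> n.
have small : P^-1 ^+ n <= e / P ^+ r by near: n; exact: near_expr_le.
have q0 : 0 < (q ^ (r * n))%:R :> R by rewrite ltr0n expn_gt0 (ltnW q1).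
have Pn : 0 < P ^+ n by rewrite exprn_gt0.
rewrite ger0_norm; last first.
  by rewrite subr_ge0 ler_pdivrMr// mul1r ler_nat full_count_le.
have := full_count_ge l p_pr r n; rewrite -(ler_nat R) natrD !natrM [(p ^ n)%:R]natrX [(p ^ r)%:R]natrX -/P.
set x := (full_count _ _ _ _)%:R; set y := (q ^ (r * n))%:R in q0 *; move=> H.
rewrite lerBlDr -lerBlDl ler_pdivlMr// mulrBl mul1r lerBlDr.
have : P ^+ r <= e * P ^+ n.
  by move: small; rewrite exprVn -[_^-1]mul1r ler_pdivrMr// mulrAC ler_pdivlMr ?exprn_gt0// mul1r.
move=> H2; rewrite -(ler_pM2r Pn); apply: le_trans H _.
rewrite mulrDl lerD2l mulrAC ler_wpM2r ?(ltW q0)//.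
Unshelve. all: by end_near. Qed.

(** For kernels of size p^r exactly, the remaining block of size n - r has to be nonsingular modulo
    p, and the probability of this tends to the infinite product. *)
Lemma uniform_limit :
  (fun n => expect (@uniform_law R p l n)
     (fun M => N M * (kercard M == p ^ r)%N%:R) / A%:R ^+ n) @ \oo -->
  K0 * odd_power_product R p.
Proof.
pose Q m : R := \prod_(1 <= k < m.+1) (1 - p%:R ^ (1 - 2 * k%:Z)).
have Qc : Q @ \oo --> odd_power_product R p.
  by apply: is_cvg_odd_power_product; rewrite prime_gt0.
have Qc' : (fun n => Q (uphalf (n - r))) @ \oo --> odd_power_product R p.
  apply: (@cvg_comp _ _ _ (fun n => uphalf (n - r)) Q \oo \oo) => //.
  move=> B [k _ Bk]; exists (r + k.*2)%N => // n /= kn; apply: Bk => /=.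
  by rewrite uphalf_half; lia.
have : (fun n => (full_count l p_pr r n)%:R / (q ^ (r * n))%:R * K0 *
    Q (uphalf (n - r))) @ \oo --> 1 * K0 * odd_power_product R p.
  by apply: cvgM => //; apply: cvgM; [exact: full_count_cvg|exact: cvg_cst].
rewrite mul1r; apply: cvg_trans; apply: near_eq_cvg; exists r => // n /= rn.
rewrite expect_uniform//.
rewrite (mean_quad_countE c1_red cond_full (fun k => (k == p ^ r)%N%:R) rn).
congr (_ * _); rewrite /Q -(mean_ker_nonsingular R l p_pr); apply: eq_mean_ker => k _.
by rewrite -[X in _ = (_ == X)%:R]muln1 eqn_pmul2l ?expn_gt0 ?prime_gt0.
Qed.

(** The degree J is fixed before n. Both laws are compared with the truncation polynomial at the
    cost of a moment of order J+1, which is bounded for the uniform law and passes to [w] by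
    universality. *)
Theorem expect_limit (alpha : R) (w : forall n, upper_index n -> 'Z_q -> R) :
  0 < alpha < 1 -> (forall n, is_law (w n)) -> (forall n, balanced p_pr alpha (w n)) ->
  (fun n => expect (w n) (fun M => N M * (kercard M == p ^ r)%N%:R) / A%:R ^+ n) @ \oo
    --> K0 * odd_power_product R p.
Proof.
move=> /andP[a0 a1] wl wb.
(* A balance constant for both laws, 1/2 being admissible for the uniform one since p >= 2; a single
   rho then serves both. *)
pose beta := Num.min alpha 2^-1.
have b01 : 0 < beta <= 1.
  by rewrite lt_min a0 invr_gt0 ltr0n /= ge_min ltW.
have [rho rho01 rhoP] := balanced_fourier_le l p_pr b01.
have wr n : fourier_le q1 rho (w n).
  apply: rhoP => // u x; apply: le_trans (wb n u x) _.
  by rewrite lerD2l lerN2 ge_min lexx.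
have ur n : fourier_le q1 rho (@uniform_law R p l n).
  apply: rhoP; first exact: uniform_is_law.
  move=> u x; apply: le_trans (uniform_balanced R l p_pr u x) _.
  by rewrite lerD2l lerN2 ge_min lexx orbT.
have ul n := @uniform_is_law R p l p_pr n.
apply/cvgrPdist_le => e e0.
have e6 : 0 < e / 6 by rewrite divr_gt0.
have [J tJ] := tail_small e6.
have /cvgrPdist_le/(_ _ e6) Hlim := uniform_limit.
pose tc := trunc_const J / P ^+ (r * J.+1).
have tc0 : 0 <= tc.
  by rewrite divr_ge0 ?invr_ge0 ?mulr_ge0 ?exprn_ge0 ?(ltW P0) ?(ltW (den_gt0 J)).
have d0 : 0 < e / 6 / (tc + 1) by rewrite divr_gt0// ltr_wpDl.
near=> n.
have rn : (r <= n)%N by near: n; exact: nbhs_infty_ge.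
have An : 0 < A%:R ^+ n :> R by rewrite exprn_gt0.
have h1 : `|expect (w n) (fun M => N M * (trunc_poly J).[(kercard M)%:R]) -
      expect (@uniform_law R p l n) (fun M => N M * (trunc_poly J).[(kercard M)%:R])|
    <= e / 6 * A%:R ^+ n.
  have : forall v v' : upper_index n -> 'Z_q -> R,
    is_law v -> is_law v' -> fourier_le q1 rho v -> fourier_le q1 rho v' ->
    `|expect v (fun M => N M * (trunc_poly J).[(kercard M)%:R]) -
      expect v' (fun M => N M * (trunc_poly J).[(kercard M)%:R])| <= e / 6 * A%:R ^+ n.
    by near: n; exact: poly_universality.
  by apply.
have h2 : `|expect (w n) (fun M => N M * (kercard M)%:R ^+ J.+1) -
      expect (@uniform_law R p l n) (fun M => N M * (kercard M)%:R ^+ J.+1)|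
    <= e / 6 / (tc + 1) * A%:R ^+ n.
  have : forall v v' : upper_index n -> 'Z_q -> R,
    is_law v -> is_law v' -> fourier_le q1 rho v -> fourier_le q1 rho v' ->
    `|expect v (fun M => N M * (kercard M)%:R ^+ J.+1) -
      expect v' (fun M => N M * (kercard M)%:R ^+ J.+1)| <= e / 6 / (tc + 1) * A%:R ^+ n.
    by near: n; exact: moment_universality.
  by apply.
have h3 : `|K0 * odd_power_product R p - expect (@uniform_law R p l n)
     (fun M => N M * (kercard M == p ^ r)%N%:R) / A%:R ^+ n| <= e / 6.
  by near: n.
have h4 := expect_trunc J (wl n); have h5 := expect_trunc J (ul n).
have h6 := uniform_moment_le J rn.
rewrite -/tc in h4 h5.
set x := expect (w n) (fun M => N M * (kercard M == p ^ r)%N%:R) in h4 *.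
set y := expect (w n) (fun M => N M * (trunc_poly J).[(kercard M)%:R]) in h1 h4.
set x' := expect _ (fun M => N M * (kercard M == p ^ r)%N%:R) in h3 h5.
set y' := expect _ (fun M => N M * (trunc_poly J).[(kercard M)%:R]) in h1 h5.
set m := expect (w n) (fun M => N M * (kercard M)%:R ^+ J.+1) in h2 h4.
set m' := expect _ (fun M => N M * (kercard M)%:R ^+ J.+1) in h2 h5 h6.
have Pr : 0 < P ^+ (r * J.+1) by rewrite exprn_gt0.
have m'le : tc * m' <= e / 6 * A%:R ^+ n.
  apply: le_trans (ler_wpM2l tc0 h6) _; rewrite [leLHS]mulrA.
  apply: ler_wpM2r; first exact: ltW.
  by apply: le_trans tJ; rewrite /tc -mulrA mulKf ?gt_eqF.
have mle : tc * m <= e / 6 * A%:R ^+ n + e / 6 * A%:R ^+ n.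
  have : m <= m' + e / 6 / (tc + 1) * A%:R ^+ n.
    by move: h2; rewrite ler_norml => /andP[_]; rewrite lerBlDl.
  move/(ler_wpM2l tc0); move/le_trans; apply; rewrite mulrDr; apply: lerD => //.
  rewrite [leLHS]mulrA; apply: ler_wpM2r; first exact: ltW.
  rewrite mulrCA ler_piMr ?(ltW e6)//.
  by rewrite ler_pdivrMr ?mul1r ?lerDl// ltr_wpDl.
(* Truncation for w costs two sixths of e, universality one, truncation for the uniform law one; the
   fifth is slack. *)
have xx' : `|x - x'| <= (5 * (e / 6)) * A%:R ^+ n.
  have -> : x - x' = (x - y) + ((y - y') + (y' - x')) by ring.
  apply: le_trans (ler_normD _ _) _.
  apply: le_trans (lerD h4 (le_trans (ler_normD _ _) (lerD h1 (le_refl _)))) _.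
  have h5' : `|y' - x'| <= tc * m' by rewrite distrC.
  rewrite -[5 * _ * _]mulrA; set z := e / 6 * _ in m'le mle *.
  have z0 : 0 <= z by rewrite mulr_ge0 ?(ltW An) ?(ltW e6).
  by move: (tc * m) (tc * m') mle m'le h5' => u v; lra.
have -> : K0 * odd_power_product R p - x / A%:R ^+ n =
    (K0 * odd_power_product R p - x' / A%:R ^+ n) - (x - x') / A%:R ^+ n by ring.
apply: le_trans (ler_normB _ _) _; rewrite normrM normfV (gtr0_norm An).
have : `|x - x'| / A%:R ^+ n <= 5 * (e / 6) by rewrite ler_pdivrMr.
lra.
Unshelve. all: by end_near. Qed.

End limit.

(** * Finite abelian p-groups, cokernels and their pairings *)

(** The cyclic decomposition of [abelian_structure]. Its factors are nontrivial, and this positivity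
    of [e] makes every congruence modulo p^(e a) visible modulo p. *)
Lemma zmod_basis (G : finZmodType) (p : nat) : (p.-group [set: G]%SET)%g ->
  exists (r : nat) (e : 'I_r -> nat) (g : 'I_r -> G),
    [/\ forall a, (0 < e a)%N,
        forall x, exists c : 'I_r -> int, x = \sum_a g a *~ c a,
        forall c : 'I_r -> int,
          \sum_a g a *~ c a = 0 <-> forall a, ((p ^ e a)%N%:Z %| c a)%Z
      & #|G| = (\prod_a p ^ e a)%N].
Proof.
move=> pG; have [b Gb ordb] := abelian_structure (FinRing.Theory.zmod_abelian [set: G]%SET).
pose r := size b; pose g (a : 'I_r) : G := tnth (in_tuple b) a.
have Gg : \big[dprod/1%g]_(a < r) <[g a]>%g = [set: G]%SET.
  exact: (etrans (esym (big_tnth _ _ b xpredT (fun x => <[x]>%g))) Gb).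
have ord a : exists k, (0 < k)%N && (#[g a]%g == p ^ k)%N.
  have pk : p.-nat #[g a]%g by exact: pnat_dvd (order_dvdG (finset.in_setT _)) pG.
  have [k ak] := p_natP pk; exists k; rewrite ak eqxx andbT lt0n; apply/eqP => k0.
  have : #[g a]%g \in abelian_type [set: G]%SET.
    by rewrite -ordb; apply: map_f; exact: mem_tnth.
  by move=> /(allP (abelian_type_gt1 _)); rewrite ak k0 expn0.
pose e a := xchoose (ord a).
have e0 a : (0 < e a)%N by have /andP[] := xchooseP (ord a).
have eP a : #[g a]%g = (p ^ e a)%N by have /andP[_ /eqP] := xchooseP (ord a).
have cyc a (c : int) : g a *~ c \in <[g a]>%g.
  case: c => m; first by rewrite -[g a *~ _]/((g a ^+ m)%g) mem_cycle.
  by rewrite -[g a *~ _]/((g a ^- m.+1)%g) groupV mem_cycle.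
have dvd a (c : int) : (g a *~ c == 0) = ((p ^ e a)%N%:Z %| c)%Z.
  have nat_case m : (g a *+ m == 0) = (p ^ e a %| m)%N by rewrite -eP order_dvdn.
  case: c => m; first by rewrite dvdzE /= -nat_case.
  by rewrite NegzE mulrNz oppr_eq0 dvdzE abszN /= -nat_case.
exists r, e, g; split=> //.
- move=> x; have [c [cg xE _]] := mem_bigdprod Gg (finset.in_setT x).
  have cex a : exists m : nat, c a == g a *+ m.
    by have /cycleP[m ->] := cg a isT; exists m.
  exists (fun a => (xchoose (cex a))%:Z); rewrite xE.
  rewrite -[LHS]/(\sum_a c a); apply: eq_bigr => a _.
  exact/eqP/(xchooseP (cex a)).
- move=> c; split=> [c0 a|H]; last first.
    by rewrite big1// => a _; apply/eqP; rewrite dvd H.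
  have [d [_ _ uniq]] := mem_bigdprod Gg (finset.in_setT (0 : G)).
  have u1 := uniq (fun a => g a *~ c a) (fun a _ => cyc a _) (esym c0) a isT.
  have u2 := uniq (fun a => 0) (fun a _ => group1 _) _ a isT.
  by rewrite -dvd u1 -u2// big1_eq.
- by rewrite -cardsT -(bigdprod_card Gg); apply: eq_bigr => a _; rewrite -eP.
Qed.

Lemma qzD (x y : rat) : qz (x + y) = qz x + qz y.
Proof. by rewrite /qz raddfD. Qed.

Lemma qzB (x y : rat) : qz (x - y) = qz x - qz y.
Proof. by rewrite /qz raddfB. Qed.

Lemma qz0 : qz 0 = 0.
Proof. by rewrite /qz raddf0. Qed.

Lemma qz_eq0 (x : rat) : qz x = 0 <-> x \is a Num.int.
Proof. by rewrite -qz0 qzP subr0. Qed.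

Lemma qzMz (x : rat) (m : int) : qz (x *~ m) = qz x *~ m.
Proof. by rewrite /qz raddfMz. Qed.

Lemma qz_sum (I : finType) (F : I -> rat) : qz (\sum_i F i) = \sum_i qz (F i).
Proof. exact: (big_morph qz qzD qz0). Qed.

Lemma qz_surj (t : QmodZ) : exists x, t = qz x.
Proof. by exists (generic_quotient.repr t); rewrite /qz generic_quotient.reprK. Qed.

Lemma int_div_nat (m : nat) (z : int) : (0 < m)%N ->
  ((z%:~R / m%:R : rat) \is a Num.int) = (m%:Z %| z)%Z.
Proof.
move=> m0; have mn0 : m%:R != 0 :> rat by rewrite pnatr_eq0 -lt0n.
apply/intrP/dvdzP => -[x xE]; exists x.
  apply: (@intr_inj rat); rewrite intrM -[X in _ * X]/(m%:R) -xE.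
  by rewrite divfK.
by rewrite xE intrM -[X in _ * X / _]/(m%:R) mulfK.
Qed.

(** * Corank and dual rows over a field *)

Section field_kernels.
Variables (F : fieldType) (n r : nat) (B : 'M[F]_n) (Y H : 'M[F]_(r, n)).
Hypothesis YB : Y *m B = 0.
Hypothesis HY : H *m Y^T \in unitmx.

Lemma dual_row_free : row_free Y.
Proof.
apply/row_freeP; exists (H^T *m invmx (Y *m H^T)); rewrite mulmxA mulmxV//.
by rewrite -unitmx_tr trmx_mul trmxK.
Qed.

(** If u B = 0 then u = z Y, since the r independent rows of Y fill the kernel; and z (Y H^T) = 0
    gives z = 0. With its converse below, this turns the corank condition into the statement that
    the columns of B and H^T generate everything. *)
Lemma corank_row_free : (n - \rank B)%N = r -> row_free (row_mx B H^T).
Proof.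
move=> nr; rewrite -kermx_eq0 -submx0; apply/row_subP => i; rewrite submx0.
have := row_sub i (kermx (row_mx B H^T)); move: (row i _) => u.
rewrite (sameP sub_kermxP eqP) mul_mx_row -row_mx0 => /eqP/eq_row_mx[/sub_kermxP uB uH].
have YK : (Y <= kermx B)%MS by exact/sub_kermxP.
have : (kermx B <= Y)%MS.
  by rewrite -(geq_leqif (mxrank_leqif_sup YK)) mxrank_ker nr (eqP dual_row_free).
move=> /(submx_trans uB)/submxP[z uz]; move: uH; rewrite uz -mulmxA => zu.
have : z = 0.
  apply: (can_inj (mulmxK (_ : Y *m H^T \in unitmx))); last by rewrite zu mul0mx.
  by rewrite -unitmx_tr trmx_mul trmxK.
by move=> ->; rewrite mul0mx.
Qed.

Lemma row_free_corank : row_free (row_mx B H^T) -> (n - \rank B)%N = r.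
Proof.
move=> /eqP rk; apply/eqP; rewrite eqn_leq; apply/andP; split.
  have : row_mx B H^T = B *m row_mx 1%:M 0 + H^T *m row_mx 0 1%:M.
    by rewrite !mul_mx_row !mulmx1 !mulmx0 add_row_mx addr0 add0r.
  move=> /(congr1 mxrank) E; rewrite leq_subLR -[X in (X <= _)%N]rk E.
  apply: leq_trans (mxrank_add _ _) _; apply: leq_add; first exact: mxrankM_maxl.
  exact: leq_trans (mxrankM_maxl _ _) (rank_leq_col _).
rewrite -mxrank_ker -[X in (X <= _)%N](eqP dual_row_free); apply: mxrankS.
exact/sub_kermxP.
Qed.

End field_kernels.

Lemma coprimez_torsion (V : zmodType) (x : V) (m k : int) :
  coprimez m k -> x *~ m = 0 -> x *~ k = 0 -> x = 0.
Proof.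
move=> /coprimezP[[u v] /= uv] xm xk.
by rewrite -[x]mulr1z -uv mulrzDr [u * m]mulrC [v * k]mulrC !mulrzA xm xk !mul0rz addr0.
Qed.

Lemma coprimez_ppower (p : nat) (m : int) k : prime p -> ~~ (p%:Z %| m)%Z ->
  coprimez m (p ^ k)%N%:Z.
Proof.
by move=> p_pr pm; rewrite coprimezE /= coprime_sym coprimeXl// prime_coprime.
Qed.

Lemma dvdp_Fp (p : nat) (z : int) : prime p -> (p%:Z %| z)%Z -> z%:~R = 0 :> 'F_p.
Proof.
by move=> p_pr /dvdzP[t ->]; rewrite intrM -[X in _ * X]/(p%:R) pchar_Fp_0// mulr0.
Qed.

Lemma Fp_dvdp (p : nat) (z : int) : prime p -> z%:~R = 0 :> 'F_p -> (p%:Z %| z)%Z.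
Proof.
move=> p_pr; have nat_case (m : nat) : m%:R = 0 :> 'F_p -> (p %| m)%N.
  by move=> /(congr1 val); rewrite /= val_Fp_nat// => /eqP.
case: z => m; first exact: nat_case.
by rewrite NegzE mulrNz dvdzE abszN => /eqP; rewrite oppr_eq0 => /eqP/nat_case.
Qed.

(** The adjugate, with the p-part of the determinant set apart. Multiplication by m is invertible on
    p-primary groups, so arguing up to m takes the place of localisation at p. *)
Lemma det_split (p n : nat) (M : 'M[int]_n) : prime p -> \det M != 0 ->
  exists u (m : int) (W : 'M[int]_n),
    ~~ (p%:Z %| m)%Z /\ M *m W = ((p ^ u)%N%:Z * m)%:M.
Proof.
move=> p_pr dM; have d0 : (0 < `|\det M|)%N by rewrite absz_gt0.
have [m pm dE] := pfactor_coprime p_pr d0.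
exists (logn p `|\det M|), ((-1) ^+ (\det M < 0)%R * m%:Z), (\adj M); split.
  rewrite dvdzE abszMsign /=; apply: contraL pm => pm.
  by rewrite prime_coprime// pm.
rewrite mul_mx_adj; congr _%:M.
transitivity ((-1) ^+ (\det M < 0)%R * (`|\det M|%N)%:Z); first exact: intEsign.
by rewrite [in LHS]dE PoszM mulrA mulrC.
Qed.

Lemma dvdz_sum (I : finType) (d : int) (f : I -> int) :
  (forall i, (d %| f i)%Z) -> (d %| \sum_i f i)%Z.
Proof. by move=> df; apply: rpred_sum => i _; exact: df. Qed.

Lemma mulmxMz m n k (A : 'M[int]_(m, n)) (B : 'M[int]_(n, k)) z :
  A *m (B *~ z) = (A *m B) *~ z.
Proof. exact: (raddfMz (mulmx A)). Qed.

Lemma det_neq0_inj n (M : 'M[int]_n) (u v : 'cV[int]_n) : \det M != 0 ->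
  M *m u = M *m v -> u = v.
Proof.
move=> d0 uv; apply/matrixP => i j; have := congr1 (mulmx (\adj M)) uv.
rewrite !mulmxA mul_adj_mx !mul_scalar_mx => /matrixP/(_ i j); rewrite !mxE.
exact: mulfI.
Qed.

(** * The Sylow p-subgroup of the cokernel *)

Section sylow_cokernel.
Variables (p n : nat) (M : 'M[int]_n).
Hypothesis p_pr : prime p.

Lemma cok_classD u v : cok_class M (u + v) = cok_class M u + cok_class M v.
Proof. exact: raddfD. Qed.

Lemma cok_class0 : cok_class M 0 = 0.
Proof. exact: raddf0. Qed.

Lemma cok_classMz v m : cok_class M (v *~ m) = cok_class M v *~ m.
Proof. exact: raddfMz. Qed.

Lemma cok_class_eq0 v : cok_class M v = 0 <-> exists s, v = M *m s.
Proof. by rewrite -cok_class0 cok_classP subr0. Qed.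

Lemma ppower_torsion_sylow (v s : 'cV[int]_n) j : M *m s = v *~ (p ^ j)%N%:Z ->
  exists x : sylow p (cok M), sylow_val x = cok_class M v.
Proof.
move=> sv; have vP : cok_class M v \in ppower_torsion p (V := cok M).
  apply/asboolP; exists j; have -> : cok_class M v *+ p ^ j = cok_class M v *~ (p ^ j)%N%:Z by [].
  by rewrite -cok_classMz -sv; apply/cok_class_eq0; exists s.
by exists (Defs.Sylow vP).
Qed.

Lemma sylow_class (x : sylow p (cok M)) v : sylow_val x = cok_class M v ->
  exists s j, M *m s = v *~ (p ^ j)%N%:Z.
Proof.
case: x => x0 /asboolP[j xj] /= xv; rewrite xv in xj.
have /cok_class_eq0[s vs] : cok_class M (v *~ (p ^ j)%N%:Z) = 0 by rewrite cok_classMz.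
by exists s, j.
Qed.

Lemma sylow_lift (x : sylow p (cok M)) : exists v, sylow_val x = cok_class M v.
Proof. by exists (generic_quotient.repr (sylow_val x)); rewrite /cok_class generic_quotient.reprK. Qed.

Lemma sylow_valMz (x : sylow p (cok M)) m : sylow_val (x *~ m) = sylow_val x *~ m.
Proof. exact: (raddfMz (\val : sylow p (cok M) -> cok M)). Qed.

Hypothesis symM : M^T = M.

(** A witness for the first argument is enough: in S^t M S' / (k k') the factor M S' equals k' v',
    and k' cancels. *)
Lemma sylow_pairing_formula (x x' : sylow p (cok M)) v v' s j :
  sylow_val x = cok_class M v -> sylow_val x' = cok_class M v' ->
  M *m s = v *~ (p ^ j)%N%:Z ->
  sylow_pairing x x' = qz ((dot s v')%:~R / (p ^ j)%:R).
Proof.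
move=> xv xv' sv; have [s' [j' sv']] := sylow_class xv'.
have perp w t i : M *m t = w *~ (p ^ i)%N%:Z -> ker_perp M w.
  move=> tw u Mu; have : dot w u *+ (p ^ i) = 0.
    by rewrite -dotMnl -[w *+ _]/(w *~ (p ^ i)%N%:Z) -tw -dot_sym// Mu /dot mulmx0 mxE.
  by move/eqP; rewrite mulrn_eq0 expn_eq0 (gtn_eqF (prime_gt0 p_pr))/= => /eqP.
have pp i : (0 < p ^ i)%N by rewrite expn_gt0 prime_gt0.
apply: canonical_pairingE => //; exists v, v', s, s', (p ^ j)%N, (p ^ j')%N; split=> //.
- by split; [exact: perp sv|exact: perp sv'].
- congr qz; rewrite sv' [dot s (_ *~ _)]dotC -[v' *~ _]/(v' *+ (p ^ j')) dotMnl dotC rmorphMn/=.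
  rewrite -[X in _ = X / _]mulr_natr natrM.
  by rewrite -mulf_div divff ?mulr1// pnatr_eq0 -lt0n.
Qed.

End sylow_cokernel.

(** Each e a is counted once for every b >= a and once for every b <= a, that is r + 1 times. *)
Lemma sum_upper_index r (e : 'I_r -> nat) :
  (\sum_(u : upper_index r) (e (val u).1 + e (val u).2) = r.+1 * \sum_a e a)%N.
Proof.
have -> : (\sum_(u : upper_index r) (e (val u).1 + e (val u).2) =
    \sum_(x : 'I_r * 'I_r | (x.1 <= x.2)%N) (e x.1 + e x.2))%N.
  rewrite (reindex_onto (fun u : upper_index r => val u) (fun x => uidx x.1 x.2)) /=.
    by apply: eq_bigl => u; rewrite uidxK eqxx andbT; case: u.
  by move=> [a b] /= ab; rewrite ab.
rewrite (eq_bigr (fun x : 'I_r * 'I_r => e x.1 + e x.2)%N)//.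
rewrite -(pair_big_dep xpredT (fun a b : 'I_r => a <= b)%N (fun a b => e a + e b)%N) /=.
under eq_bigr do rewrite big_split /=.
rewrite big_split /= [X in (_ + X)%N](exchange_big_dep xpredT) //= -big_split /= big_distrr /=.
have cst (Q : pred 'I_r) c : (\sum_(i | Q i) c = #|[pred i | Q i]| * c)%N.
  by rewrite -sum_nat_const; apply: eq_bigl => i; rewrite inE.
apply: eq_bigr => a _; rewrite !cst -mulnDl; congr (_ * _)%N.
have := cardUI [pred b : 'I_r | a <= b]%N [pred b : 'I_r | b <= a]%N.
have -> : #|[predU [pred b : 'I_r | a <= b]%N & [pred b : 'I_r | b <= a]%N]| = r.
  by rewrite -[RHS]card_ord; apply: eq_card => b; rewrite !inE leq_total.
have -> : #|[predI [pred b : 'I_r | a <= b]%N & [pred b : 'I_r | b <= a]%N]| = 1%N.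
  by rewrite -(card1 a); apply: eq_card => b; rewrite !inE -eqn_leq eq_sym.
by rewrite addn1 => ->.
Qed.

Lemma card_sym_family q r (S : 'I_r -> 'I_r -> {set 'Z_q}) :
  (forall a b, S a b = S b a) ->
  #|[pred A : 'M['Z_q]_r | (A^T == A) && [forall a, forall b, A a b \in S a b]]| =
  (\prod_(u : upper_index r) #|S (val u).1 (val u).2|)%N.
Proof.
move=> Ss.
have -> : (\prod_(u : upper_index r) #|S (val u).1 (val u).2|)%N =
    #|family (fun u : upper_index r => mem (S (val u).1 (val u).2))|.
  by rewrite card_family foldrE big_image.
rewrite -(card_imset _ (@symx_inj r 'Z_q)); apply: eq_card => A; rewrite inE.
apply/andP/imsetP => [[/eqP At /forallP AS]|[f /familyP fS ->]].
  exists [ffun u => A (val u).1 (val u).2]; last by rewrite symxK.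
  by apply/familyP => u; rewrite ffunE; exact: (forallP (AS _)).
split; first by rewrite symx_sym.
apply/forallP => a; apply/forallP => b; rewrite mxE.
suff <- : S (val (uidx a b)).1 (val (uidx a b)).2 = S a b by exact: fS.
by rewrite /=; case: ifP => //= _; rewrite Ss.
Qed.

(** * Singular matrices *)

(** Denominators are cleared in a rational kernel vector, which is then divided by p as long as
    possible. The absolute value of a fixed nonzero coordinate decreases at each division. *)
Lemma int_kernel_vector (p n : nat) (M : 'M[int]_n) : prime p -> \det M = 0 ->
  exists2 v : 'rV[int]_n, v *m M = 0 & exists i, ~~ (p%:Z %| v ord0 i)%Z.
Proof.
move=> p_pr dM.
have [v v0 vM] : exists2 v : 'rV[int]_n, v != 0 & v *m M = 0.
  have /det0P[v v0 vM] : \det (map_mx intr M : 'M[rat]_n) == 0.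
    by rewrite det_map_mx dM.
  pose u := \row_j (numq (v 0 j) * \prod_(i | i != j) denq (v 0 i)).
  pose D : int := \prod_i denq (v 0 i).
  have D0 : D != 0 by apply/prodf_neq0 => i _; exact: denq_neq0.
  have uE : map_mx intr u = D%:~R *: v :> 'rV[rat]_n.
    apply/rowP => j; have -> : D = denq (v 0 j) * \prod_(i | i != j) denq (v 0 i).
      by rewrite /D (bigD1 j).
    rewrite !mxE !intrM -[X in _ = _ * X]divq_num_den.
    by field; rewrite intr_eq0 denq_neq0.
  exists u.
    apply: contra_neq v0 => u0; apply/eqP.
    move: uE; rewrite u0 map_mx0 => /esym/eqP.
    by rewrite scaler_eq0 intr_eq0 (negbTE D0).
  have uM : map_mx intr (u *m M) = 0 :> 'rV[rat]_n.
    by rewrite map_mxM [X in X *m _]uE -scalemxAl vM scaler0.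
  apply/rowP => j; apply: (@intr_inj rat); have /rowP/(_ j) := uM.
  by rewrite mxE => ->; rewrite !mxE.
have [i vi] : exists i, v ord0 i != 0.
  apply/existsP; apply: contraNT v0; rewrite negb_exists => /forallP H.
  by apply/eqP/rowP => i; rewrite mxE; apply/eqP; have := H i; rewrite negbK.
elim: {v}`|v ord0 i|%N {-2}v (leqnn `|v ord0 i|%N) vi vM v0 => [|N IH] v vN vi vM v0.
  by move: vN; rewrite leqn0 absz_eq0 (negbTE vi).
have [/forallP H|/forallPn H] := boolP [forall j, (p%:Z %| v ord0 j)%Z]; last by exists v.
pose u := \row_j (v ord0 j %/ p%:Z)%Z.
have pu : v = p%:Z *: u by apply/rowP => j; rewrite !mxE mulrC divzK.
have p0 : p%:Z != 0 by rewrite -lt0n prime_gt0.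
have ui : u ord0 i != 0 by apply: contra_neq vi => ui; rewrite pu mxE ui mulr0.
apply: (IH u) => //.
- rewrite -ltnS; apply: leq_trans vN.
  have -> : v ord0 i = p%:Z * u ord0 i by rewrite {1}pu mxE.
  rewrite abszM /=.
  by rewrite ltn_Pmull ?prime_gt1// absz_gt0.
- have puM : p%:Z *: (u *m M) = 0 by rewrite scalemxAl -pu.
  apply/matrixP => a b; have /matrixP/(_ a b) := puM.
  rewrite [LHS]mxE [RHS]mxE => /eqP; rewrite mulf_eq0 (negbTE p0) => /eqP ->.
  by rewrite mxE.
- by apply: contra_neq ui => ->; rewrite mxE.
Qed.

Section singular.
Variables (R : realType) (p l : nat).
Hypothesis p_pr : prime p.
Local Notation q := (p ^ l.+1)%N.
Local Notation q1 := (prime_power_gt1 l p_pr).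
Local Notation red := (red l p_pr).

(** The weight 1 asks for Y M = 0 modulo q and the zero weights switch the quadratic conditions off;
    [row_free] restricts to rows that are nonzero modulo p. *)
Definition null_count n (M : 'M['Z_q]_n) : R :=
  weighted_count (fun=> 1 : 'Z_q) (fun _ _ : 'I_1 => 0) (fun _ _ => 0)
    (fun Y => (row_free (map_mx red Y))%:R) M.

Let one_red (s : 'I_1) (x : 'Z_q) : 1 * x = 0 -> red x = 0.
Proof. by rewrite mul1r => ->; rewrite rmorph0. Qed.

Let cond1E n (Y : 'M['Z_q]_(1, n)) (M : 'M['Z_q]_n) :
  quad_cond (fun=> 1 : 'Z_q) (fun _ _ : 'I_1 => 0) (fun _ _ => 0) Y M = (Y *m M == 0).
Proof.
apply/andP/eqP => [[/forallP H _]|YM].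
  apply/matrixP => s i; have /forallP/(_ s) := H i; rewrite mul1r => /eqP ->.
  by rewrite mxE.
split; first by apply/forallP => i; apply/forallP => s; rewrite YM mxE mulr0.
by apply/forallP => st; rewrite mul0r.
Qed.

Let ann1 (s : 'I_1) : #|annihilator (fun=> 1 : 'Z_q) s| = 1%N.
Proof.
transitivity #|[set 0 : 'Z_q]%SET|; last exact: cards1.
by apply: eq_card => x; rewrite !inE mul1r.
Qed.

(** A row that is nonzero modulo p is part of a basis, so a uniform M kills it with probability
    q^-n; there are at most q^n such rows. *)
Lemma null_count_mean n : (0 < n)%N -> mean (@null_count n) <= 1.
Proof.
case: n => // m _; rewrite -[m.+1]/(1 + m)%N.
rewrite /mean ler_pdivrMr ?symcount_gt0// mul1r.
have -> : symsum (@null_count (1 + m)) = \sum_(Y : 'M['Z_q]_(1, 1 + m))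
   (row_free (map_mx red Y))%:R * symsum (fun M : 'M['Z_q]_(1 + m) =>
     (quad_cond (fun=> 1 : 'Z_q) (fun _ _ : 'I_1 => 0) (fun _ _ => 0) Y M)%:R * 1 : R).
  rewrite /symsum exchange_big /=; apply: eq_bigr => Y _; rewrite mulr_sumr.
  by apply: eq_bigr => M _; rewrite mulr1.
have corner : corner_count (fun=> 1 : 'Z_q) (fun _ _ : 'I_1 => 0) (fun _ _ => 0) = 1%N.
  transitivity #|pred1 (0 : 'M['Z_q]_1)|; last exact: card1.
  apply: eq_card => A; rewrite !inE cond1E mul1mx.
  by apply: andb_idl => /eqP ->; rewrite trmx0.
apply: (@le_trans _ _ (\sum_(Y : 'M['Z_q]_(1, 1 + m)) symcount R p l m)).
  apply: ler_sum => Y _; case: (boolP (row_free _)) => [Yf|_]; last first.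
    by rewrite mul0r ltW// symcount_gt0.
  rewrite mul1r (symsum_full_rank _ _ one_red (fun=> 1) Yf) corner mul1r.
  by rewrite big1 ?exp1n ?mul1r.
rewrite sumr_constE (card_mx_Zq l p_pr) mul1n (symcount_block R l p_pr 1 m) symcount1// mul1n.
by rewrite (expnD q 1 m) expn1 natrM.
Qed.

(** The multiples t v of an integral kernel vector v that is nonzero modulo p, with t = 1 modulo p:
    there are p^l of them, distinct because v has a coordinate that is a unit. *)
Lemma null_count_singular n (M : 'M[int]_n) : \det M = 0 ->
  (p ^ l)%:R <= null_count (map_mx intr M).
Proof.
move=> /(int_kernel_vector p_pr)[v vM [i vi]].
pose vq : 'rV['Z_q]_n := map_mx intr v.
have vu : vq 0 i \is a GRing.unit.
  by rewrite (red_unit p_pr) mxE rmorph_int; apply: contra vi => /eqP/(Fp_dvdp p_pr).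
pose S := [set t : 'Z_q | red t == 1]%SET.
have cS : #|S| = (p ^ l)%N.
  apply/eqP; rewrite cardsE -(eqn_pmul2r (prime_gt0 p_pr)) -expnSr; apply/eqP.
  exact: card_red_fiber.
have inj : injective (fun t : 'Z_q => t *: vq).
  by move=> t t' /rowP/(_ i); rewrite [LHS]mxE [RHS]mxE; exact: (mulIr vu).
rewrite -cS -(card_imset _ inj) /null_count /weighted_count -sum1_card natr_sum.
rewrite big_mkcond /=; apply: ler_sum => Y _; case: ifP => [/imsetP[t]|_].
  rewrite inE => /eqP t1 ->; rewrite cond1E -scalemxAl -map_mxM vM map_mx0 scaler0 eqxx.
  have -> : map_mx red (t *: vq) = map_mx intr v.
    by apply/rowP => j; rewrite !mxE rmorphM /= t1 mul1r rmorph_int.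
  rewrite /row_free rank_rV.
  have -> : (map_mx intr v != 0 :> 'rV['F_p]_n); last by rewrite mulr1.
  apply: contra vi => /eqP/rowP/(_ i); rewrite !mxE => H.
  exact: Fp_dvdp.
by rewrite mulr_ge0.
Qed.

(** Here A = 1, so universality with eps = 1 compares directly with the uniform mean, which is at
    most 1. *)
Lemma null_count_expect (alpha : R) : 0 < alpha < 1 ->
  \forall n \near \oo, forall w : upper_index n -> 'Z_q -> R,
    is_law w -> balanced p_pr alpha w -> expect w (@null_count n) <= 2.
Proof.
move=> /andP[a0 a1].
have b01 : 0 < Num.min alpha 2^-1 <= 1.
  by rewrite lt_min a0 invr_gt0 ltr0n /= ge_min (ltW a1).
have [rho rho01 fl] := balanced_fourier_le l p_pr b01.
have weaken n (w : upper_index n -> 'Z_q -> R) (b : R) :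
    Num.min alpha 2^-1 <= b -> balanced p_pr b w -> balanced p_pr (Num.min alpha 2^-1) w.
  by move=> bb wb u x; apply: le_trans (wb u x) _; rewrite lerD2l lerN2.
apply: filterS2 (universality q1 (fun=> 1) (fun _ _ : 'I_1 => 0) (fun _ _ => 0) rho01
  (ltr01 : 0 < (1 : R))) (nbhs_infty_gt 0) => n H n0 w wl wb.
have c01 (Y : 'M['Z_q]_(1, n)) : `|(row_free (map_mx red Y))%:R| <= 1 :> R.
  by rewrite normr_nat; case: row_free; rewrite ?lexx ?ler01.
have := H w (@uniform_law R p l n) (fun Y => (row_free (map_mx red Y))%:R) wl
  (uniform_is_law R l p_pr n) _ _ c01.
have w1 : balanced p_pr (Num.min alpha 2^-1) w by apply: weaken wb; rewrite ge_min lexx.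
have w2 : balanced p_pr (Num.min alpha 2^-1) (@uniform_law R p l n).
  by apply: weaken (uniform_balanced R l p_pr (n:=n)); rewrite ge_min lexx orbT.
move=> /(_ (fl _ _ wl w1) (fl _ _ (uniform_is_law R l p_pr n) w2)).
rewrite expect_uniform// big1 ?expr1n ?mulr1 => [|s _]; last exact: ann1.
have := null_count_mean n0; rewrite /null_count.
set x := mean _; set y := expect _ _ => x1 /ler_normlP[_]; lra.
Qed.

End singular.

(** * Reduction of a random integer matrix modulo a prime power *)

Section int_random_variables.
Variables (R : realType) (d : measure_display) (T : measurableType d).
Variable P : probability T R.

Lemma measure_preim_finType (K : finType) (h : T -> K) (A : pred K) :
  (forall k, measurable [set t | h t = k]) ->
  measurable [set t | A (h t)] /\
  P [set t | A (h t)] = (\sum_(k | A k) P [set t | h t = k])%E.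
Proof.
move=> hm.
have seq_case (s : seq K) : uniq s -> measurable [set t | h t \in s] /\
    P [set t | h t \in s] = (\sum_(k <- s) P [set t | h t = k])%E.
  elim: s => [_|k s IH /= /andP[ks /IH[ms Ps]]].
    have -> : [set t | h t \in [::]] = set0 by apply/seteqP; split.
    by rewrite big_nil measure0; split.
  have -> : [set t | h t \in k :: s] = [set t | h t = k] `|` [set t | h t \in s].
    apply/seteqP; split=> t /=; rewrite inE.
      by move=> /orP[/eqP|]; [left|right].
    by move=> [->|->]; rewrite ?eqxx ?orbT.
  split; first exact: measurableU.
  have dis : [set t | h t = k] `&` [set t | h t \in s] = set0.
    by apply/seteqP; split=> t //= -[->]; rewrite (negbTE ks).
  by rewrite big_cons -Ps; exact: measureU.
have [mA PA] := seq_case (enum A) (enum_uniq A).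
have AE : [set t | h t \in enum A] = [set t | A (h t)].
  by apply/seteqP; split=> t /=; rewrite mem_enum.
by rewrite -AE; split=> //; rewrite PA big_enum.
Qed.

(** The values form a countable set, enumerated by [unpickle], so every event is a countable union
    of elementary ones. *)
Lemma measurable_ffun_preim (I : finType) (X : I -> T -> int) (B : set {ffun I -> int}) :
  (forall i, int_random_variable (X i)) ->
  measurable [set t | B [ffun i => X i t]].
Proof.
move=> Xm.
have single a : measurable [set t | [ffun i => X i t] = a].
  have -> : [set t | [ffun i => X i t] = a] = \big[setI/setT]_(i : I) (X i @^-1` [set a i]).
    rewrite -bigcap_seq; apply/seteqP; split=> t /=.
      by move=> <- i _ /=; rewrite ffunE.
    move=> H; apply/ffunP => i; rewrite ffunE.
    by apply: H; rewrite /= mem_index_enum.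
  by apply: bigsetI_measurable => i _; exact: Xm.
have -> : [set t | B [ffun i => X i t]] = \bigcup_m
    (if unpickle m is Some a then
       if `[< B a >] then [set t | [ffun i => X i t] = a] else set0 else set0).
  apply/seteqP; split=> t /=.
    move=> Bt; exists (pickle [ffun i => X i t]) => //.
    by rewrite pickleK; case: asboolP.
  move=> [m _]; case: (unpickle m) => [a|//].
  by case: asboolP => [Ba /= ->|_ []].
apply: bigcupT_measurable => m; case: (unpickle m) => [a|//].
by case: asboolP.
Qed.

End int_random_variables.

Section random_matrix.
Variables (R : realType) (d : measure_display) (T : measurableType d).
Variables (P : probability T R) (n : nat) (M : T -> 'M[int]_n).
Hypothesis Msym : forall t, (M t)^T = M t.
Hypothesis Mmeas : forall u, int_random_variable (upper_entry M u).
Hypothesis Mindep : mutually_independent P (upper_entry M).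

Lemma measurable_matrix_event (B : set 'M[int]_n) : measurable [set t | B (M t)].
Proof.
have := measurable_ffun_preim [set a | B (symx a)] Mmeas.
have e t : symx [ffun u => upper_entry M u t] = M t by exact: symxK.
by congr (measurable _); apply/seteqP; split=> t /=; rewrite e.
Qed.

Variables (p l : nat).
Hypothesis p_pr : prime p.
Local Notation q := (p ^ l.+1)%N.
Local Notation red := (red l p_pr).

Definition residue_law (u : upper_index n) (x : 'Z_q) : R :=
  fine (P [set t | (upper_entry M u t)%:~R = x]).

Let ev u (x : 'Z_q) : measurable [set t | (upper_entry M u t)%:~R = x].
Proof. exact: (Mmeas u [set z | z%:~R = x]). Qed.

Lemma residue_lawE u x : P [set t | (upper_entry M u t)%:~R = x] = (residue_law u x)%:E.
Proof. by rewrite fineK// fin_num_measure. Qed.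

Lemma residue_is_law : is_law residue_law.
Proof.
split=> [u x|u]; first by rewrite fine_ge0// measure_ge0.
have [_] := measure_preim_finType P predT (ev u).
have -> : [set t | predT ((upper_entry M u t)%:~R : 'Z_q)] = setT by apply/seteqP; split.
rewrite probability_setT; under eq_bigr do rewrite residue_lawE.
by rewrite sumEFin => -[].
Qed.

Lemma residue_balanced (alpha : R) :
  (forall u (z : int), (P [set t | (upper_entry M u t = z %[mod p])%Z] <= (1 - alpha)%:E)%E) ->
  balanced p_pr alpha residue_law.
Proof.
move=> hb u a.
have [_] := measure_preim_finType P (fun x => red x == a) (ev u).
under eq_bigr do rewrite residue_lawE.
rewrite sumEFin -lee_fin => <-; apply: le_trans (hb u (a : nat)%:Z).
rewrite le_eqVlt; apply/orP; left; apply/eqP; congr (P _); apply/seteqP.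
have aE : a = ((a : nat)%:Z)%:~R :> 'F_p by rewrite -pmulrn natr_Zp.
split=> t /=; rewrite rmorph_int//.
  move=> /eqP xa; apply/eqP; rewrite eqz_mod_dvd; apply: (Fp_dvdp p_pr).
  by rewrite intrB xa -aE subrr.
move=> /eqP; rewrite eqz_mod_dvd => /(dvdp_Fp p_pr); rewrite intrB -aE => /eqP.
by rewrite subr_eq0.
Qed.

Lemma residue_expect (A : pred 'M['Z_q]_n) :
  P [set t | A (map_mx intr (M t))] = (expect residue_law (fun B => (A B)%:R))%:E.
Proof.
pose h t : {ffun upper_index n -> 'Z_q} := [ffun u => (upper_entry M u t)%:~R].
have hE t : symx (h t) = map_mx intr (M t).
  rewrite -(symxK (M := map_mx intr (M t) : 'M['Z_q]_n)); last by rewrite map_trmx Msym.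
  by congr symx; apply/ffunP => u; rewrite !ffunE mxE.
have hP a : [set t | h t = a] = [set t | forall u, u \in [set: upper_index n]%SET ->
    [set z : int | z%:~R = a u :> 'Z_q] (upper_entry M u t)].
  apply/seteqP; split=> t /=; first by move=> <- u _; rewrite ffunE.
  by move=> H; apply/ffunP => u; rewrite ffunE; apply: H; rewrite finset.in_setT.
have hm a : measurable [set t | h t = a].
  have := measurable_ffun_preim [set b : {ffun upper_index n -> int} | [ffun u => (b u)%:~R : 'Z_q] = a] Mmeas.
  congr (measurable _); apply/seteqP.
  have e t : [ffun u => ([ffun i => upper_entry M i t] u)%:~R : 'Z_q] = h t.
    by apply/ffunP => u; rewrite !ffunE.
  by split=> t /=; rewrite e.
have [_] := measure_preim_finType P (fun a => A (symx a)) hm.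
have -> : [set t | A (symx (h t))] = [set t | A (map_mx intr (M t))].
  by apply/seteqP; split=> t /=; rewrite hE.
move=> ->; rewrite /expect -sumEFin [RHS](bigID (fun a => A (symx a))) /=.
rewrite [X in (_ + X)%E]big1 ?adde0 => [|a /negbTE ->]; last by rewrite mulr0.
apply: eq_bigr => a ->; rewrite mulr1 -prodEFin hP.
rewrite (Mindep [set: upper_index n]%SET (fun u => [set z : int | z%:~R = a u :> 'Z_q])).
rewrite (eq_bigl xpredT) => [|u]; last by rewrite finset.in_setT.
by apply: eq_bigr => u _; rewrite -residue_lawE.
Qed.

(** Markov inequality for [null_count], which is at least p^l on singular matrices. *)
Lemma singular_prob : expect residue_law (null_count R p_pr (n:=n)) <= 2 ->
  (P [set t | \det (M t) = 0%R] <= (2 / (p ^ l)%:R)%:E)%E.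
Proof.
move=> null2; pose A (B : 'M['Z_q]_n) := (p ^ l)%:R <= null_count R p_pr B.
have pl0 : 0 < (p ^ l)%:R :> R by rewrite ltr0n expn_gt0 prime_gt0.
have null0 (B : 'M['Z_q]_n) : 0 <= null_count R p_pr B.
  by apply: sumr_ge0 => Y _; rewrite mulr_ge0.
apply: (@le_trans _ _ (P [set t | A (map_mx intr (M t))])).
  apply: le_measure; rewrite ?inE.
  - exact: (measurable_matrix_event [set B | \det B = 0]).
  - exact: (measurable_matrix_event [set B | A (map_mx intr B)]).
  by move=> t /= /(null_count_singular R l p_pr).
rewrite residue_expect lee_fin ler_pdivlMr// mulrC; apply: le_trans null2.
rewrite -expectZ; apply: (le_expect residue_is_law) => B _; rewrite /A.
by case: (boolP ((p ^ l)%:R <= null_count R p_pr B)) => [H|_]; rewrite ?mulr1 ?mulr0.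
Qed.

End random_matrix.

(** * Homomorphisms onto a group with a duality pairing *)

Section presented_pairing.
Variables (G : finZmodType) (bG : G -> G -> QmodZ).
Hypothesis hbG : is_duality_pairing bG.

Lemma bGC x y : bG x y = bG y x. Proof. by case: hbG. Qed.
Lemma bGDl x y z : bG (x + y) z = bG x z + bG y z. Proof. by case: hbG. Qed.

Definition bGl y x := bG x y.

Lemma bG_zmod_morphism y : zmod_morphism (bGl y).
Proof.
by move=> x z; apply/eqP; rewrite eq_sym subr_eq /bGl -bGDl subrK.
Qed.

HB.instance Definition _ y := GRing.isZmodMorphism.Build G QmodZ (bGl y)
  (bG_zmod_morphism y).

Lemma bGMzl x y m : bG (x *~ m) y = bG x y *~ m.
Proof. exact: (raddfMz (bGl y)). Qed.

Lemma bG_suml (I : finType) (F : I -> G) y : bG (\sum_i F i) y = \sum_i bG (F i) y.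
Proof. exact: (raddf_sum (bGl y)). Qed.

Lemma bG0l y : bG 0 y = 0.
Proof. exact: (raddf0 (bGl y)). Qed.

Lemma bG_inj x y : (forall z, bG x z = bG y z) -> x = y.
Proof.
move=> xy.
have fadd : zmod_morphism (bG x).
  by move=> u v; rewrite !(bGC x); exact: bG_zmod_morphism.
pose f : {additive G -> QmodZ} := HB.pack (bG x) (GRing.isZmodMorphism.Build _ _ _ fadd).
have [_ _ /(_ f)[a [_ aP]]] := hbG.
by rewrite -(aP x (fun=> erefl)) -(aP y (fun z => esym (xy z))).
Qed.

Variables (p r : nat) (e : 'I_r -> nat) (g : 'I_r -> G).
Local Notation pz j := (p ^ j)%N%:Z.
Hypothesis p_pr : prime p.
Hypothesis e0 : forall a, (0 < e a)%N.
Hypothesis gen : forall x, exists c : 'I_r -> int, x = \sum_a g a *~ c a.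
Hypothesis rel : forall c : 'I_r -> int,
  \sum_a g a *~ c a = 0 <-> forall a, (pz (e a) %| c a)%Z.

Lemma rel_eq (c d : 'I_r -> int) :
  \sum_a g a *~ c a = \sum_a g a *~ d a <->
  forall a, (pz (e a) %| c a - d a)%Z.
Proof.
rewrite -rel; split=> [H|].
  by under eq_bigr do rewrite mulrzBr; rewrite sumrB H subrr.
by under eq_bigr do rewrite mulrzBr; rewrite sumrB => /subr0_eq.
Qed.

Let pe0 a : (0 < p ^ e a)%N. Proof. by rewrite expn_gt0 prime_gt0. Qed.

(** The a-th coordinate divided by p^(e a) is a well-defined character of G, which duality
    represents by an element. *)
Lemma dual_basis_exists a : exists k : G, forall c : 'I_r -> int,
  bG k (\sum_b g b *~ c b) = qz ((c a)%:~R / (p ^ e a)%:R).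
Proof.
pose c x := projT1 (cid (gen x)).
have cE x : x = \sum_b g b *~ c x b by exact: projT2 (cid (gen x)).
pose f x : QmodZ := qz ((c x a)%:~R / (p ^ e a)%:R).
have fE (d : 'I_r -> int) : f (\sum_b g b *~ d b) = qz ((d a)%:~R / (p ^ e a)%:R).
  apply/qzP; rewrite -mulrBl -intrB int_div_nat//.
  by apply: (rel_eq _ _).1; rewrite -cE.
have fadd : zmod_morphism f.
  move=> x y; rewrite {1}(cE x) {1}(cE y) -sumrB.
  under eq_bigr do rewrite -mulrzBr.
  by rewrite fE intrB mulrBl qzB.
pose fA : {additive G -> QmodZ} := HB.pack f (GRing.isZmodMorphism.Build _ _ f fadd).
have [_ _ /(_ fA)[k [kP _]]] := hbG.
by exists k => d; rewrite kP -fE.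
Qed.

Variables (k : 'I_r -> G) (theta : 'I_r -> 'I_r -> int).
Hypothesis kP : forall a (c : 'I_r -> int),
  bG (k a) (\sum_b g b *~ c b) = qz ((c a)%:~R / (p ^ e a)%:R).
Hypothesis kE : forall a, k a = \sum_b g b *~ theta a b.

Lemma bG_kg (d c : 'I_r -> int) :
  bG (\sum_a k a *~ d a) (\sum_b g b *~ c b) =
  qz (\sum_a (d a)%:~R * ((c a)%:~R / (p ^ e a)%:R)).
Proof.
rewrite bG_suml qz_sum; apply: eq_bigr => a _.
by rewrite bGMzl kP -qzMz -mulrzl.
Qed.

(** The value of x against g_a is killed by p^(e a), hence is a fraction d_a / p^(e a); the
    combination of the k_a with coefficients d_a pairs with every element as x does. *)
Lemma k_gen x : exists d : 'I_r -> int, x = \sum_a k a *~ d a.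
Proof.
have H a : exists d : int, bG x (g a) = qz (d%:~R / (p ^ e a)%:R).
  have [s sE] := qz_surj (bG x (g a)).
  have : qz (s *~ pz (e a)) = 0.
    rewrite qzMz -sE bGC -bGMzl.
    have -> : g a *~ pz (e a) = \sum_b g b *~ (if b == a then pz (e a) else 0).
      rewrite (bigD1 a)//= eqxx big1 ?addr0// => b /negbTE ->.
      by rewrite mulr0z.
    rewrite (rel _).2 ?bG0l//; by move=> b; case: eqP => [->|_]; rewrite ?dvdz0.
  move=> /qz_eq0/intrP[d dE]; exists d; rewrite -dE sE; congr qz.
  by rewrite -mulrzr mulfK// pnatr_eq0 -lt0n.
pose d a := projT1 (cid (H a)).
have dP a : bG x (g a) = qz ((d a)%:~R / (p ^ e a)%:R) by exact: projT2 (cid (H a)).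
exists d; apply: bG_inj => z; have [c ->] := gen z.
rewrite bG_kg bGC bG_suml qz_sum; apply: eq_bigr => a _.
by rewrite bGMzl bGC dP -qzMz -mulrzl mulrCA.
Qed.

Lemma k_rel (d : 'I_r -> int) : \sum_a k a *~ d a = 0 ->
  forall a, (pz (e a) %| d a)%Z.
Proof.
move=> d0 a; rewrite -int_div_nat//; apply/qz_eq0.
have := bG_kg d (fun b => (b == a)%:Z); rewrite d0 bG0l => /esym.
rewrite (bigD1 a)//= eqxx big1 ?addr0 ?mul1r// => b /negbTE ->.
by rewrite mul0r mulr0.
Qed.

(** Symmetry of the pairing at k_a and k_b, where its value is theta_ba / p^(e a). *)
Lemma theta_sym a b : (pz (e a + e b) %|
  pz (e a) * theta a b - pz (e b) * theta b a)%Z.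
Proof.
have : qz ((theta b a)%:~R / (p ^ e a)%:R) = qz ((theta a b)%:~R / (p ^ e b)%:R).
  by rewrite -kP -kP -!kE bGC.
move/esym/qzP; rewrite -(int_div_nat _ (_ : 0 < p ^ (e a + e b))%N) ?expn_gt0 ?prime_gt0//.
congr (_ \is a Num.int); rewrite intrB !intrM expnD natrM.
rewrite -[(pz (e a))%:~R]/((p ^ e a)%:R : rat) -[(pz (e b))%:~R]/((p ^ e b)%:R : rat).
by field; rewrite !pnatr_eq0 -!lt0n !pe0.
Qed.

(** The k_a generate G as the g_a do, and coordinates with respect to g are unique modulo p since e
    a > 0; so expressing g through k yields an inverse of theta modulo p. *)
Lemma theta_unit : \matrix_(a, b) ((theta a b)%:~R : 'F_p) \in unitmx.
Proof.
pose D a := projT1 (cid (k_gen (g a))).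
have DE a : g a = \sum_b k b *~ D a b by exact: projT2 (cid (k_gen (g a))).
suff H : (\matrix_(a, b) ((D a b)%:~R : 'F_p)) *m \matrix_(a, b) ((theta a b)%:~R : 'F_p) = 1%:M.
  by have [_] := mulmx1_unit H.
apply/matrixP => a c; rewrite !mxE.
have : \sum_b g b *~ (b == a)%:Z = \sum_b g b *~ (\sum_i D a i * theta i b).
  transitivity (g a).
    rewrite (bigD1 a)//= eqxx big1 ?addr0// => b /negbTE ->.
    by rewrite mulr0z.
  rewrite {1}DE; under eq_bigr do rewrite kE mulrz_suml.
  rewrite exchange_big; apply: eq_bigr => b _ /=.
  by rewrite mulrz_sumr; apply: eq_bigr => i _; rewrite mulrC mulrzA.
move=> /rel_eq/(_ c) H.
have : (p%:Z %| (c == a)%:Z - \sum_i D a i * theta i c)%Z.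
  apply: dvdz_trans H; rewrite dvdzE /= -{1}(expn1 p).
  exact: dvdn_exp2l.
move=> /dvdzP[z /(congr1 (fun x : int => x%:~R : 'F_p))].
rewrite intrB intrM -[X in _ = _ * X]/(p%:R) pchar_Fp_0// mulr0 => /subr0_eq.
rewrite raddf_sum /= => E; rewrite eq_sym.
transitivity ((c == a)%:Z%:~R : 'F_p); last by case: (c == a).
by rewrite E; apply: eq_bigr => i _; rewrite !mxE intrM.
Qed.

Let E := (\sum_a e a)%N.
Let eE a : (e a <= E)%N. Proof. by rewrite /E (bigD1 a)//= leq_addr. Qed.
Let pp j : (0 < p ^ j)%N. Proof. by rewrite expn_gt0 prime_gt0. Qed.
Let ppz j : pz j != 0. Proof. by rewrite -lt0n. Qed.
Let pE a : pz E = pz (e a) * pz (E - e a).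
Proof. by rewrite -PoszM -expnD subnKC. Qed.

Lemma ppower_kills (x : G) : x *~ pz E = 0.
Proof.
have [c ->] := gen x; rewrite mulrz_suml.
under eq_bigr do rewrite -mulrzA; apply/rel => a.
by rewrite (pE a) mulrCA dvdz_mulr.
Qed.

Definition hom n (z : 'rV[G]_n) (v : 'cV[int]_n) : G := \sum_i z 0 i *~ v i 0.

Lemma hom_is_zmod_morphism n (z : 'rV[G]_n) : zmod_morphism (hom z).
Proof.
by move=> u v; rewrite /hom -sumrB; apply: eq_bigr => i _; rewrite !mxE mulrzBr.
Qed.

HB.instance Definition _ n (z : 'rV[G]_n) :=
  GRing.isZmodMorphism.Build 'cV[int]_n G (hom z) (hom_is_zmod_morphism z).

Definition images n (y : 'M[int]_(r, n)) : 'rV[G]_n := \row_i \sum_a g a *~ y a i.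

Lemma hom_images n (y : 'M[int]_(r, n)) v :
  hom (images y) v = \sum_a g a *~ (y *m v) a 0.
Proof.
rewrite /hom; under eq_bigr do rewrite mxE mulrz_suml.
rewrite exchange_big; apply: eq_bigr => a _ /=; rewrite mxE mulrz_sumr.
by apply: eq_bigr => i _; rewrite mulrzA.
Qed.

(** If y M has rows p^(e a) H_a, then M y_a^T = p^(e a) H_a^T, so H_a^T pairs with v to y_a v / p^(e
    a), exactly as k_a does with the image of v. The pairing thus asks H_a^T to be sent to k_a, that
    is (H y^T)_ab = theta_ab modulo p^(e b); times p^(e a), this is the second condition. *)
Definition int_cond n (y : 'M[int]_(r, n)) (M : 'M[int]_n) : Prop :=
  (forall a i, (pz (e a) %| (y *m M) a i)%Z) /\
  (forall a b, (pz (e a + e b) %|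
     (y *m M *m y^T) a b - pz (e a) * theta a b)%Z).

Definition corank_cond n (M : 'M[int]_n) : Prop :=
  (n - \rank (map_mx intr M : 'M['F_p]_n))%N = r.

Definition compatible n (M : 'M[int]_n) (z : 'rV[G]_n)
    (f : {additive sylow p (cok M) -> G}) : Prop :=
  [/\ bijective f, forall x x', bG (f x) (f x') = sylow_pairing x x' &
      forall x v, sylow_val x = cok_class M v -> f x = hom z v].

Section quotient.
Variables (n : nat) (M : 'M[int]_n) (y H : 'M[int]_(r, n)).
Hypothesis yM : forall a i, (y *m M) a i = pz (e a) * H a i.

Lemma hom_imagesM s : hom (images y) (M *m s) = 0.
Proof.
rewrite hom_images; apply/rel => a; rewrite mulmxA mxE.
by apply: dvdz_sum => i; rewrite yM -mulrA dvdz_mulr.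
Qed.

Hypothesis Hy : forall a b, (pz (e b) %| (H *m y^T) a b - theta a b)%Z.

Lemma hom_images_dual d : hom (images y) (H^T *m d) = \sum_a k a *~ d a 0.
Proof.
rewrite hom_images; under [RHS]eq_bigr do rewrite kE mulrz_suml.
rewrite exchange_big /=.
under [RHS]eq_bigr do (under eq_bigr do rewrite -mulrzA; rewrite -mulrz_sumr).
apply/rel_eq => b; rewrite mulmxA mxE -sumrB.
apply: dvdz_sum => a; rewrite -mulrBl dvdz_mulr//.
have -> : (y *m H^T) b a = (H *m y^T) a b by rewrite -[in LHS](trmxK y) -trmx_mul mxE.
exact: Hy.
Qed.

Let intrp : {rmorphism int -> 'F_p} := intr.
Local Notation "A ^p" := (map_mx intrp A) (at level 2, format "A ^p").

Lemma reduced_kernel : y^p *m M^p = 0.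
Proof.
rewrite -map_mxM; apply/matrixP => a i; rewrite mxE yM [RHS]mxE; apply: (dvdp_Fp p_pr).
by rewrite dvdz_mulr// dvdzE /= dvdn_exp.
Qed.

Lemma reduced_dual_unit : H^p *m (y^p)^T \in unitmx.
Proof.
rewrite map_trmx -map_mxM.
suff -> : map_mx intrp (H *m y^T) = \matrix_(a, b) ((theta a b)%:~R : 'F_p).
  exact: theta_unit.
apply/matrixP => a b; rewrite mxE [RHS]mxE; apply/subr0_eq; rewrite -rmorphB /=.
by apply: (dvdp_Fp p_pr); apply: dvdz_trans (Hy a b); rewrite dvdzE /= dvdn_exp.
Qed.

Hypothesis symM : M^T = M.

Lemma mul_dual (d : 'cV[int]_r) : M *m (y^T *m d) =
  H^T *m \col_a (pz (e a) * d a 0) :> 'cV[int]_n.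
Proof.
rewrite mulmxA -{1}symM -trmx_mul; apply/matrixP => i j; rewrite !mxE.
apply: eq_bigr => a _; rewrite [(y *m M)^T i a]mxE yM !mxE (ord1 j).
by rewrite mulrCA mulrA.
Qed.

Lemma mul_dual_ppower (d : 'cV[int]_r) : M *m (y^T *m \col_a (pz (E - e a) * d a 0)) =
  (H^T *m d) *~ pz E :> 'cV[int]_n.
Proof.
rewrite mul_dual -mulmxMz; congr (_ *m _); apply/matrixP => a j.
by rewrite -[d *~ _]scaler_int intz !mxE (ord1 j) mulrA -pE.
Qed.

(** Modulo p the columns of M and H^T generate the whole space. Lifting a right inverse gives a
    matrix congruent to 1 modulo p, and its adjugate turns it into a scalar m prime to p: up to m,
    the H_a^T generate the cokernel. *)
Lemma corank_split : corank_cond M ->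
  exists (m : int) (X : 'M[int]_n) (X' : 'M[int]_(r, n)),
    ~~ (p%:Z %| m)%Z /\ M *m X + H^T *m X' = m%:M.
Proof.
move=> cM; have := corank_row_free reduced_kernel reduced_dual_unit cM.
move=> /row_freeP[Z ZE].
pose lf (A : 'F_p) : int := (A : nat)%:Z.
have lfK A : intrp (lf A) = A by rewrite /intrp /lf /= -pmulrn natr_Zp.
pose X := map_mx lf (usubmx Z); pose X' := map_mx lf (dsubmx Z).
pose B := M *m X + H^T *m X'.
have B1 : B^p = 1%:M.
  rewrite -ZE -[Z]vsubmxK mul_row_col /B map_mxD !map_mxM map_trmx.
  have lfKm a b (A : 'M['F_p]_(a, b)) : (map_mx lf A)^p = A.
    by apply/matrixP => i j; rewrite !mxE lfK.
  by rewrite !lfKm.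
exists (\det B), (X *m \adj B), (X' *m \adj B); split.
  apply/negP => /(dvdp_Fp p_pr); rewrite -[_%:~R]/(intrp (\det B)) -det_map_mx B1 det1.
  by apply/eqP; rewrite oner_eq0.
by rewrite !mulmxA -mulmxDl mul_mx_adj.
Qed.

Section split_facts.
Variables (m : int) (X : 'M[int]_n) (X' : 'M[int]_(r, n)).
Hypothesis pm : ~~ (p%:Z %| m)%Z.
Hypothesis XX : M *m X + H^T *m X' = m%:M.

Let XXv (v : 'cV[int]_n) : v *~ m = M *m (X *m v) + H^T *m (X' *m v).
Proof. by rewrite !mulmxA -mulmxDl XX mul_scalar_mx -scaler_int intz. Qed.

Lemma split_torsion (v : 'cV[int]_n) :
  exists s, v *~ (m * pz E) = M *m s.
Proof.
rewrite mulrzA XXv mulrzDl -mul_dual_ppower -mulmxMz -mulmxDr.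
by eexists.
Qed.

Lemma split_det : \det M != 0.
Proof.
have : exists Z, M *m Z = (m * pz E)%:M.
  pose s i := projT1 (cid (split_torsion (delta_mx i 0))).
  exists (\matrix_(i, j) s j i 0); apply/matrixP => i j.
  have := congr1 (fun A : 'cV[int]_n => A i 0) (projT2 (cid (split_torsion (delta_mx j 0)))).
  rewrite -/(s j) !mxE => H1; transitivity ((M *m s j) i 0).
    by rewrite !mxE; apply: eq_bigr => h _; rewrite !mxE.
  rewrite mxE -H1 -scaler_int !mxE intz eqxx andbT.
  by rewrite mulr_natr.
move=> [Z MZ]; apply/eqP => d0.
have := congr1 (fun A => \det A) MZ; rewrite det_mulmx d0 mul0r det_scalar => /esym/eqP.
rewrite expf_eq0 mulf_eq0 (negbTE (ppz _)) orbF => /andP[_ /eqP m0].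
by move: pm; rewrite m0 dvdz0.
Qed.

(** Modulo col(M), m v is a combination of the H_a^T and is sent to the same combination of the k_a.
    If that is 0, its coefficients are divisible by p^(e a), and p^(e a) H_a^T lies in col(M). *)
Lemma split_kernel (v : 'cV[int]_n) : hom (images y) v = 0 ->
  exists s, v *~ m = M *m s.
Proof.
move=> v0; have : hom (images y) (v *~ m) = 0 by rewrite raddfMz /= v0 mul0rz.
rewrite XXv raddfD /= hom_imagesM add0r hom_images_dual => /k_rel H1.
pose d : 'cV[int]_r := \col_a ((X' *m v) a ord0 %/ pz (e a))%Z.
have dE : X' *m v = \col_a (pz (e a) * d a 0).
  apply/matrixP => a j; rewrite (ord1 j) [RHS]mxE [X in _ * X]mxE mulrC divzK//.
exists (X *m v + y^T *m d).
by rewrite mulmxDr mul_dual -dE.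
Qed.

(** The difference of the two sides is killed by m and by p^(E+j), which are coprime. For m, the
    vector m v is expressed through M and H^T, denominators are cleared by p^E, and preimages under
    M are compared, M being injective by [split_det]. *)
Lemma split_pairing (v v' s : 'cV[int]_n) j : M *m s = v *~ pz j ->
  bG (hom (images y) v) (hom (images y) v') = qz ((dot s v')%:~R / (p ^ j)%:R).
Proof.
move=> sv; apply/subr0_eq; apply: (coprimez_torsion (coprimez_ppower (E + j) p_pr pm)).
  rewrite mulrzBl -bGMzl// -qzMz -raddfMz /= XXv raddfD /= hom_imagesM add0r.
  rewrite hom_images_dual [hom _ v']hom_images bG_kg -qzB; apply/qz_eq0.
  set d := X' *m v; set u := X *m v; pose D : 'cV[int]_r := \col_a (pz (E - e a) * d a 0).
  have key : s *~ (m * pz E) = (u *~ pz E + y^T *m D) *~ pz j.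
    apply: (det_neq0_inj split_det); rewrite !mulmxMz mulmxDr mul_dual_ppower mulmxMz.
    by rewrite -mulrzDl -XXv sv -!mulrzA; congr (v *~ _); ring.
  have := congr1 (fun t : 'cV[int]_n => dot t v') key.
  have dotMz t z : dot (t *~ z) v' = z * dot t v'.
    by rewrite /dot -scaler_int intz linearZ/= -scalemxAl mxE.
  rewrite !dotMz; have -> : dot (u *~ pz E + y^T *m D) v' =
      pz E * dot u v' + \sum_a pz (E - e a) * (d a 0 * (y *m v') a 0).
    rewrite -dotMz /dot linearD/= mulmxDl [LHS]mxE; congr (_ + _).
    rewrite trmx_mul trmxK -mulmxA mxE; apply: eq_bigr => a _.
    by rewrite !mxE mulrA.
  move=> /(congr1 (fun z : int => z%:~R : rat)).
  rewrite !intrM intrD intrM rmorph_sum /= => K.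
  have P0 i : (p ^ i)%:R != 0 :> rat by rewrite pnatr_eq0 -lt0n.
  suff -> : \sum_a (d a 0)%:~R * (((y *m v') a 0)%:~R / (p ^ e a)%:R) -
      ((dot s v')%:~R / (p ^ j)%:R) *~ m = - (dot u v')%:~R :> rat.
    by rewrite rpredN; apply/intrP; exists (dot u v').
  have -> : \sum_a (d a 0)%:~R * (((y *m v') a 0)%:~R / (p ^ e a)%:R) =
      (\sum_a (pz (E - e a) * (d a 0 * (y *m v') a 0))%:~R) / (p ^ E)%:R :> rat.
    rewrite mulr_suml; apply: eq_bigr => a _; rewrite !intrM.
    have -> : (p ^ E)%:R = (p ^ e a)%:R * (p ^ (E - e a))%:R :> rat.
      by rewrite -natrM -expnD subnKC.
    rewrite -[(pz (E - e a))%:~R]/((p ^ (E - e a))%:R : rat).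
    by field; rewrite !P0.
  move: K; rewrite -![(pz _)%:~R]/((p ^ _)%:R : rat).
  set S := \sum_a _; set x := (dot s v')%:~R; set x' := (dot u v')%:~R => K.
  apply: (mulfI (P0 (E + j)%N)); rewrite expnD natrM -mulrzl.
  rewrite mulrBr mulrN.
  have -> : (p ^ E)%:R * (p ^ j)%:R * (S / (p ^ E)%:R) = (p ^ j)%:R * S :> rat.
    by field; rewrite P0.
  have -> : (p ^ E)%:R * (p ^ j)%:R * (m%:~R * (x / (p ^ j)%:R)) =
      m%:~R * (p ^ E)%:R * x :> rat by field; rewrite P0.
  by rewrite K; ring.
rewrite mulrzBl expnD PoszM mulrzA -bGMzl// ppower_kills bG0l// mul0rz sub0r.
rewrite [pz E * _]mulrC mulrzA -qzMz -mulrzr -[X in _ * X]/((p ^ j)%:R : rat).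
rewrite divfK ?pnatr_eq0 -?lt0n//.
have -> : qz (dot s v')%:~R = 0 by apply/qz_eq0/intrP; exists (dot s v').
by rewrite mul0rz oppr0.
Qed.

End split_facts.

End quotient.

Definition dual_rows n (y : 'M[int]_(r, n)) (M : 'M[int]_n) : 'M[int]_(r, n) :=
  \matrix_(a, i) ((y *m M) a i %/ pz (e a))%Z.

Lemma dual_rowsE n (y : 'M[int]_(r, n)) (M : 'M[int]_n) :
  (forall a i, (pz (e a) %| (y *m M) a i)%Z) ->
  forall a i, (y *m M) a i = pz (e a) * dual_rows y M a i.
Proof. by move=> H a i; rewrite [dual_rows _ _ _ _]mxE mulrC divzK. Qed.

Lemma dual_rows_cond n (y : 'M[int]_(r, n)) (M : 'M[int]_n) :
  (forall a i, (pz (e a) %| (y *m M) a i)%Z) ->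
  (forall a b, (pz (e a + e b) %|
     (y *m M *m y^T) a b - pz (e a) * theta a b)%Z) <->
  (forall a b, (pz (e b) %| (dual_rows y M *m y^T) a b - theta a b)%Z).
Proof.
move=> H.
have E1 a b : (pz (e a + e b) %|
     (y *m M *m y^T) a b - pz (e a) * theta a b)%Z =
   (pz (e b) %| (dual_rows y M *m y^T) a b - theta a b)%Z.
  rewrite -[RHS](@dvdz_mul2l (pz (e a)))// -PoszM -expnD mulrBr.
  congr (_ %| _ - _)%Z; rewrite mxE [X in _ * X]mxE mulr_sumr; apply: eq_bigr => i _.
  by rewrite (dual_rowsE H) mulrA.
by split=> K a b; have := K a b; rewrite E1.
Qed.

Lemma cond_compatible n (y : 'M[int]_(r, n)) (M : 'M[int]_n) : M^T = M ->
  int_cond y M -> corank_cond M ->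
  \det M != 0 /\ exists f : {additive sylow p (cok M) -> G}, compatible (images y) f.
Proof.
move=> Ms [c1 c2] cM; have yM := dual_rowsE c1; have Hy := (dual_rows_cond c1).1 c2.
have [m [X [X' [pm XX]]]] := corank_split yM Hy cM.
split; first exact (split_det yM Ms pm XX).
pose f (x : sylow p (cok M)) := hom (images y) (projT1 (cid (sylow_lift x))).
have fP x v : sylow_val x = cok_class M v -> f x = hom (images y) v.
  move=> xv; have /cok_classP[s ws] := etrans (esym xv) (projT2 (cid (sylow_lift x))).
  by apply/eqP; rewrite eq_sym -subr_eq0 -raddfB /= ws (hom_imagesM yM).
have fadd : zmod_morphism f.
  move=> x x'; have [v xv] := sylow_lift x; have [v' xv'] := sylow_lift x'.
  rewrite (fP x v)// (fP x' v')// -raddfB /=; apply: fP.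
  have -> : sylow_val (x - x') = sylow_val x - sylow_val x' by [].
  by rewrite xv xv' /cok_class raddfB.
pose fA : {additive sylow p (cok M) -> G} :=
  HB.pack f (GRing.isZmodMorphism.Build _ _ f fadd).
have finj : injective fA.
  apply: raddf_inj => x; have [v xv] := sylow_lift x; rewrite /= (fP x v)//.
  move=> /(split_kernel yM Hy Ms XX)[s vs]; apply: val_inj; rewrite /= xv.
  have [s' [j vj]] := sylow_class xv.
  apply: (coprimez_torsion (coprimez_ppower j p_pr pm)); rewrite -cok_classMz.
    by apply/cok_class_eq0; exists s.
  by apply/cok_class_eq0; exists s'.
have fsurj x : exists z, fA z = x.
  have [d ->] := k_gen x.
  have := mul_dual_ppower yM Ms (\col_a d a) => /ppower_torsion_sylow[z zE].
  exists z; rewrite /= (fP _ _ zE) (hom_images_dual Hy).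
  by apply: eq_bigr => a _; rewrite mxE.
exists fA; split=> //.
  exists (fun x => projT1 (cid (fsurj x))) => x; last exact: projT2 (cid (fsurj x)).
  by apply: finj; exact: projT2 (cid (fsurj (fA x))).
move=> x x'; have [v xv] := sylow_lift x; have [v' xv'] := sylow_lift x'.
have [s [j sv]] := sylow_class xv.
rewrite /= (fP x v)// (fP x' v')// (sylow_pairing_formula p_pr Ms xv xv' sv).
exact (split_pairing yM Hy Ms pm XX v' sv).
Qed.

(** The class of H_a^T is p-power torsion and pairs as k_a does, so nondegeneracy forces its image
    to be k_a. For the corank, subtracting from v a combination of the H_a^T with the same image
    leaves a w such that m w has a class in the kernel of [f]; injectivity puts m v into col(M) plus
    the span of the H_a^T. *)
Lemma compatible_cond n (y : 'M[int]_(r, n)) (M : 'M[int]_n)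
    (f : {additive sylow p (cok M) -> G}) : M^T = M -> \det M != 0 ->
  compatible (images y) f -> int_cond y M /\ corank_cond M.
Proof.
move=> Ms dM [[fi ffi fif] fp fh].
have h0 s : hom (images y) (M *m s) = 0.
  rewrite -(fh 0) ?raddf0//=; apply/esym/cok_class_eq0; by exists s.
have c1 a i : (pz (e a) %| (y *m M) a i)%Z.
  have := h0 (delta_mx i 0); rewrite hom_images => /rel/(_ a).
  by rewrite mulmxA -colE mxE.
have yM := dual_rowsE c1; set H := dual_rows y M in yM.
have Hk a : hom (images y) (H^T *m delta_mx a 0) = k a.
  have tor : M *m (y^T *m delta_mx a 0) = (H^T *m delta_mx a 0) *~ pz (e a) :> 'cV[int]_n.
    rewrite (mul_dual yM Ms) -mulmxMz; congr (_ *m _); apply/matrixP => b j.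
    rewrite -scaler_int intz !mxE (ord1 j) eqxx andbT.
    by case: eqP => [->|_]; rewrite ?mulr0.
  have [x xE] := ppower_torsion_sylow tor; rewrite -(fh x)//.
  apply: bG_inj => z; rewrite -(fif z) fp.
  have [v' xv'] := sylow_lift (fi z); rewrite (sylow_pairing_formula p_pr Ms xE xv' tor).
  rewrite (fh _ _ xv') hom_images kP; congr (qz (_%:~R / _)).
  by rewrite /dot trmx_mul trmxK -mulmxA trmx_delta -rowE mxE.
have Hy : forall a b, (pz (e b) %| (H *m y^T) a b - theta a b)%Z.
  move=> a b; have := Hk a; rewrite hom_images kE => /rel_eq/(_ b).
  by rewrite mulmxA -colE mxE -[in y *m _](trmxK y) -trmx_mul mxE.
split; first by split=> //; exact/(dual_rows_cond c1).
have [u [m [W [pm MW]]]] := det_split p_pr dM.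
have XX v : exists s : 'cV[int]_n * 'cV[int]_r, M *m s.1 + H^T *m s.2 = v *~ m.
  have [d dE] := k_gen (hom (images y) v).
  pose w := v - H^T *m \col_a d a.
  have w0 : hom (images y) w = 0.
    rewrite raddfB /= dE (hom_images_dual Hy) -sumrB big1// => a _.
    by rewrite mxE subrr.
  have tor : M *m (W *m w) = (w *~ m) *~ pz u.
    by rewrite mulmxA MW mul_scalar_mx -mulrzA mulrC -scaler_int intz.
  have [x xE] := ppower_torsion_sylow tor.
  have : f x = f 0 by rewrite raddf0 (fh _ _ xE) raddfMz /= w0 mul0rz.
  move=> /(can_inj ffi) x0; move: xE; rewrite x0 => /esym/cok_class_eq0[s wm].
  exists (s, (\col_a d a) *~ m); rewrite /= -wm mulmxMz -mulrzDl.
  by rewrite /w subrK.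
pose s i := projT1 (cid (XX (delta_mx i 0))).
have sE i : M *m (s i).1 + H^T *m (s i).2 = delta_mx i 0 *~ m := projT2 (cid (XX (delta_mx i 0))).
pose X := \matrix_(i, j) (s j).1 i ord0; pose X' := \matrix_(i, j) (s j).2 i ord0.
have XE : M *m X + H^T *m X' = m%:M.
  apply/matrixP => i j; have /matrixP/(_ i 0) := sE j.
  rewrite -scaler_int intz !mxE eqxx andbT mulr_natr => <-.
  by congr (_ + _); apply: eq_bigr => h _; rewrite !mxE.
apply: (row_free_corank (reduced_kernel yM) (reduced_dual_unit Hy)).
have m0 : m%:~R != 0 :> 'F_p by apply: contra pm => /eqP/(Fp_dvdp p_pr).
apply/row_freeP; exists ((m%:~R)^-1 *: map_mx intr (col_mx X X')).
rewrite -scalemxAr map_col_mx mul_row_col map_trmx -!map_mxM -map_mxD XE map_scalar_mx /=.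
by rewrite scale_scalar_mx mulVf.
Qed.

Section automorphisms.
Variables (n : nat) (M : 'M[int]_n).
Hypothesis dM : \det M != 0.

(** The part m of det M that is prime to p moves every class into the Sylow subgroup. *)
Lemma unit_class_sylow : exists (m : int) (x : 'I_n -> sylow p (cok M)),
  ~~ (p%:Z %| m)%Z /\ forall i, sylow_val (x i) = cok_class M (delta_mx i 0 *~ m).
Proof.
have [u [m [W [pm MW]]]] := det_split p_pr dM; exists m.
have H i : exists x : sylow p (cok M), sylow_val x = cok_class M (delta_mx i 0 *~ m).
  apply: (@ppower_torsion_sylow _ _ _ _ (W *m delta_mx i 0) u).
  by rewrite mulmxA MW mul_scalar_mx -mulrzA mulrC -scaler_int intz.
exists (fun i => projT1 (cid (H i))); split=> // i.
exact: projT2 (cid (H i)).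
Qed.

(** The image z_i of a unit vector is found by applying [f] to m times its class and dividing by m
    in G, with an inverse m' of m modulo p^E. *)
Lemma iso_compatible (f : {additive sylow p (cok M) -> G}) : bijective f ->
  (forall x x', bG (f x) (f x') = sylow_pairing x x') ->
  exists z, compatible z f.
Proof.
move=> fb fp; have [m [x [pm xE]]] := unit_class_sylow.
have /coprimezP[[m' t] /= mt] := coprimez_ppower E p_pr pm.
exists (\row_i (f (x i) *~ m')); split=> // w v wv.
have -> : hom (\row_i (f (x i) *~ m')) v = f (\sum_i x i *~ v i 0) *~ m'.
  rewrite raddf_sum /= mulrz_suml; apply: eq_bigr => i _.
  by rewrite mxE raddfMz /= mulrzAC.
have -> : \sum_i x i *~ v i 0 = w *~ m.
  apply: val_inj; rewrite raddf_sum /= sylow_valMz wv -cok_classMz.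
  under eq_bigr do rewrite sylow_valMz xE -cok_classMz.
  rewrite -(big_morph (cok_class M) (@cok_classD _ M) (cok_class0 M)).
  congr cok_class; apply/matrixP => i j; rewrite summxE (bigD1 i)//= big1.
    by rewrite addr0 -!scaler_int !mxE !intz (ord1 j) !eqxx mulr1 mulrC.
  by move=> h /negbTE hi; rewrite -!scaler_int !mxE eq_sym hi !mulr0.
rewrite raddfMz /= -mulrzA -[LHS]mulr1z -mt mulrzDr [t * _]mulrC [f w *~ (_ * t)]mulrzA.
by rewrite ppower_kills mul0rz addr0 mulrC.
Qed.

(** Two isomorphisms differ by a pairing-preserving automorphism of G, and z and [f] determine each
    other, since m z_i is a value of [f] and m is invertible on G. *)
Lemma card_compatible (f0 : {additive sylow p (cok M) -> G}) : bijective f0 ->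
  (forall x x', bG (f0 x) (f0 x') = sylow_pairing x x') ->
  #|[set z | `[< exists f : {additive sylow p (cok M) -> G}, compatible z f >]]%SET| =
  #|pairing_Aut bG|.
Proof.
move=> f0b f0p; have [z0 [_ _ z0f]] := iso_compatible f0b f0p.
have [f0i f0K f0iK] := f0b.
have autD (a : {perm G}) : a \in pairing_Aut bG -> {morph a : x y / x + y}.
  rewrite inE => /andP[/Aut_morphic/morphicP aM _] x y.
  by have := aM x y (finset.in_setT _) (finset.in_setT _).
have autB (a : {perm G}) : a \in pairing_Aut bG -> zmod_morphism a.
  by move=> /autD aD x y; apply/eqP; rewrite eq_sym subr_eq -aD subrK.
pose aA a (aP : a \in pairing_Aut bG) : {additive G -> G} :=
  HB.pack (a : G -> G) (GRing.isZmodMorphism.Build _ _ (a : G -> G) (autB a aP)).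
have homa a (aP : a \in pairing_Aut bG) v : hom (map_mx a z0) v = a (hom z0 v).
  rewrite -[a (hom _ _)]/(aA a aP (hom z0 v)) /hom raddf_sum; apply: eq_bigr => i _.
  by rewrite mxE raddfMz.
have inj : {in pairing_Aut bG &, injective (fun a : {perm G} => map_mx a z0)}.
  move=> a b aP bP ab; apply/permP => x; rewrite -(f0iK x).
  have [v xv] := sylow_lift (f0i x); rewrite (z0f _ _ xv).
  by rewrite -(homa a aP) -(homa b bP) ab.
rewrite -(card_in_imset inj); apply: eq_card => z; rewrite inE.
apply/asboolP/imsetP => [[f [fb fp zf]]|[a aP ->]].
  have [fi fK fiK] := fb; pose h x := f (f0i x).
  have hinj : injective h.
    by move=> x y /(can_inj fK)/(can_inj f0iK).
  have hD : {morph h : x y / x + y}.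
    move=> x y; rewrite /h -raddfD; congr (f _); apply: (can_inj f0K).
    by rewrite raddfD /= !f0iK.
  pose a : {perm G} := perm hinj.
  have aP : a \in pairing_Aut bG.
    rewrite inE; apply/andP; split.
      rewrite inE; apply/andP; split; first by apply/fintype.subsetP => x _; rewrite inE.
      apply/morphicP => x y _ _; rewrite !permE; exact: hD.
    apply/forallP => x; apply/forallP => y; rewrite !permE /h fp -f0p !f0iK.
    exact: eqxx.
  exists a => //; apply/rowP => i; have [m [x [pm xE]]] := unit_class_sylow.
  apply/subr0_eq; apply: (coprimez_torsion (coprimez_ppower E p_pr pm)); last exact: ppower_kills.
  have delta z1 : hom z1 (delta_mx i 0) = z1 0 i.
    rewrite /hom (bigD1 i)//= big1 ?addr0 => [|j /negbTE ji]; rewrite !mxE ?eqxx ?mulr1z//.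
    by rewrite ji mulr0z.
  rewrite mulrzBl -!delta -!raddfMz /= (homa a aP) -(zf _ _ (xE i)) -(z0f _ _ (xE i)).
  by rewrite permE /h f0K subrr.
have [aAut /forallP ap] : a \in Aut [set: G]%SET /\ [forall x, forall y, bG (a x) (a y) == bG x y].
  by move: aP; rewrite inE => /andP.
have hB : zmod_morphism (a \o f0) by move=> x y; rewrite /= raddfB (autB a aP).
pose f : {additive sylow p (cok M) -> G} :=
  HB.pack (a \o f0) (GRing.isZmodMorphism.Build _ _ (a \o f0) hB).
exists f; split.
- exact: bij_comp (injF_bij perm_inj) f0b.
- by move=> x y; rewrite /= (eqP (forallP (ap _) _)) f0p.
- by move=> x v xv; rewrite /= (z0f _ _ xv) homa.
Qed.

End automorphisms.

(** * Counting homomorphisms modulo q *)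

Variables (R : realType) (l : nat).
Hypothesis cardG : #|G| = (\prod_a p ^ e a)%N.
Hypothesis el2 : forall a b, (e a + e b <= l.+1)%N.

Local Notation q := (p ^ l.+1)%N.
Local Notation q1 := (prime_power_gt1 l p_pr).
Local Notation red := (red l p_pr).

Let el a : (e a <= l.+1)%N. Proof. exact: leq_trans (leq_addr _ _) (el2 a a). Qed.

(* [weight1 a * x = 0] says that [p ^ e a] divides [x], and [weight2 a b * x = 0]
   that [p ^ (e a + e b)] does. *)
Definition weight1 (a : 'I_r) : 'Z_q := (p ^ (l.+1 - e a))%:R.
Definition weight2 (a b : 'I_r) : 'Z_q := (p ^ (l.+1 - (e a + e b)))%:R.
Definition target (a b : 'I_r) : 'Z_q := (pz (e a) * theta a b)%:~R.

Definition int_lift m n (A : 'M['Z_q]_(m, n)) : 'M[int]_(m, n) :=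
  map_mx (fun x : 'Z_q => (x : nat)%:Z) A.

Lemma int_liftK m n (A : 'M['Z_q]_(m, n)) : map_mx intr (int_lift A) = A.
Proof. by apply/matrixP => i j; rewrite !mxE Zq_lift. Qed.

Lemma red_intr m n (A : 'M[int]_(m, n)) :
  map_mx red (map_mx intr A) = map_mx intr A :> 'M['F_p]_(m, n).
Proof. by apply/matrixP => i j; rewrite !mxE rmorph_int. Qed.

Lemma weight1_red a x : weight1 a * x = 0 -> red x = 0.
Proof.
rewrite -(Zq_lift x) => /eqP; rewrite Zq_natmul_eq0// => px.
rewrite rmorph_int; apply: (dvdp_Fp p_pr); apply: dvdz_trans px.
by rewrite dvdzE /= dvdn_exp.
Qed.

Lemma quad_cond_int n (y : 'M[int]_(r, n)) (M : 'M[int]_n) :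
  quad_cond weight1 weight2 target (map_mx intr y) (map_mx intr M) <->
  int_cond y M.
Proof.
rewrite /quad_cond -!map_mxM; split.
  move=> /andP[/forallP H1 /forallP H2]; split=> [a i|a b].
    by have /forallP/(_ a) := H1 i; rewrite mxE Zq_natmul_eq0.
  have := H2 (a, b); rewrite /= map_trmx -map_mxM mxE -intrB.
  by rewrite Zq_natmul_eq0.
move=> [H1 H2]; apply/andP; split.
  apply/forallP => i; apply/forallP => a; by rewrite mxE Zq_natmul_eq0.
apply/forallP => -[a b]; rewrite /= map_trmx -map_mxM mxE -intrB.
by rewrite Zq_natmul_eq0.
Qed.

(** The conditions make H Y^T congruent to theta modulo p, which is invertible. *)
Lemma quad_cond_full n (Y : 'M['Z_q]_(r, n)) M : M^T = M ->
  quad_cond weight1 weight2 target Y M -> row_free (map_mx red Y).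
Proof.
move=> _; rewrite -(int_liftK Y) -(int_liftK M) => /quad_cond_int[c1 c2].
have yM := dual_rowsE c1; have Hy := (dual_rows_cond c1).1 c2.
rewrite red_intr; apply: (dual_row_free (H := map_mx intr (dual_rows (int_lift Y) (int_lift M)))).
exact: (reduced_dual_unit Hy).
Qed.

Lemma kercard_corank n (M : 'M[int]_n) :
  (kercard p_pr (map_mx intr M : 'M['Z_q]_n) == p ^ r)%N <-> corank_cond M.
Proof.
rewrite kercardE red_intr eqn_exp2l ?prime_gt1//.
by split=> /eqP.
Qed.

Lemma mulrz_intr_lift a (z : int) : g a *~ ((z%:~R : 'Z_q) : nat)%:Z = g a *~ z.
Proof.
apply/eqP; rewrite -subr_eq0 -mulrzBr; apply/eqP.
have -> : g a *~ (((z%:~R : 'Z_q) : nat)%:Z - z) =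
    \sum_b g b *~ (if b == a then ((z%:~R : 'Z_q) : nat)%:Z - z else 0).
  by rewrite (bigD1 a)//= eqxx big1 ?addr0// => b /negbTE ->; rewrite mulr0z.
apply/rel => b; case: eqP => [->|_]; last exact: dvdz0.
have : (q%:Z %| ((z%:~R : 'Z_q) : nat)%:Z - z)%Z.
  by rewrite -(intr_Zq_eq0 l p_pr) intrB Zq_lift subrr.
by apply: dvdz_trans; rewrite dvdzE /= dvdn_exp2l.
Qed.

(** The map from Y to the images of the unit vectors is a surjective homomorphism onto G^n, so its
    fibres have q^(r n) / |G|^n elements, and q^r = |G| A. *)
Lemma card_images n (z : 'rV[G]_n) :
  #|[pred Y : 'M['Z_q]_(r, n) | images (int_lift Y) == z]| =
  ((\prod_a #|annihilator weight1 a|) ^ n)%N.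
Proof.
pose f (Y : 'M['Z_q]_(r, n)) := images (int_lift Y).
have fE (y : 'M[int]_(r, n)) : f (map_mx intr y) = images y.
  apply/rowP => i; rewrite !mxE; apply: eq_bigr => a _.
  by rewrite !mxE mulrz_intr_lift.
have fadd : zmod_morphism f.
  move=> Y Y'; rewrite -{1}(int_liftK Y) -{1}(int_liftK Y') -map_mxB fE.
  apply/rowP => i; rewrite !mxE -sumrB; apply: eq_bigr => a _.
  by rewrite !mxE mulrzBr.
pose fA : {additive 'M['Z_q]_(r, n) -> 'rV[G]_n} :=
  HB.pack f (GRing.isZmodMorphism.Build _ _ f fadd).
have surj z' : exists Y, fA Y = z'.
  pose c i := projT1 (cid (gen (z' 0 i))).
  exists (map_mx intr (\matrix_(a, i) c i a)); rewrite [LHS]fE; apply/rowP => i.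
  rewrite mxE [RHS](projT2 (cid (gen (z' 0 i)))).
  by apply: eq_bigr => a _; rewrite mxE.
have := card_surj_fiber surj z; rewrite (card_mx_Zq l p_pr) card_mx mul1n cardG => H.
have G0 : (0 < (\prod_a p ^ e a) ^ n)%N.
  by rewrite expn_gt0 prodn_gt0// => a; rewrite expn_gt0 prime_gt0.
apply/eqP; rewrite -(eqn_pmul2r G0) [X in X == _]H -expnMn -big_split /=.
rewrite (eq_bigr (fun=> q)) => [|a _]; last first.
  by rewrite card_Zq_ann ?leq_subr// -expnD subnK.
by rewrite prod_nat_const card_ord expnM.
Qed.

(** The left side sees M modulo q only, yet its conditions force det M to be nonzero; this is why
    nonsingularity stands inside the indicator on the right. *)
Lemma weighted_count_iso n (M : 'M[int]_n) : M^T = M ->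
  weighted_count weight1 weight2 target (fun=> 1) (map_mx intr M : 'M['Z_q]_n) *
    (kercard p_pr (map_mx intr M : 'M['Z_q]_n) == p ^ r)%N%:R =
  (`[< \det M != 0 /\ pairing_isomorphic (@sylow_pairing p n M) bG >])%:R *
  (#|pairing_Aut bG|%:R * (\prod_a #|annihilator weight1 a|)%:R ^+ n) :> R.
Proof.
move=> Ms; pose Mq : 'M['Z_q]_n := map_mx intr M.
pose good (Y : 'M['Z_q]_(r, n)) := quad_cond weight1 weight2 target Y Mq &&
  (kercard p_pr Mq == p ^ r)%N.
have -> : weighted_count weight1 weight2 target (fun=> 1) Mq *
    (kercard p_pr Mq == p ^ r)%N%:R = #|[pred Y | good Y]|%:R :> R.
  rewrite /weighted_count mulr_suml -sum1_card natr_sum [RHS]big_mkcond /=.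
  apply: eq_bigr => Y _; rewrite mul1r inE /good.
  by case: quad_cond; case: (_ == _); rewrite ?mulr1 ?mulr0.
have goodP Y : good Y <-> \det M != 0 /\ exists f : {additive sylow p (cok M) -> G},
    compatible (images (int_lift Y)) f.
  rewrite /good -{1}(int_liftK Y); split.
    move=> /andP[/quad_cond_int c /kercard_corank cM].
    exact: cond_compatible.
  move=> [dM [f fc]].
  have [c cM] := compatible_cond Ms dM fc.
  by apply/andP; split; [exact/quad_cond_int|exact/kercard_corank].
case: asboolP => [[dM [f fb fp]]|nM]; last first.
  rewrite mul0r; case: (pickP (fun Y => good Y)) => [Y /goodP[dM [f [fb fp _]]]|no].
    by case: nM; split=> //; exists f.
  by rewrite eq_card0.
rewrite mul1r -natrX -natrM; congr _%:R.
rewrite -(card_compatible dM fb fp).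
rewrite -[LHS]sum1_card (partition_big (fun Y => images (int_lift Y))
  (mem [set z | `[< exists f : {additive sylow p (cok M) -> G}, compatible z f >]]%SET)) /=.
  rewrite -sum_nat_const; apply: eq_bigr => z; rewrite inE => /asboolP zf.
  rewrite sum1_card -(card_images z); apply: eq_card => Y; rewrite !inE.
  rewrite [in LHS]/in_mem /=; apply: andb_idl => /eqP Yz; apply/goodP.
  by rewrite Yz.
by move=> Y /goodP[_ fY]; rewrite inE; exact/asboolP.
Qed.

(** By [theta_sym] the conditions at (a, b) and (b, a) agree, and they imply the linear ones because
    p^(e a) divides both p^(e a + e b) and the target. The entries on and above the diagonal are
    then chosen independently. *)
Lemma corner_countE : corner_count weight1 weight2 target =
  (\prod_(u : upper_index r) p ^ (l.+1 - (e (val u).1 + e (val u).2)))%N.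
Proof.
pose S a b : {set 'Z_q} := [set x | weight2 a b * (x - target a b) == 0]%SET.
have w2C a b : weight2 a b = weight2 b a by rewrite /weight2 addnC.
have SE a b : S a b = S b a.
  apply/setP => x; rewrite !inE w2C; congr (_ == 0); apply/eqP; rewrite -subr_eq0 -mulrBr.
  rewrite opprB addrC addrA subrK -intrB Zq_natmul_eq0//.
  by rewrite theta_sym.
rewrite (eq_bigr (fun u : upper_index r => #|S (val u).1 (val u).2|)) => [|u _]; last first.
  rewrite -(card_Zq_ann p_pr (leq_subr (e (val u).1 + e (val u).2) l.+1)).
  rewrite -(card_imset _ (addIr (target (val u).1 (val u).2))).
  apply: eq_card => x; rewrite [RHS]inE; apply/imsetP/idP => [[t]|xS].
    by rewrite inE => t0 ->; rewrite addrK.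
  by exists (x - target (val u).1 (val u).2); rewrite ?inE// subrK.
rewrite -(card_sym_family SE); apply: eq_card => A; rewrite !inE.
case: eqP => //= At; rewrite /quad_cond trmx1 !mulmx1 mul1mx.
apply/andP/forallP => [[_ /forallP H] a|H].
  by apply/forallP => b; rewrite inE; exact: (H (a, b)).
split; last by apply/forallP => -[a b]; have /forallP/(_ b) := H a; rewrite inE.
apply/forallP => b; apply/forallP => a; have /forallP/(_ b) := H a; rewrite inE.
rewrite -(Zq_lift (A a b)) -intrB !Zq_natmul_eq0// => H1.
have : (pz (e a) %| (A a b : nat)%:Z - pz (e a) * theta a b)%Z.
  by apply: dvdz_trans H1; rewrite dvdzE /= dvdn_exp2l// leq_addr.
by rewrite rpredBr// dvdz_mulr.
Qed.

(** With S the sum of the e a, corner_count / symcount is p^(-(r+1) S) by [sum_upper_index], while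
    (q^r / A)^r is p^(r S). *)
Lemma quad_constE : quad_const R weight1 weight2 target = (#|G|%:R)^-1.
Proof.
rewrite /quad_const corner_countE; set U := (\prod_(u : upper_index r) _)%N.
pose S := (\sum_a e a)%N.
have prodE (I : finType) (f : I -> nat) : (\prod_i p ^ f i = p ^ \sum_i f i)%N.
  by rewrite (big_morph _ (expnD p) (expn0 p)).
have UE : (U * (p ^ S) ^ r.+1)%N = (q ^ #|upper_index r|)%N.
  rewrite -expnM [(S * _)%N]mulnC -sum_upper_index -prodE -big_split /=.
  rewrite (eq_bigr (fun=> q)) => [|u _]; last by rewrite -expnD subnK.
  by rewrite prod_nat_const.
have AE : (\prod_a #|annihilator weight1 a| * p ^ S = q ^ r)%N.
  rewrite -prodE -big_split /= (eq_bigr (fun=> q)) => [|a _]; last first.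
    by rewrite card_Zq_ann ?leq_subr// -expnD subnK.
  by rewrite prod_nat_const card_ord.
have sE : symcount R p l r = (q ^ #|upper_index r|)%:R.
  rewrite /symcount symsum_symx sumr_constE mulr1 card_ffun card_ord.
  by rewrite Zp_cast ?q1.
rewrite sE cardG prodE -/S -UE expnM -AE expnMn.
set A := (\prod_a _)%N; set P := (p ^ S)%N.
have P0 : P%:R != 0 :> R by rewrite pnatr_eq0 -lt0n expn_gt0 prime_gt0.
have A0 : A%:R != 0 :> R.
  by have : (0 < q ^ r)%N; [rewrite expn_gt0 expn_gt0 prime_gt0|rewrite -AE muln_gt0 pnatr_eq0 -lt0n => /andP[]].
have U0 : U%:R != 0 :> R.
  have : (0 < q ^ #|upper_index r|)%N by rewrite expn_gt0 expn_gt0 prime_gt0.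
  by rewrite -UE muln_gt0 pnatr_eq0 -lt0n => /andP[].
clear UE AE sE; clearbody P A; rewrite !natrM !natrX exprS.
by field; rewrite P0 U0 !expf_neq0.
Qed.

Section nonsingular_iso.
Variables (d : measure_display) (T : measurableType d).
Variables (P : probability T R) (n : nat) (M : T -> 'M[int]_n).
Hypothesis Msym : forall t, (M t)^T = M t.
Hypothesis Mmeas : forall u, int_random_variable (upper_entry M u).
Hypothesis Mindep : mutually_independent P (upper_entry M).

Lemma nonsingular_iso_prob :
  P [set t | \det (M t) != 0 /\ pairing_isomorphic (@sylow_pairing p n (M t)) bG] =
  (expect (@residue_law R d T P n M p l) (fun B => weighted_count weight1 weight2
      target (fun=> 1) B * (kercard p_pr B == p ^ r)%N%:R) /
    (\prod_a #|annihilator weight1 a|)%:R ^+ n / #|pairing_Aut bG|%:R)%:E.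
Proof.
pose iso (B : 'M[int]_n) : bool :=
  `[< \det B != 0 /\ pairing_isomorphic (@sylow_pairing p n B) bG >].
pose ind (B : 'M['Z_q]_n) := iso (int_lift B).
set A := (\prod_a _)%N; set c := #|pairing_Aut bG|.
have wc B := weighted_count_iso (M := B) (n := n).
have c0 : c%:R != 0 :> R.
  rewrite pnatr_eq0 -lt0n; apply/card_gt0P; exists 1%g; rewrite inE group1 /=.
  by apply/forallP => x; apply/forallP => y; rewrite !perm1.
have A0 : A%:R != 0 :> R.
  rewrite pnatr_eq0 -lt0n prodn_gt0// => a; apply/card_gt0P; exists 0.
  by rewrite inE mulr0.
have cA : c%:R * A%:R ^+ n != 0 :> R by rewrite mulf_neq0 ?expf_neq0.
(* The event depends on B only modulo q: [weighted_count_iso] gives the same count for B and for the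
   integral lift of its residues. *)
have indE (B : 'M[int]_n) : B^T = B -> ind (map_mx intr B) = iso B.
  move=> Bs; pose Bq : 'M['Z_q]_n := map_mx intr B.
  have Bs' : (int_lift Bq)^T = int_lift Bq by rewrite /int_lift map_trmx /Bq map_trmx Bs.
  have := wc _ Bs'; rewrite int_liftK (wc _ Bs) => /(mulIf cA).
  rewrite -/(iso B) -/(iso (int_lift _)) /ind.
  by case: (iso B); case: (iso _) => // /eqP; rewrite ?oner_eq0 ?(eq_sym 0) ?oner_eq0.
have -> : [set t | \det (M t) != 0 /\ pairing_isomorphic (@sylow_pairing p n (M t)) bG] =
    [set t | ind (map_mx intr (M t))].
  by apply/seteqP; split=> t /=; rewrite indE// /iso => /asboolP.
rewrite (residue_expect Msym Mmeas Mindep); congr EFin.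
rewrite -mulrA -invfM mulrC -expectZ; apply: eq_expect => B Bs.
have Bs' : (int_lift B)^T = int_lift B by rewrite /int_lift map_trmx Bs.
have := wc _ Bs'; rewrite int_liftK => ->; rewrite -/(iso _) -/(ind B).
by rewrite mulrCA -mulrC [A%:R ^+ n * _]mulrC mulVf ?mul1r.
Qed.

End nonsingular_iso.

End presented_pairing.

Theorem theorem1p3 (R : realType) (alpha : R) (p : nat)
  (halpha : 0 < alpha < 1) (hp : prime p)
  (d : nat -> measure_display)
  (Omega : forall n : nat, measurableType (d n))
  (P : forall n : nat, probability (Omega n) R)
  (M : forall n : nat, Omega n -> 'M[int]_n)
  (hsym : forall (n : nat) (w : Omega n), (M n w)^T = M n w)
  (hmeas : forall (n : nat) (ij : upper_index n),
     int_random_variable (upper_entry (M n) ij))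
  (hindep : forall n : nat, mutually_independent (P n) (upper_entry (M n)))
  (hbal : forall (n : nat) (ij : upper_index n) (t : int),
     (P n [set w | (upper_entry (M n) ij w = t %[mod p])%Z] <= (1 - alpha)%:E)%E)
  (G : finZmodType) (hG : (p.-group [set: G]%SET)%g)
  (bG : G -> G -> QmodZ) (hbG : is_duality_pairing bG) :
  P n [set w | pairing_isomorphic (@sylow_pairing p n (M n w)) bG] @[n --> \oo]
    --> (odd_power_product R p / (#|G| * #|pairing_Aut bG|)%N%:R)%:E.
Proof.
have [r [e [g [e0 gen rel cardG]]]] := zmod_basis hG.
pose k a := projT1 (cid (dual_basis_exists hbG hp gen rel a)).
have kP a (c : 'I_r -> int) :
    bG (k a) (\sum_b g b *~ c b) = qz ((c a)%:~R / (p ^ e a)%:R).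
  exact: (projT2 (cid (dual_basis_exists hbG hp gen rel a)) c).
pose theta a := projT1 (cid (gen (k a))).
have kE a : k a = \sum_b g b *~ theta a b := projT2 (cid (gen (k a))).
(* The modulus q has to be divisible by p^(e a + e b) for all a and b; twice the sum of the
   exponents is ample. *)
pose l := (\sum_a e a + \sum_a e a)%N.
have e_le a : (e a <= \sum_b e b)%N by rewrite (bigD1 a)//= leq_addr.
have el2 a b : (e a + e b <= l.+1)%N by apply/leqW/leq_add; exact: e_le.
pose iso n := [set w | pairing_isomorphic (@sylow_pairing p n (M n w)) bG].
pose good n := [set w | \det (M n w) != 0 /\ pairing_isomorphic (@sylow_pairing p n (M n w)) bG].
pose sing n := [set w | \det (M n w) = 0].
have misoE n : measurable (iso n).
  exact: (measurable_matrix_event (@hsym n) (@hmeas n)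
    [set B | pairing_isomorphic (@sylow_pairing p n B) bG]).
have mgood n : measurable (good n).
  exact: (measurable_matrix_event (@hsym n) (@hmeas n)
    [set B | \det B != 0 /\ pairing_isomorphic (@sylow_pairing p n B) bG]).
have msing n : measurable (sing n).
  exact: (measurable_matrix_event (@hsym n) (@hmeas n) [set B | \det B = 0]).
have fin n (A : set (Omega n)) : measurable A -> P n A \is a fin_num.
  by move=> mA; rewrite fin_num_measure.
pose w l' n := @residue_law R (d n) (Omega n) (P n) n (M n) p l'.
have law l' n : is_law (w l' n) by exact: residue_is_law.
have bal l' n : balanced hp alpha (w l' n) by exact: residue_balanced.
have good_cvg : fine (P n (good n)) @[n --> \oo] -->
    odd_power_product R p / (#|G| * #|pairing_Aut bG|)%N%:R.
  have := expect_limit (@weight1_red p r e hp e0 l el2)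
    (quad_cond_full hbG hp e0 gen rel kP kE el2) halpha
    (law l) (bal l).
  rewrite (quad_constE hbG hp kP kE R cardG el2) => lim.
  rewrite natrM invfM mulrA [_ / #|G|%:R]mulrC.
  under eq_fun do rewrite (nonsingular_iso_prob hbG hp e0 gen rel kP kE cardG el2
    (@hsym _) (@hmeas _) (hindep _)) /=.
  by apply: cvgM => //; exact: cvg_cst.
(* Each eps gets a modulus of its own: the bound 2 / p^l' holds for all n beyond a threshold
   depending on l'. *)
have sing_cvg : fine (P n (sing n)) @[n --> \oo] --> (0 : R).
  apply/cvgrPdist_le => eps eps0.
  have [l' _ small] : \forall l' \near \oo, (p%:R^-1 : R) ^+ l' <= eps / 2.
    apply: near_expr_le; last by rewrite divr_gt0.
    by rewrite invr_ge0 ler0n /= invf_lt1 ?ltr0n ?ltr1n ?prime_gt0 ?prime_gt1.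
  apply: filterS (null_count_expect l' hp halpha) => n null2.
  rewrite sub0r normrN ger0_norm ?fine_ge0 ?measure_ge0//.
  have := singular_prob (@hsym n) (@hmeas n) (hindep n) (null2 _
    (law l' n) (bal l' n)).
  rewrite -[X in (X <= _)%E]fineK ?fin// lee_fin => /le_trans; apply.
  have := small l' (leqnn l'); rewrite ler_pdivlMr// mulrC exprVn natrX.
  exact.
apply: cvg_EFin; first by near=> n; exact: fin.
apply: (@squeeze_cvgr _ _ _ _ (fun n => fine (P n (good n)))
  (fun n => fine (P n (good n)) + fine (P n (sing n)))); last 2 first.
- exact: good_cvg.
- by rewrite -[X in _ --> X]addr0; apply: cvgD.
near=> n; rewrite /=; apply/andP; split.
  rewrite -lee_fin !fineK ?fin//; apply: le_measure; rewrite ?inE//.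
  by move=> t [].
rewrite -lee_fin EFinD !fineK ?fin//.
apply: (@le_trans _ _ (P n (good n `|` sing n))); last exact: measureU2.
apply: le_measure; rewrite ?inE//; first exact: measurableU.
by move=> t isot; have [d0|d0] := eqVneq (\det (M n t)) 0; [right|left].
Unshelve. all: by end_near. Qed.
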